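(* Let $V_0\in L^2(\mathbb{T}^d;\mathbb{R}^d)$ be a divergence-free vector field of zero spatial mean with $\nabla V_0\in L^2(\mathbb{T}^d;\mathbb{R}^{d\times d})$, and let $\bar V\in L^2(0,T;L^2(\mathbb{T}^d;\mathbb{R}^d))$ and $\bar W\in L^2(0,T;L^2(\mathbb{T}^d;\mathbb{R}^{d\times d}))$. Then the sup-inf problem $$\mathcal{J}_{NS}[\bar V,\bar W](V_0):=\sup_{(\mathbb{E},B,\chi)\in\mathcal{EB}\Psi^\nu_{2,\infty,2}}\ \inf_{V,W}\Bigg(\int_0^T\!\!\int_{\mathbb{T}^d}V^i\mathbb{E}_i+\tfrac12V^iV^j(2B_{ij}+a_V\delta_{ij})+\tfrac{a_V}{2}\bar V^i(\bar V^i-2V^i)\,dx\,dt$$ $$+\int_0^T\!\!\int_{\mathbb{T}^d}\tfrac{a_W}{2}W^{ij}W^{ij}-W^{ij}(B_{ij}-\chi_{ij})+\tfrac{a_W}{2}\bar W^{ij}\bar W^{ij}-a_W\bar W^{ij}W^{ij}\,dx\,dt$$ $$-\int_0^T\!\!\int_{\mathbb{T}^d}\big(V_0^i(x)\,\mathbb{E}_i(t,x)+2\nu\,\partial_lV_0^i(x)\,\chi_{il}(t,x)\big)\,dx\,dt\Bigg),$$ where the infimum is over $V\in L^2(0,T;L^2(\mathbb{T}^d;\mathbb{R}^d))$ and $W\in L^2(0,T;L^2(\mathbb{T}^d;\mathbb{R}^{d\times d}))$, admits a solution $(\mathbb{E},B,\chi)\in\mathcal{EB}\Psi^\nu_{2,\infty,2}$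 (i.e. the supremum is attained). In addition, $B$ belongs to $C^{1/2}([0,T],C^2(\mathbb{T}^d)'_{w*})$.
   Context: Here $d\in\{2,3\}$, $\mathbb{T}^d=\mathbb{R}^d/\mathbb{Z}^d$, $T>0$, $\nu>0$ (viscosity), $a_V>0$, $a_W>0$ are fixed, repeated indices are summed from $1$ to $d$, and $\partial_i$, $\nabla$, $\Delta$ act in the space variable; $\Delta^{-1}$ is the inverse Laplacian on mean-zero functions/distributions on $\mathbb{T}^d$. $\mathcal{EB}\Psi^\nu_{2,\infty,2}$ is the class of all triples $(\mathbb{E},B,\chi)$ in $L^2\times L^\infty\times L^2$ on $[0,T]\times\mathbb{T}^d$, with $\mathbb{E}$ valued in $\mathbb{R}^d$ and $B,\chi$ valued in symmetric $d\times d$ matrices, satisfying weakly, together with $B(T,\cdot)\equiv0$, $$\partial_tB_{ij}=\tfrac12(\partial_j\mathbb{E}_i+\partial_i\mathbb{E}_j)-\partial_i\partial_j\Delta^{-1}(\partial_l\mathbb{E}_l-2\nu\,\partial_l\partial_k\chi_{lk})-\nu(\partial_j\partial_l\chi_{li}+\partial_i\partial_l\chi_{lj}).$$ ''Weakly, with $B(T,\cdot)\equiv 0$'' means: for every smooth symmetric-matrix-valued $\psi$ on $[0,T]\times\mathbb{T}^d$ with $\psi(0,\cdot)=0$, $$-\int_0^T\!\!\int_{\mathbb{T}^d}B_{ij}\partial_t\psi_{ij}=\int_0^T\!\!\int_{\mathbb{T}^d}\Big(-\mathbb{E}_i\partial_j\psi_{ij}+\mathbb{E}_l\partial_l\Delta^{-1}\partial_i\partial_j\psi_{ij}+2\nu\chi_{lk}\partial_l\partial_k\Delta^{-1}\partial_i\partial_j\psi_{ij}-2\nu\chi_{li}\partial_l\partial_j\psi_{ij}\Big).$$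 (Formally $\mathbb{E}_i=\partial_t\lambda_i+\partial_i\gamma+2\nu\partial_l\chi_{il}$ and $B_{ij}=\frac12(\partial_i\lambda_j+\partial_j\lambda_i)$ for a divergence-free $\lambda$ with $\lambda(T,\cdot)=0$ and a scalar $\gamma$.) $C^2(\mathbb{T}^d)'_{w*}$ is the dual of the space of $C^2$ symmetric-matrix-valued functions on $\mathbb{T}^d$ with its weak-* topology; $B\in C^{1/2}([0,T],C^2(\mathbb{T}^d)'_{w*})$ means that (for a suitable representative in time) $t\mapsto\int_{\mathbb{T}^d}B_{ij}(t,x)\psi_{ij}(x)\,dx$ is $\frac12$-Hölder continuous on $[0,T]$ for each such $\psi$. *)

(* Defs.v *)
From HB Require Import structures.
From mathcomp Require Import all_boot all_order all_algebra.
From mathcomp Require Import all_classical all_reals all_analysis.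

Set Implicit Arguments.
Unset Strict Implicit.
Unset Printing Implicit Defensive.

Import Order.TTheory GRing.Theory Num.Theory.
Import numFieldNormedType.Exports.

Local Open Scope classical_set_scope.
Local Open Scope ring_scope.

(* Row vectors carry the sigma-algebra generated by their coordinates. *)
Definition rV_display : measure_display.
Proof. exact: default_measure_display. Qed.

Section measurable_rV.
Context {R : realType} (n : nat).

Let coor (i : 'I_n) (x : 'rV[R]_n) : R := x 0 i.

Let rV_set0 : g_sigma_preimage coor set0.
Proof. exact: sigma_algebra0. Qed.

Let rV_setC A : g_sigma_preimage coor A -> g_sigma_preimage coor (~` A).
Proof. exact: sigma_algebraC. Qed.

Let rV_bigcup (F : _^nat) : (forall i, g_sigma_preimage coor (F i)) ->
  g_sigma_preimage coor (\bigcup_i (F i)).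
Proof. exact: sigma_algebra_bigcup. Qed.

HB.instance Definition _ := @isMeasurable.Build
  rV_display 'rV[R]_n
  (g_sigma_preimage coor) rV_set0 rV_setC rV_bigcup.

End measurable_rV.

Lemma measurable_rV_coord (R : realType) n (i : 'I_n) :
  measurable_fun [set: 'rV[R]_n] (fun x : 'rV[R]_n => x 0 i).
Proof.
move=> _ Y mY; rewrite setTI; apply: sub_sigma_algebra => /=.
rewrite -bigcup_seq/=; exists i => /=; first by rewrite mem_index_enum.
by exists Y => //; rewrite setTI.
Qed.

Lemma measurable_rVP (R : realType) d (U : measurableType d) n
    (f : U -> 'rV[R]_n) :
  (forall i, measurable_fun [set: U] (fun u => f u 0 i)) ->
  measurable_fun [set: U] f.
Proof.
move=> mf.
have sub : g_sigma_preimage (fun (i : 'I_n) u => f u 0 i) `<=` measurable.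
  apply: smallest_sub; first exact: sigma_algebra_measurable.
  case: n f mf => [|n] f mf; first by rewrite big_ord0.
  rewrite -bigcup_mkord_ord; apply: bigcup_sub => i _ A [B mB <-].
  exact: mf.
move=> _ A mA; rewrite setTI; apply: sub.
have -> : g_sigma_preimage (fun (i : 'I_n) u => f u 0 i) =
    preimage_set_system [set: U] f
      (g_sigma_preimage (fun (i : 'I_n) (x : 'rV[R]_n) => x 0 i)).
  exact: (g_sigma_preimage_comp (fun (i : 'I_n) (x : 'rV[R]_n) => x 0 i) f).
by exists A => //; rewrite setTI.
Qed.

Section torus_measure.
Context {R : realType}.
Local Open Scope ereal_scope.

Definition rV_cons n (p : R * 'rV[R]_n) : 'rV[R]_n.+1 :=
  row_mx (const_mx p.1 : 'rV[R]_1) p.2.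

Lemma measurable_rV_cons n : measurable_fun [set: R * 'rV[R]_n] (@rV_cons n).
Proof.
apply: measurable_rVP => i; rewrite /rV_cons.
rewrite -(fintype.splitK (i : 'I_(1 + n)%N)).
case: (fintype.split _) => j /=.
  apply: eq_measurable_fun (measurable_fst) => p _ /=.
  by rewrite mxE (unsplitK (inl j)) mxE.
apply: eq_measurable_fun (measurableT_comp (measurable_rV_coord j)
  measurable_snd) => p _ /=.
by rewrite mxE (unsplitK (inr j)).
Qed.

HB.instance Definition _ n :=
  isMeasurableFun.Build _ _ _ _ (@rV_cons n) (@measurable_rV_cons n).

Definition leb0 (T : R) : set R -> \bar R :=
  mrestr (@lebesgue_measure R) (measurable_itv `[0%R, T]).

Section leb0_measure.
Variable T : R.

Let mu : {measure set (measurableTypeR R) -> \bar R} :=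
  mrestr (@lebesgue_measure R) (measurable_itv `[0%R, T]).

Let leb0_0 : leb0 T set0 = 0.
Proof. exact: (measure0 mu). Qed.

Let leb0_ge0 A : 0 <= leb0 T A.
Proof. exact: (measure_ge0 mu). Qed.

Let leb0_sigma_additive : semi_sigma_additive (leb0 T).
Proof. exact: (@measure_semi_sigma_additive _ _ _ mu). Qed.

HB.instance Definition _ := isMeasure.Build _ _ _ (leb0 T)
  leb0_0 leb0_ge0 leb0_sigma_additive.

End leb0_measure.

Lemma leb0_fin (T : R) : fin_num_fun (leb0 T).
Proof.
move=> A mA; rewrite ge0_fin_numE//.
apply: (@le_lt_trans _ _ (@lebesgue_measure R `[0%R, T]%classic)).
  by apply: measureIr.
by rewrite lebesgue_measure_itv /=; case: ifP => //; rewrite ltry.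
Qed.

HB.instance Definition _ (T : R) :=
  Measure_isFinite.Build _ _ _ (leb0 T) (@leb0_fin T).

Section finite.
Context {n : nat} (mu : {finite_measure set 'rV[R]_n -> \bar R}).

Definition time_product (T : R) : set (R * 'rV[R]_n) -> \bar R := leb0 T \x mu.

HB.instance Definition _ (T : R) := Measure.on (time_product T).

Lemma time_product_fin (T : R) : fin_num_fun (time_product T).
Proof.
move=> A mA; rewrite ge0_fin_numE//.
apply: (@le_lt_trans _ _ (time_product T setT)).
  by apply: le_measure; rewrite ?inE.
rewrite -setXTT /time_product product_measure1E//.
by rewrite lte_mul_pinfty// ?ge0_fin_numE// -ge0_fin_numE// fin_num_measure.
Qed.

HB.instance Definition _ (T : R) :=
  Measure_isFinite.Build _ _ _ (time_product T) (time_product_fin T).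

Definition cube_step : set 'rV[R]_n.+1 -> \bar R :=
  pushforward (time_product 1%R) (@rV_cons n).

Let cube_step0 : cube_step set0 = 0.
Proof. exact: measure0. Qed.

Let cube_step_ge0 A : 0 <= cube_step A.
Proof. exact: measure_ge0. Qed.

Let cube_step_sigma_additive : semi_sigma_additive cube_step.
Proof. exact: measure_semi_sigma_additive. Qed.

HB.instance Definition _ := isMeasure.Build _ _ _ cube_step
  cube_step0 cube_step_ge0 cube_step_sigma_additive.

Lemma cube_step_fin : fin_num_fun cube_step.
Proof.
move=> A mA; apply: time_product_fin.
by have := measurable_rV_cons measurableT mA; rewrite setTI.
Qed.

HB.instance Definition _ := Measure_isFinite.Build _ _ _ cube_step cube_step_fin.

End finite.
End torus_measure.

(* T^d is the unit cube with opposite faces identified: functions on T^d are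
   Z^d-periodic functions on R^d, and integration over T^d is integration
   against [torus_measure], the Lebesgue measure of the unit cube. Periodicity
   is only required of smooth functions: elements of L^p are only seen through
   their values on the cube. *)
Fixpoint torus_measure {R : realType} (n : nat) :
    {finite_measure set 'rV[R]_n -> \bar R} :=
  if n is m.+1 then @cube_step R m (torus_measure m)
  else \d_(0 : 'rV[R]_0).

Definition spacetime (R : realType) (d : nat) (T : R) :
    {finite_measure set (R * 'rV[R]_d)%type -> \bar R} :=
  time_product (torus_measure d) T.

Section function_spaces.
Context {R : realType}.

Fixpoint Ck {V : normedModType R} (k : nat) (f : V -> R) : Prop :=
  continuous f /\
  if k is k'.+1 then
    forall v, (forall x, derivable f x v) /\ Ck k' (fun x => 'D_v f x)
  else True.

Definition smooth {V : normedModType R} (f : V -> R) := forall k, Ck k f.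

Definition torus_periodic {d} (f : 'rV[R]_d -> R) :=
  forall x (i : 'I_d), f (x + delta_mx 0 i) = f x.

Definition spartial {d} (i : 'I_d) (f : 'rV[R]_d -> R) : 'rV[R]_d -> R :=
  fun x => 'D_(delta_mx 0 i) f x.

Definition tpartial {d} (f : R -> 'rV[R]_d -> R) : R -> 'rV[R]_d -> R :=
  fun t x => derive1 (fun s => f s x) t.

Definition laplacian {d} (f : 'rV[R]_d -> R) : 'rV[R]_d -> R :=
  fun x => \sum_i spartial i (spartial i f) x.

Definition smooth_torus {d} (f : 'rV[R]_d -> R) := smooth f /\ torus_periodic f.

(* Smooth functions on [0,T] x T^d are given by smooth extensions to R x T^d. *)
Definition smooth_spacetime {d} (f : R -> 'rV[R]_d -> R) :=
  smooth (fun z : R * 'rV[R]_d => f z.1 z.2) /\ forall t, torus_periodic (f t).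

(* [is_invlaplacian f u] is u = Delta^-1 f: the graph of the inverse Laplacian
   on smooth functions, functional and defined exactly when f has zero mean. *)
Definition is_invlaplacian {d} (f u : 'rV[R]_d -> R) :=
  [/\ smooth_torus u, (\int[torus_measure d]_x u x) = 0
    & forall x, laplacian u x = f x].

Definition divdiv {d} (psi : 'rV[R]_d -> 'M[R]_d) : 'rV[R]_d -> R :=
  fun x => \sum_i \sum_j spartial i (spartial j (fun y => psi y i j)) x.

Definition symmetric_mx {d} (A : 'M[R]_d) := A^T = A.

Definition Lvec {d} {disp} {U : measurableType disp}
    (mu : {measure set U -> \bar R}) (p : \bar R) (v : U -> 'rV[R]_d) :=
  forall i, (fun z => v z 0 i) \in Lfun mu p.

Definition Lmat {d} {disp} {U : measurableType disp}
    (mu : {measure set U -> \bar R}) (p : \bar R) (A : U -> 'M[R]_d) :=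
  forall i j, (fun z => A z i j) \in Lfun mu p.

Definition zero_mean {d} (v : 'rV[R]_d -> 'rV[R]_d) :=
  forall i, (\int[torus_measure d]_x v x 0 i) = 0.

Definition weakly_divergence_free {d} (v : 'rV[R]_d -> 'rV[R]_d) :=
  forall f, smooth_torus f ->
    (\int[torus_measure d]_x (\sum_i v x 0 i * spartial i f x)) = 0.

(* [G x l i] is the distributional derivative d_l v^i. *)
Definition is_weak_gradient {d} (v : 'rV[R]_d -> 'rV[R]_d)
    (G : 'rV[R]_d -> 'M[R]_d) :=
  forall f, smooth_torus f -> forall l i,
    (\int[torus_measure d]_x (v x 0 i * spartial l f x)) =
    - (\int[torus_measure d]_x (G x l i * f x)).

End function_spaces.

Section dual_problem.
Context {R : realType} {d : nat}.
Variables (T nu aV aW : R).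

Notation point := (R * 'rV[R]_d)%type.
Notation Q := (spacetime d T).

(* L^2(0,T; L^2(T^d)) is identified with L^2 of [0,T] x T^d throughout.
   The constraint tested against psi, with phi = Delta^-1 d_i d_j psi_ij. *)
Definition EB_equation (E : point -> 'rV[R]_d) (B chi : point -> 'M[R]_d) :=
  forall (psi : R -> 'rV[R]_d -> 'M[R]_d) (phi : R -> 'rV[R]_d -> R),
    (forall i j, smooth_spacetime (fun t x => psi t x i j)) ->
    (forall t x, symmetric_mx (psi t x)) ->
    (forall x, psi 0 x = 0) ->
    smooth_spacetime phi ->
    (forall t, is_invlaplacian (divdiv (psi t)) (phi t)) ->
    - (\int[Q]_z (\sum_i \sum_j
        B z i j * tpartial (fun t x => psi t x i j) z.1 z.2)) =
    (\int[Q]_z (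
      - (\sum_i \sum_j E z 0 i * spartial j (fun x => psi z.1 x i j) z.2)
      + \sum_l E z 0 l * spartial l (phi z.1) z.2
      + 2 * nu * (\sum_l \sum_k
          chi z l k * spartial l (spartial k (phi z.1)) z.2)
      - 2 * nu * (\sum_i \sum_j \sum_l
          chi z l i * spartial l (spartial j (fun x => psi z.1 x i j)) z.2))).

Definition EBPsi (E : point -> 'rV[R]_d) (B chi : point -> 'M[R]_d) :=
  [/\ Lvec Q 2%:E E, Lmat Q +oo%E B, Lmat Q 2%:E chi,
      (forall z, symmetric_mx (B z)) /\ (forall z, symmetric_mx (chi z))
    & EB_equation E B chi].

Variables (Vbar : point -> 'rV[R]_d) (Wbar : point -> 'M[R]_d).
Variables (V0 : 'rV[R]_d -> 'rV[R]_d) (gradV0 : 'rV[R]_d -> 'M[R]_d).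

Definition lagrangian (E : point -> 'rV[R]_d) (B chi : point -> 'M[R]_d)
    (V : point -> 'rV[R]_d) (W : point -> 'M[R]_d) : R :=
  (\int[Q]_z (
      (\sum_i V z 0 i * E z 0 i)
    + 2^-1 * (\sum_i \sum_j
        V z 0 i * V z 0 j * (2 * B z i j + aV * (i == j)%:R))
    + aV / 2 * (\sum_i Vbar z 0 i * (Vbar z 0 i - 2 * V z 0 i))))
  + (\int[Q]_z (
      aW / 2 * (\sum_i \sum_j W z i j * W z i j)
    - (\sum_i \sum_j W z i j * (B z i j - chi z i j))
    + aW / 2 * (\sum_i \sum_j Wbar z i j * Wbar z i j)
    - aW * (\sum_i \sum_j Wbar z i j * W z i j)))
  - (\int[Q]_z (
      (\sum_i V0 z.2 0 i * E z 0 i)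
    + 2 * nu * (\sum_l \sum_i gradV0 z.2 l i * chi z i l))).

Definition dual_functional (E : point -> 'rV[R]_d) (B chi : point -> 'M[R]_d)
    : \bar R :=
  ereal_inf [set y | exists V W,
    [/\ Lvec Q 2%:E V, Lmat Q 2%:E W & y = (lagrangian E B chi V W)%:E]].

Definition J_NS : \bar R :=
  ereal_sup [set y | exists E B chi,
    EBPsi E B chi /\ y = dual_functional E B chi].

End dual_problem.

(* B \in C^{1/2}([0,T], C^2(T^d)'_{w*}): the curve t |-> B(t,.) agrees for
   a.e. t with a curve of integrable matrix fields whose pairing with every
   C^2 symmetric matrix field is 1/2-Hoelder on the whole of [0,T]. *)
Definition holder_half_weakstar {R : realType} {d : nat} (T : R)
    (B : R * 'rV[R]_d -> 'M[R]_d) :=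
  exists Bt : R -> 'rV[R]_d -> 'M[R]_d,
  [/\ \forall t \ae leb0 T, \forall x \ae torus_measure d, Bt t x = B (t, x),
      forall t, t \in `[0, T] -> Lmat (torus_measure d) 1 (Bt t)
    & forall psi : 'rV[R]_d -> 'M[R]_d,
      (forall i j, Ck 2 (fun x => psi x i j) /\ torus_periodic (fun x => psi x i j)) ->
      (forall x, symmetric_mx (psi x)) ->
      let pairing t :=
        \int[torus_measure d]_x (\sum_i \sum_j Bt t x i j * psi x i j) in
      exists C, forall s t, s \in `[0, T] -> t \in `[0, T] ->
        `|pairing t - pairing s| <= C * Num.sqrt `|t - s| ].

(* Main.v *)
(* The supremum is attained because a concave maximisation problem that is
   coercive in L^2 needs no weak compactness: the sets of almost maximisers are
   convex, nested and bounded, and their elements of almost minimal norm form a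
   Cauchy sequence by the parallelogram identity.

   Coercivity. The identity matrix as a test direction in the constraint shows
   that B is trace free. Finiteness of the infimum over V forces 2 B + a_V I to
   be nonnegative, hence |B| <= (d + 1) a_V almost everywhere. Testing the
   infimum with V = V_0 - eps E and W = 2 nu (grad V_0)^T - eps chi, for a small
   eps, then bounds the L^2 norms of E and chi.

   Time regularity. Testing the constraint with t^n times a plane wave shows
   that each Fourier coefficient of B_ij is, for almost every t, the primitive
   of a function in L^2(0,T). By the estimates for Delta^-1 d_i d_j in H^2, the
   pairing of B_ij with a trigonometric polynomial eta is 1/2-Hoelder in time
   with constant at most C |eta|_{H^2}. Trigonometric polynomials are dense in
   C^2 for the H^2 norm: the jet of the residual of a best approximation is
   orthogonal to the jets of all waves, so its Fourier coefficients, multiplied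
   by 1 + |k|^2 + |k|^4 (up to factors 2 pi), vanish. *)
Require Import Defs.
From HB Require Import structures.
From mathcomp Require Import all_boot all_order all_algebra.
From mathcomp Require Import all_classical all_reals all_analysis.
From mathcomp Require Import measurable_realfun ess_sup_inf.
From mathcomp Require Import zify ring lra.

Set Implicit Arguments.
Unset Strict Implicit.
Unset Printing Implicit Defensive.

Import Order.TTheory GRing.Theory Num.Theory.
Import numFieldNormedType.Exports.

Local Open Scope classical_set_scope.
Local Open Scope ring_scope.

(** * Integrable and square-integrable functions *)

(** The consequences of the constraint are drawn from tests that are powers of time multiplied by
    plane waves: for these the potential Delta^-1 d_i d_j psi_ij is explicit, a Fourier multiplier.
    The price is that such products must be shown to separate integrable functions; this rests on
    the polynomials (1 - v^n)^(2^n), which, composed with a suitable u, tend to the indicator of an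
    interval. The limit must lie in the class itself. The term B_ij V^i V^j contains V^i V^j, which
    is only integrable, so it is passed to the limit by almost everywhere convergence and the
    uniform bound on B; limits superior taken at every point keep B and chi symmetric everywhere.
    The curve in time must be defined at every t, while the constraint describes only almost every
    slice of B. At an exceptional time a slice is built by the same minimal-norm argument, among
    bounded functions whose Fourier coefficients are close to the prescribed ones. The Hoelder
    constant may depend on the test only through its H^2 norm; hence increments of pairings are kept
    as exact space-time integrals, summed over the waves, and estimated only afterwards. *)

Section L1_L2.
Context {disp} {U : measurableType disp} {R : realType}.
Variable mu : {finite_measure set U -> \bar R}.
Implicit Types b f g h : U -> R.

Definition L1 f := mu.-integrable [set: U] (EFin \o f).

Definition L2 f := measurable_fun [set: U] f /\ L1 (fun x => f x ^+ 2).

Lemma L1_meas f : L1 f -> measurable_fun [set: U] f.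
Proof. by move=> /measurable_int /measurable_EFinP. Qed.

Lemma L2_meas f : L2 f -> measurable_fun [set: U] f.
Proof. by case. Qed.

Lemma L1_le f g : measurable_fun [set: U] f -> L1 g ->
  (forall x, `|f x| <= `|g x|) -> L1 f.
Proof.
move=> mf Lg fg; apply: le_integrable Lg => //; first exact/measurable_EFinP.
by move=> x _; rewrite /= lee_fin.
Qed.

Lemma L1D f g : L1 f -> L1 g -> L1 (fun x => f x + g x).
Proof. by move=> Lf Lg; apply: (integrableD measurableT Lf Lg). Qed.

Lemma L1Z (c : R) f : L1 f -> L1 (fun x => c * f x).
Proof. by move=> Lf; apply: (integrableZl measurableT c Lf). Qed.

Lemma L1N f : L1 f -> L1 (fun x => - f x).
Proof. by move=> Lf; apply: (integrableN Lf). Qed.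

Lemma L1B f g : L1 f -> L1 g -> L1 (fun x => f x - g x).
Proof. by move=> Lf Lg; exact: L1D Lf (L1N Lg). Qed.

Lemma L1_norm f : L1 f -> L1 (fun x => `|f x|).
Proof. by move=> Lf; apply: (integrable_norm Lf). Qed.

Lemma L1_cst (c : R) : L1 (fun=> c).
Proof. exact: finite_measure_integrable_cst. Qed.

Lemma L1_sum (I : Type) (s : seq I) (P : pred I) (F : I -> U -> R) :
  (forall i, P i -> L1 (F i)) -> L1 (fun x => \sum_(i <- s | P i) F i x).
Proof.
move=> LF; elim: s => [|i s IH].
  by under eq_fun do rewrite big_nil; exact: L1_cst.
under eq_fun do rewrite big_cons.
by case Pi : (P i); [exact: L1D (LF _ Pi) IH|exact: IH].
Qed.

Lemma RintgD f g : L1 f -> L1 g ->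
  \int[mu]_x (f x + g x) = \int[mu]_x f x + \int[mu]_x g x.
Proof. by move=> Lf Lg; exact: RintegralD. Qed.

Lemma RintgZ (c : R) f : L1 f -> \int[mu]_x (c * f x) = c * \int[mu]_x f x.
Proof. by move=> Lf; exact: RintegralZl. Qed.

Lemma RintgN f : L1 f -> \int[mu]_x (- f x) = - \int[mu]_x f x.
Proof.
move=> Lf; rewrite -[RHS]mulN1r -RintgZ//.
by apply: eq_Rintegral => x _; rewrite mulN1r.
Qed.

Lemma RintgB f g : L1 f -> L1 g ->
  \int[mu]_x (f x - g x) = \int[mu]_x f x - \int[mu]_x g x.
Proof. by move=> Lf Lg; exact: RintegralB. Qed.

Lemma Rintg0 : \int[mu]_x (0 : R) = 0.
Proof. by rewrite Rintegral_cst// mul0r. Qed.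

Lemma Rintg_cst (c : R) : \int[mu]_x c = c * fine (mu [set: U]).
Proof. by rewrite Rintegral_cst. Qed.

Lemma Rintg_sum (I : Type) (s : seq I) (P : pred I) (F : I -> U -> R) :
  (forall i, P i -> L1 (F i)) ->
  \int[mu]_x (\sum_(i <- s | P i) F i x) = \sum_(i <- s | P i) \int[mu]_x F i x.
Proof.
move=> LF; elim: s => [|i s IH].
  by under eq_Rintegral do rewrite big_nil; rewrite Rintg0 big_nil.
under eq_Rintegral do rewrite big_cons.
rewrite big_cons; case Pi : (P i); last exact: IH.
by rewrite RintgD ?IH//; [exact: LF|exact: L1_sum].
Qed.

Lemma Rintg_ge0 f : (forall x, 0 <= f x) -> 0 <= \int[mu]_x f x.
Proof. by move=> f0; apply: Rintegral_ge0. Qed.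

Lemma le_Rintg f g : L1 f -> L1 g -> (forall x, f x <= g x) ->
  \int[mu]_x f x <= \int[mu]_x g x.
Proof. by move=> Lf Lg fg; apply: le_Rintegral. Qed.

Lemma EFin_Rintg f : L1 f -> (\int[mu]_x f x)%:E = (\int[mu]_x (f x)%:E)%E.
Proof. by move=> Lf; rewrite fineK//; exact: integrable_fin_num. Qed.

Lemma ae_eq_Rintg f g : measurable_fun [set: U] f -> measurable_fun [set: U] g ->
  (\forall x \ae mu, f x = g x) -> \int[mu]_x f x = \int[mu]_x g x.
Proof.
move=> mf mg fg; rewrite /Rintegral; congr fine; apply: ae_eq_integral => //.
- exact/measurable_EFinP.
- exact/measurable_EFinP.
- by apply: filterS fg => x fgx _; rewrite /= fgx.
Qed.

Lemma L1_ae f g : measurable_fun [set: U] f -> L1 g ->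
  (\forall x \ae mu, f x = g x) -> L1 f.
Proof.
move=> mf Lg fg; apply/integrableP; split; first exact/measurable_EFinP.
have /integrableP[mg] := Lg; apply: le_lt_trans.
rewrite le_eqVlt; apply/orP; left; apply/eqP; apply: ae_eq_integral => //.
- by apply: measurableT_comp => //; exact/measurable_EFinP.
- by apply: measurableT_comp => //.
- by apply: filterS fg => x fgx _; rewrite /= fgx.
Qed.

(** As the domination holds only almost everywhere, |f| is first replaced by min(|f|, |g|), which is
    dominated everywhere and differs from |f| on a null set. *)
Lemma L1_ae_le f g : measurable_fun [set: U] f -> L1 g ->
  (\forall x \ae mu, `|f x| <= g x) -> L1 f.
Proof.
move=> mf Lg fg.
have mg := L1_meas Lg.
have Lh : L1 (fun x => Num.min `|f x| `|g x|).
  apply: (@L1_le _ g) => //.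
    by apply: measurable_minr; apply: measurableT_comp.
  by move=> x; rewrite ger0_norm ?ge_min ?lexx ?orbT// le_min !normr_ge0.
have Lnf : L1 (fun x => `|f x|).
  apply: L1_ae Lh _; first exact: measurableT_comp.
  apply: filterS fg => x fgx; rewrite min_l//.
  by rewrite (le_trans fgx)// ler_norm.
by apply: L1_le Lnf _ => // x; rewrite normr_id.
Qed.

Lemma ae_le_Rintg f g : L1 f -> L1 g -> (\forall x \ae mu, f x <= g x) ->
  \int[mu]_x f x <= \int[mu]_x g x.
Proof.
move=> Lf Lg fg.
have mf := L1_meas Lf; have mg := L1_meas Lg.
have Lh : L1 (fun x => Num.min (f x) (g x)).
  apply: L1_ae Lf _; first exact: measurable_minr.
  by apply: filterS fg => x fgx; rewrite min_l.
rewrite (@ae_eq_Rintg f (fun x => Num.min (f x) (g x)))//.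
- by apply: le_Rintg => // x; rewrite ge_min lexx orbT.
- exact: measurable_minr.
- by apply: filterS fg => x fgx; rewrite min_l.
Qed.

Lemma Rintg_eq0 f : L1 f -> (forall x, 0 <= f x) -> \int[mu]_x f x = 0 ->
  \forall x \ae mu, f x = 0.
Proof.
move=> Lf f0 If.
have mf := L1_meas Lf.
have : ae_eq mu setT (EFin \o f) (cst 0%E).
  apply/ae_eq_integral_abs => //; first exact/measurable_EFinP.
  under eq_integral do rewrite /= ger0_norm//.
  by rewrite -EFin_Rintg// If.
by apply: filterS => x /(_ I)[].
Qed.

Lemma dominated_cvg_Rintg (f_ : nat -> U -> R) f g :
  (forall n, measurable_fun [set: U] (f_ n)) -> measurable_fun [set: U] f ->
  L1 g -> (\forall x \ae mu, f_ n x @[n --> \oo] --> f x) ->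
  (\forall x \ae mu, forall n, `|f_ n x| <= g x) ->
  \int[mu]_x f_ n x @[n --> \oo] --> \int[mu]_x f x.
Proof.
move=> mf_ mf Lg f_f f_g.
have f_f' : {ae mu, forall x, [set: U] x ->
    (EFin \o f_ n) x @[n --> \oo] --> (EFin \o f) x}.
  apply: filterS f_f => x cx _; apply: cvg_EFin; first exact: nearW.
  exact: cx.
have [Lf _ cv] := @dominated_convergence _ _ _ mu setT measurableT
  (fun n => EFin \o f_ n) (EFin \o f) (EFin \o g)
  (fun n => (measurable_EFinP _ _).2 (mf_ n)) ((measurable_EFinP _ _).2 mf)
  f_f' Lg
  (filterS (fun x cx n _ => cx n) f_g).
move: cv; rewrite -EFin_Rintg//.
exact: fine_cvg.
Qed.

Lemma L1_bounded f (C : R) : measurable_fun [set: U] f ->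
  (\forall x \ae mu, `|f x| <= C) -> L1 f.
Proof. by move=> mf fC; apply: (L1_ae_le mf (L1_cst C)). Qed.

Lemma L2_bounded f (C : R) : measurable_fun [set: U] f ->
  (\forall x \ae mu, `|f x| <= C) -> L2 f.
Proof.
move=> mf fC; split=> //; apply: (@L1_bounded _ (C ^+ 2)).
  exact: measurable_funX.
by apply: filterS fC => x fxC; rewrite normrX lerXn2r ?nnegrE// (le_trans _ fxC).
Qed.

Lemma L2_cst (c : R) : L2 (fun=> c).
Proof. by apply: (@L2_bounded _ `|c|) => //; exact: aeW. Qed.

Lemma L2_mul f g : L2 f -> L2 g -> L1 (fun x => f x * g x).
Proof.
move=> [mf Lf] [mg Lg]; apply: (@L1_le _ (fun x => f x ^+ 2 + g x ^+ 2)).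
- exact: measurable_funM.
- exact: L1D.
- by move=> x; rewrite ler_norml ger0_norm ?addr_ge0 ?sqr_ge0//; apply/andP; nra.
Qed.

Lemma L2_L1 f : L2 f -> L1 f.
Proof.
move=> Lf; have := L2_mul (L2_cst 1) Lf.
by under eq_fun do rewrite mul1r.
Qed.

Lemma L2D f g : L2 f -> L2 g -> L2 (fun x => f x + g x).
Proof.
move=> [mf Lf] [mg Lg]; split; first exact: measurable_funD.
apply: (@L1_le _ (fun x => 2 * (f x ^+ 2 + g x ^+ 2))).
- by apply: measurable_funX; exact: measurable_funD.
- by apply: L1Z; exact: L1D.
- move=> x; have := sqr_ge0 (f x - g x); have := sqr_ge0 (f x + g x).
  have := sqr_ge0 (f x); have := sqr_ge0 (g x) => ????.
  by rewrite !ger0_norm//; nra.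
Qed.

Lemma L2Z (c : R) f : L2 f -> L2 (fun x => c * f x).
Proof.
move=> [mf Lf]; split; first exact: measurable_funM.
by under eq_fun do rewrite exprMn; exact: L1Z.
Qed.

Lemma L2N f : L2 f -> L2 (fun x => - f x).
Proof.
by move=> Lf; under eq_fun do rewrite -mulN1r; exact: L2Z.
Qed.

Lemma L2B f g : L2 f -> L2 g -> L2 (fun x => f x - g x).
Proof. by move=> Lf Lg; exact: L2D Lf (L2N Lg). Qed.

Lemma L2_sum (I : Type) (s : seq I) (P : pred I) (F : I -> U -> R) :
  (forall i, P i -> L2 (F i)) -> L2 (fun x => \sum_(i <- s | P i) F i x).
Proof.
move=> LF; elim: s => [|i s IH].
  by under eq_fun do rewrite big_nil; exact: L2_cst.
under eq_fun do rewrite big_cons.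
by case Pi : (P i); [exact: L2D (LF _ Pi) IH|exact: IH].
Qed.

Lemma L2_bddM b f (C : R) : measurable_fun [set: U] b ->
  (\forall x \ae mu, `|b x| <= C) -> L2 f -> L2 (fun x => b x * f x).
Proof.
move=> mb bC [mf Lf]; split; first exact: measurable_funM.
apply: (@L1_ae_le _ (fun x => C ^+ 2 * f x ^+ 2)).
- by apply: measurable_funX; exact: measurable_funM.
- exact: L1Z.
- apply: filterS bC => x bxC; rewrite exprMn normrM !normrX.
  rewrite (real_normK (num_real (f x))) ler_wpM2r ?sqr_ge0//.
  by rewrite lerXn2r ?nnegrE// (le_trans _ bxC).
Qed.

Lemma L1_bddM b f (C : R) : measurable_fun [set: U] b ->
  (\forall x \ae mu, `|b x| <= C) -> L1 f -> L1 (fun x => b x * f x).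
Proof.
move=> mb bC Lf; have mf := L1_meas Lf.
apply: (@L1_ae_le _ (fun x => C * `|f x|)).
- exact: measurable_funM.
- by apply: L1Z; exact: L1_norm.
- by apply: filterS bC => x bxC; rewrite normrM ler_wpM2r.
Qed.

Lemma Lfun2_L2 f : f \in Lfun mu 2%:E -> L2 f.
Proof.
move=> Lf; split; last exact: Lfun2_integrable_sqr.
by move: Lf; rewrite inE => /andP[]; rewrite inE.
Qed.

Lemma L2_Lfun2 f : L2 f -> f \in Lfun mu 2%:E.
Proof.
move=> [mf Lf]; rewrite inE; apply/andP; split; first by rewrite inE.
rewrite inE /= /finite_norm unlock /=.
apply: poweR_lty.
have /integrableP[_] := Lf; apply: le_lt_trans.
rewrite le_eqVlt; apply/orP; left; apply/eqP; apply: eq_integral => x _ /=.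
by rewrite powR_mulrn// normrX.
Qed.

Lemma cauchy_schwarz f g : L2 f -> L2 g ->
  (\int[mu]_x (f x * g x)) ^+ 2 <=
  (\int[mu]_x f x ^+ 2) * (\int[mu]_x g x ^+ 2).
Proof.
move=> Lf Lg.
set a := \int[mu]_x f x ^+ 2; set b := \int[mu]_x (f x * g x).
set c := \int[mu]_x g x ^+ 2.
(* The integral of (f - s g)^2, a nonnegative quadratic polynomial in s. *)
have H s : 0 <= a - 2 * s * b + s ^+ 2 * c.
  have : 0 <= \int[mu]_x (f x - s * g x) ^+ 2 by apply: Rintg_ge0 => x; exact: sqr_ge0.
  rewrite (_ : \int[mu]_x _ = a - 2 * s * b + s ^+ 2 * c)//.
  have L1b := L2_mul Lf Lg.
  have -> : \int[mu]_x (f x - s * g x) ^+ 2 =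
      \int[mu]_x (f x ^+ 2 - 2 * s * (f x * g x) + s ^+ 2 * g x ^+ 2).
    by apply: eq_Rintegral => x _; ring.
  have [L1f L1g] := (Lf.2, Lg.2).
  by rewrite RintgD ?RintgB ?RintgZ//; [exact: L1Z|apply: L1B => //|]; exact: L1Z.
have c0 : 0 <= c by apply: Rintg_ge0 => x; exact: sqr_ge0.
have a0 : 0 <= a by apply: Rintg_ge0 => x; exact: sqr_ge0.
have [c00|cN0] := eqVneq c 0.
  have [->|bN0] := eqVneq b 0; first by rewrite expr0n mulr_ge0.
  (* For c = 0 the quadratic is affine in s, and this s makes it equal to -1. *)
  have := H ((a + 1) / (2 * b)); rewrite c00.
  by rewrite (_ : 2 * _ * b = a + 1); [lra|field].
have cp : 0 < c by rewrite lt_neqAle eq_sym cN0.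
have := H (b / c).
rewrite (_ : _ + _ = (a * c - b ^+ 2) / c); last by field.
by rewrite pmulr_lge0 ?invr_gt0// subr_ge0.
Qed.

End L1_L2.

(** * Nested convex sets in L^2 *)

Section riesz_fischer.
Context {disp} {U : measurableType disp} {R : realType}.
Variable mu : {finite_measure set U -> \bar R}.
Implicit Types f g h : U -> R.

(** A limit superior is defined and measurable whether or not the sequence converges, and sequences
    that are equal at a point have equal values there. *)
Definition seq_lim (s : nat -> R) : R := fine (limn_esup (EFin \o s)).

Lemma seq_limE (s : nat -> R) (l : R) : s n @[n --> \oo] --> l -> seq_lim s = l.
Proof.
move=> sl; have esl : (EFin \o s) n @[n --> \oo] --> l%:E.
  by apply: cvg_EFin => //; exact: nearW.
by rewrite /seq_lim (cvg_limn_einf_sup esl).2.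
Qed.

Lemma measurable_seq_lim (u : nat -> U -> R) :
  (forall n, measurable_fun [set: U] (u n)) ->
  measurable_fun [set: U] (fun x => seq_lim (u ^~ x)).
Proof.
move=> mu_; apply: measurableT_comp => //.
apply: (@measurable_fun_limn_esup _ _ _ setT (fun n => EFin \o u n)) => n.
exact/measurable_EFinP.
Qed.

(** The increments have summable L^1 norms, so by monotone convergence the sum of their absolute
    values is finite almost everywhere, and the telescoping series converges absolutely. *)
Lemma fast_cauchy_ae_cvg (u : nat -> U -> R) : (forall n, L2 mu (u n)) ->
  (forall n k, (n <= k)%N ->
     \int[mu]_x (u k x - u n x) ^+ 2 <= (2 ^- n) ^+ 2) ->
  \forall x \ae mu, u n x @[n --> \oo] --> seq_lim (u ^~ x).
Proof.
move=> Lu Hu.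
pose h n x := `|u n.+1 x - u n x|.
have h0 n x : 0 <= h n x by exact: normr_ge0.
have Lh2 n : L2 mu (fun x => u n.+1 x - u n x) by exact: L2B.
have Lh n : L1 mu (h n) by apply: L1_norm; exact: L2_L1.
pose M := fine (mu setT).
have M0 : 0 <= M by exact: fine_ge0.
(* The inequality |y| <= (2^-n + 2^n y^2) / 2 turns the L^2 bound 4^-n into an L^1 bound of order
   2^-n. *)
have Ih n : \int[mu]_x h n x <= (M + 1) / (2 ^ n.+1)%:R.
  have L1h2 := (Lh2 n).2.
  have := @le_Rintg _ _ _ mu (h n)
    (fun x => 2^-1 * (2 ^- n + 2 ^+ n * (u n.+1 x - u n x) ^+ 2)) (Lh n).
  rewrite RintgZ; last by apply: L1D; [exact: L1_cst|exact: L1Z].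
  rewrite RintgD ?Rintg_cst ?RintgZ//; [|exact: L1_cst|exact: L1Z].
  move=> H; apply: (le_trans (H _ _)).
  - by apply: L1Z; apply: L1D; [exact: L1_cst|exact: L1Z].
  - move=> x; rewrite /h; set y := u n.+1 x - u n x.
    have t0 : (0 : R) < 2 ^+ n by rewrite exprn_gt0.
    rewrite -[y ^+ 2]real_normK ?num_real//.
    rewrite -subr_ge0 (_ : _ - _ = 2^-1 * (2 ^- n) * (1 - 2 ^+ n * `|y|) ^+ 2).
      by rewrite mulr_ge0 ?sqr_ge0// mulr_ge0 ?invr_ge0// ltW.
    by field; rewrite gt_eqF.
  - have := Hu n n.+1 (leqnSn n); rewrite -/M => Hn.
    have t0 : (0 : R) < 2 ^+ n by rewrite exprn_gt0.
    rewrite natrX exprS invfM mulrCA ler_wpM2l ?invr_ge0//.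
    rewrite mulrDl addrC mul1r [2 ^- n * M]mulrC addrC lerD2l.
    by rewrite -ler_pdivlMl// (le_trans Hn)// expr2.
pose g x := (\sum_(n <oo) (h n x)%:E)%E.
have mg : measurable_fun setT g.
  apply: ge0_emeasurable_sum => [n x _ _|n _]; first by rewrite lee_fin.
  apply/measurable_EFinP; exact: L1_meas (Lh n).
have g0 x : (0 <= g x)%E by apply: nneseries_ge0 => n _ _; rewrite lee_fin.
have Ig : (\int[mu]_x g x < +oo)%E.
  have mh n : measurable_fun setT (EFin \o h n).
    by apply/measurable_EFinP; exact: L1_meas (Lh n).
  rewrite /g (@integral_nneseries _ _ _ mu setT measurableT (fun n => EFin \o h n))//; last first.
    by move=> n x _; rewrite /= lee_fin.
  apply: (@le_lt_trans _ _ (M + 1)%:E); last by rewrite ltry.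
  apply: le_trans (epsilon_trick0 xpredT (addr_ge0 M0 ler01)).
  apply: lee_nneseries => [n _ _|n _].
    by apply: integral_ge0 => x _; rewrite lee_fin.
  by rewrite -EFin_Rintg// lee_fin.
have gfin : \forall x \ae mu, (g x < +oo)%E.
  have : mu.-integrable setT g.
    apply/integrableP; split=> //.
    under eq_integral do rewrite gee0_abs ?g0//.
    exact: Ig.
  move=> /(integrable_ae measurableT); apply: filterS => x /(_ I).
  by rewrite ge0_fin_numE.
apply: filterS gfin => x gx.
suff cu : cvgn (u ^~ x) by rewrite (seq_limE (l := limn (u ^~ x))).
have : cvgn (series (telescope (u ^~ x))).
  apply: normed_cvg; apply: nondecreasing_is_cvgn.
    by apply: nondecreasing_series => n _ _; exact: normr_ge0.
  exists (fine (g x)) => _ [n _ <-].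
  rewrite -lee_fin fineK ?ge0_fin_numE//.
  rewrite /series/= -sumEFin.
  by apply: (@nneseries_lim_ge _ (fun n => (h n x)%:E) xpredT 0%N n) => k _ _; rewrite lee_fin.
move=> cs.
have -> : u ^~ x = (fun=> u 0%N x) + series (telescope (u ^~ x)).
  by apply/funext => n; exact: (eq_sum_telescope (u ^~ x)).
by apply: is_cvgD => //; exact: is_cvg_cst.
Qed.

(** Fatou's lemma, applied to k |-> (u_(n+k) - u_n)^2, carries the Cauchy bound over to the almost
    everywhere limit. *)
Lemma fast_cauchy_L2 (u : nat -> U -> R) : (forall n, L2 mu (u n)) ->
  (forall n k, (n <= k)%N ->
     \int[mu]_x (u k x - u n x) ^+ 2 <= (2 ^- n) ^+ 2) ->
  L2 mu (fun x => seq_lim (u ^~ x)) /\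
  forall n, \int[mu]_x (u n x - seq_lim (u ^~ x)) ^+ 2 <= (2 ^- n) ^+ 2.
Proof.
move=> Lu Hu.
have cu := fast_cauchy_ae_cvg Lu Hu.
set v := fun x => seq_lim (u ^~ x).
have mv : measurable_fun setT v by apply: measurable_seq_lim => n; exact: (Lu n).1.
have E n : (\int[mu]_x ((u n x - v x) ^+ 2)%:E <= ((2 ^- n) ^+ 2)%:E)%E.
  pose F k x : \bar R := ((u (n + k)%N x - u n x) ^+ 2)%:E.
  have mF k : measurable_fun setT (F k).
    apply/measurable_EFinP; apply: measurable_funX.
    by apply: measurable_funB; exact: (Lu _).1.
  have F0 k x : setT x -> (0 <= F k x)%E by rewrite lee_fin sqr_ge0.
  have := fatou mu measurableT mF F0.
  rewrite (_ : (\int[mu]_x limn_einf (F ^~ x))%E = (\int[mu]_x ((u n x - v x) ^+ 2)%:E)%E).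
    move=> /le_trans; apply.
    rewrite limn_einf_lim; apply: lime_le; first exact: is_cvg_einfs.
    apply: nearW => k; apply: (@le_trans _ _ (\int[mu]_x F k x)%E).
      by apply: ereal_inf_lbound; exists k => /=.
    rewrite /F -EFin_Rintg; last by have [] := L2B (Lu (n + k)%N) (Lu n).
    by rewrite lee_fin Hu// leq_addr.
  apply: ae_eq_integral => //.
  - under eq_fun do rewrite -[limn_einf _]oppeK -limn_esupN.
    apply: measurableT_comp => //.
    apply: (@measurable_fun_limn_esup _ _ _ setT (fun k => -%E \o F k)) => k.
    exact: measurableT_comp.
  - by apply/measurable_EFinP; apply: measurable_funX; apply: measurable_funB => //; exact: (Lu _).1.
  apply: filterS cu => x cx _.
  suff : F ^~ x @ \oo --> ((u n x - v x) ^+ 2)%:E by move=> /cvg_limn_einf_sup[].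
  apply: cvg_EFin; first exact: nearW.
  have -> : (u n x - v x) ^+ 2 = (v x - u n x) ^+ 2 by ring.
  have cs : u (n + k)%N x @[k --> \oo] --> v x.
    exact: (@cvg_comp _ _ _ (addn n) (u ^~ x) _ _ _ (@cvg_addnl n) cx).
  have cd : (u (n + k)%N x - u n x) @[k --> \oo] --> v x - u n x.
    by apply: cvgB => //; exact: cvg_cst.
  have c2 : ((u (n + k)%N x - u n x) * (u (n + k)%N x - u n x)) @[k --> \oo]
      --> (v x - u n x) * (v x - u n x) by exact: cvgM.
  rewrite expr2; apply: cvg_trans c2; apply: near_eq_cvg; apply: nearW => k.
  by rewrite /F /= expr2.
have L1E n : L2 mu (fun x => u n x - v x).
  split; first by apply: measurable_funB => //; exact: (Lu _).1.
  apply/integrableP; split.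
    apply/measurable_EFinP; apply: measurable_funX; apply: measurable_funB => //.
    exact: (Lu _).1.
  apply: le_lt_trans (ltry ((2 ^- n) ^+ 2)).
  by under eq_integral do rewrite /= ger0_norm ?sqr_ge0//; exact: E.
split.
  have -> : v = fun x => u 0%N x - (u 0%N x - v x) by apply/funext => x; ring.
  exact: L2B.
by move=> n; rewrite -lee_fin EFin_Rintg ?E//; exact: (L1E n).2.
Qed.
End riesz_fischer.

Section nested_convex.
Context {disp} {U : measurableType disp} {R : realType} {I : finType}.
Variable mu : {finite_measure set U -> \bar R}.
Implicit Types u v : I -> U -> R.

Definition sqnorm u : R := \sum_i \int[mu]_x u i x ^+ 2.

Definition midpoint u v : I -> U -> R := fun i x => 2^-1 * (u i x + v i x).

Lemma sqnorm_ge0 u : 0 <= sqnorm u.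
Proof. by apply: sumr_ge0 => i _; apply: Rintg_ge0 => x; exact: sqr_ge0. Qed.

Lemma sqnorm_parallelogram u v :
  (forall i, L2 mu (u i)) -> (forall i, L2 mu (v i)) ->
  sqnorm (fun i x => u i x - v i x) =
  2 * sqnorm u + 2 * sqnorm v - 4 * sqnorm (midpoint u v).
Proof.
move=> Lu Lv; rewrite /sqnorm !mulr_sumr -big_split -sumrB /=.
apply: eq_bigr => i _.
have [Lui Lvi] := (Lu i, Lv i).
have Lm : L2 mu (midpoint u v i) by apply: L2Z; exact: L2D.
have [[_ ?] [_ ?]] := (Lui, Lvi); have [_ ?] := Lm.
rewrite -!RintgZ// -RintgD; [|exact: L1Z|exact: L1Z].
rewrite -RintgB; [|by apply: L1D; exact: L1Z|exact: L1Z].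
by apply: eq_Rintegral => x _; rewrite /midpoint; field.
Qed.

(* Elements of nearly minimal norm form a Cauchy sequence, by the parallelogram
   identity: strong convergence replaces weak compactness. *)
Lemma nested_convex_cvg (K : nat -> set (I -> U -> R)) (M : R) :
  (forall n, exists u, K n u) ->
  (forall n m, (n <= m)%N -> K m `<=` K n) ->
  (forall n u v, K n u -> K n v -> K n (midpoint u v)) ->
  (forall n u, K n u -> forall i, L2 mu (u i)) ->
  (forall n u, K n u -> sqnorm u <= M) ->
  exists u : nat -> I -> U -> R, let v i x := seq_lim (fun n => u n i x) in
  [/\ forall n, K n (u n), forall i, L2 mu (v i),
    forall i, \forall x \ae mu, u n i x @[n --> \oo] --> v i x &
    forall i n, \int[mu]_x (u n i x - v i x) ^+ 2 <= (2 ^- n) ^+ 2].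
Proof.
move=> K0 Kdec Kmid KL2 KM.
pose A n := [set sqnorm u | u in K n].
have lbA n : has_lbound (A n) by exists 0 => _ [u _ <-]; exact: sqnorm_ge0.
have neA n : A n !=set0 by have [u Ku] := K0 n; exists (sqnorm u), u.
have infA n : has_inf (A n) by split.
pose m n := inf (A n).
have m_ndec : nondecreasing_seq m.
  move=> n k nk; apply: lb_le_inf => // _ [u Ku <-].
  by apply: ge_inf => //; exists u => //; exact: Kdec Ku.
have m_le n u : K n u -> m n <= sqnorm u.
  by move=> Ku; apply: ge_inf => //; exists u.
have m_ub : has_ubound (range m).
  exists M => _ [n _ <-]; have [u Ku] := K0 n.
  by rewrite (le_trans (m_le _ _ Ku))//; exact: KM Ku.
pose s := sup (range m).
have m_s n : m n <= s by apply: ub_le_sup => //; exists n.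
have near_s e : 0 < e -> exists n, s - e < m n.
  by move=> e0; have [|_ [n _ <-]] := @sup_adherent _ (range m) e e0;
    [split => //; exists (m 0%N), 0%N|exists n].
(* If the infimum over K_k is within e of [s] and the norm within e of that infimum, the
   parallelogram identity loses at most 8 e; the divisor 16 keeps this below (2^-n)^2. *)
have sel n : exists2 u : I -> U -> R, exists2 k, K k u & (n <= k)%N &
    exists2 k, K k u & s - (2 ^- n) ^+ 2 / 16 < m k /\ sqnorm u < m k + (2 ^- n) ^+ 2 / 16.
  set e := (2 ^- n) ^+ 2 / 16.
  have e0 : 0 < e by rewrite divr_gt0// exprn_gt0// invr_gt0 exprn_gt0.
  have [k0 k0P] := near_s e e0.
  have [_ [u Ku <-] ue] := inf_adherent e0 (infA (maxn k0 n)).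
  exists u; first by exists (maxn k0 n) => //; exact: leq_maxr.
  exists (maxn k0 n) => //; split => //.
  by rewrite (lt_le_trans k0P)// m_ndec// leq_maxl.
pose u n := sval (cid2 (sel n)).
have uK n : K n (u n).
  by rewrite /u; case: cid2 => /= v [k Kv nk] _; exact: Kdec Kv.
have uL n i : L2 mu (u n i) by exact: KL2 (uK n) i.
have uP n : exists2 k, K k (u n) & s - (2 ^- n) ^+ 2 / 16 < m k /\
    sqnorm (u n) < m k + (2 ^- n) ^+ 2 / 16.
  by rewrite /u; case: cid2.
have uC n k : (n <= k)%N ->
    sqnorm (fun i x => u k i x - u n i x) <= (2 ^- n) ^+ 2.
  move=> nk; rewrite sqnorm_parallelogram//.
  have [a Ka [sa una]] := uP n; have [b Kb [sb ukb]] := uP k.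
  (* Both points lie in the larger of the two nested sets, hence so does their midpoint, and the
     infimum over that set is already close to [s]. *)
  have Hmid : m (minn a b) <= sqnorm (midpoint (u k) (u n)).
    apply: m_le; apply: Kmid.
      by apply: Kdec Kb; exact: geq_minr.
    by apply: Kdec Ka; exact: geq_minl.
  have e_dec : (2 ^- k) ^+ 2 <= (2 ^- n) ^+ 2 :> R.
    rewrite lerXn2r ?nnegrE ?invr_ge0 ?exprn_ge0//.
    by rewrite lef_pV2 ?posrE ?exprn_gt0// ler_eXn2l// ltr1n.
  have smin : s - (2 ^- n) ^+ 2 / 16 < m (minn a b).
    by rewrite /minn; case: ifP => _ //; lra.
  have sn := m_s a; have sk := m_s b.
  by lra.
have uCi i n k : (n <= k)%N ->
    \int[mu]_x (u k i x - u n i x) ^+ 2 <= (2 ^- n) ^+ 2.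
  move=> nk; apply: le_trans (uC n k nk); rewrite /sqnorm (bigD1 i)//= lerDl.
  by apply: sumr_ge0 => j _; apply: Rintg_ge0 => x; exact: sqr_ge0.
exists u => v; split => // i.
- by have [] := fast_cauchy_L2 (fun n => uL n i) (uCi i).
- exact: fast_cauchy_ae_cvg (fun n => uL n i) (uCi i).
- by have [] := fast_cauchy_L2 (fun n => uL n i) (uCi i).
Qed.

End nested_convex.

(** * Complete families of functions *)

Section leb0_theory.
Context {R : realType} (T : R).
Notation leb := (@lebesgue_measure R).

Lemma leb0_ae_itv : \forall t \ae leb0 T, 0 <= t <= T.
Proof.
exists (~` `[0, T]%classic); split.
- by apply: measurableC.
- rewrite /leb0 /mrestr.
  rewrite (_ : ~` _ `&` _ = set0) ?measure0//.
  by rewrite setICl.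
- by move=> t /= tN; rewrite in_itv/=; exact: tN.
Qed.

Lemma leb0_ae_of_leb (P : R -> Prop) :
  (\forall t \ae leb, P t) -> \forall t \ae leb0 T, P t.
Proof.
move=> [N [mN N0 PN]]; exists N; split => //.
apply/eqP; rewrite -measure_le0; apply: (@le_trans _ _ (leb N)); last by rewrite N0.
by apply: measureIl.
Qed.

Lemma leb_ae_neq (a : R) : \forall t \ae leb, t <> a.
Proof.
exists [set a]; split; [by []|by rewrite lebesgue_measure_set1|].
by move=> t /= /contrapT ->.
Qed.

(* [leb0 T] lives on [R] with its default display, [lebesgue_measure] on the
   alias [measurableTypeR R]; the identity transports one to the other. *)
Let idTR : measurableTypeR R -> R := idfun.

HB.instance Definition _ := @isMeasurableFun.Build _ _ _ _ idTR
  (@measurable_id _ _ setT).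

Lemma leb0_pushforward (E : set R) (f : R -> \bar R) : measurable E ->
  E `<=` `[0, T]%classic ->
  (\int[leb0 T]_(t in E) f t = \int[pushforward leb idTR]_(t in E) f t)%E.
Proof.
move=> mE ET; apply: eq_measure_integral => A mA AE.
transitivity (leb (A `&` `[0, T])) => //.
rewrite setIidl//.
exact: subset_trans ET.
Qed.

Lemma leb0_integrable_leb (f : R -> R) : L1 (leb0 T) f ->
  leb.-integrable `[0, T] (EFin \o f).
Proof.
move=> /integrableP[mf If]; apply/integrableP; split.
  exact: measurable_funS mf.
have := @ge0_integral_pushforward _ _ _ _ R idTR (@measurable_id _ _ setT)
  leb `[0, T] (fun t => `|(f t)%:E|)%E.
move=> <-//; last by apply: measurable_funTS; exact: measurableT_comp.
rewrite -leb0_pushforward//; apply: le_lt_trans If.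
by apply: ge0_subset_integral => //; exact: measurableT_comp.
Qed.

Lemma eq_leb0_Rintegral (E : set R) (f : R -> R) : measurable E ->
  E `<=` `[0, T]%classic -> L1 (leb0 T) f ->
  \int[leb0 T]_(t in E) f t = \int[leb]_(t in E) f t.
Proof.
move=> mE ET Lf; have ilf := leb0_integrable_leb Lf.
pose g := f \_ `[0, T].
have fg : {in E, f =1 g}.
  by move=> x /[!inE] Ex; rewrite /g patchE mem_set//; exact: ET.
rewrite (@eq_Rintegral _ _ _ _ E g f fg) (@eq_Rintegral _ _ _ leb E g f fg).
rewrite /Rintegral; congr fine.
rewrite leb0_pushforward//.
rewrite (@integral_pushforward _ _ _ _ R idTR (@measurable_id _ _ setT) leb E (EFin \o g))//.
  apply/measurable_EFinP; apply/(measurable_restrictT f) => //.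
  exact: measurable_funTS (L1_meas Lf).
have : leb.-integrable E (EFin \o g).
  apply: (@integrableS _ _ _ leb `[0, T]%classic E (EFin \o g)) => //.
  by apply: eq_integrable ilf => // x xT; rewrite /g/= patchE xT.
exact.
Qed.

(** The primitive of g that starts at an interior point vanishes near t, and by Lebesgue's
    differentiation theorem its derivative is g t for almost every t. *)
Lemma leb0_ae0 (g : R -> R) : L1 (leb0 T) g ->
  (forall a b, 0 < a -> a < b -> b < T ->
    \int[leb0 T]_t (g t * \1_(`]a, b[) t) = 0) ->
  \forall t \ae leb0 T, g t = 0.
Proof.
move=> Lg Ig.
have ig := leb0_integrable_leb Lg.
pose g' := g \_ `[0, T].
have ig' : leb.-integrable setT (EFin \o g').
  by move: ig; rewrite integrable_mkcond//= restrict_EFin.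
have locg' : locally_integrable setT g'.
  by apply: open_integrable_locally => //; exact: openT.
have aept := leb0_ae_of_leb (lebesgue_differentiation locg').
have ae0 := leb0_ae_of_leb (leb_ae_neq 0).
have aeT := leb0_ae_of_leb (leb_ae_neq T).
apply: filterS3 aept (filterI ae0 aeT) leb0_ae_itv => t tpt [/eqP t0 /eqP tT] /andP[t0' tT'].
have tp : 0 < t by rewrite lt_neqAle eq_sym t0.
have tlT : t < T by rewrite lt_neqAle tT.
pose a := t / 2.
have ap : 0 < a by rewrite divr_gt0.
have at_ : a < t by rewrite /a; lra.
pose u := (t + T) / 2.
have [] := @FTC1_lebesgue_pt R g' (BRight a) t u _ _ _ tpt.
- by rewrite /u; lra.
- exact: integrableS ig'.
- exact: at_.
move=> _.
have -> : g' t = g t by rewrite /g' patchE mem_set//= in_itv/= t0' tT'.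
move=> <-.
rewrite -[RHS](derive1_cst (0 : R) t) !derive1E.
apply: near_eq_derive.
near=> y.
have yT : y < T by near: y; exact: lt_nbhsl.
have ay : a < y by near: y; exact: lt_nbhsr.
have yaT : `]a, y] `<=` `[0, T]%classic.
  by move=> s /=; rewrite !in_itv/= => /andP[as_ sy]; apply/andP; split; lra.
have yaT' : `]a, y[ `<=` `[0, T]%classic.
  by move=> s /=; rewrite !in_itv/= => /andP[as_ sy]; apply/andP; split; lra.
rewrite -[RHS](Ig a y ap ay yT).
transitivity (\int[leb]_(s in `]a, y]) g s).
  by apply: eq_Rintegral => s /[!inE] /yaT ss; rewrite /g' patchE mem_set.
rewrite -Rintegral_itv_bndo_bndc; last first.
  apply: (@integrableS _ _ _ leb `[0, T]%classic `]a, y[%classic (EFin \o g)) => //.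
rewrite -eq_leb0_Rintegral// Rintegral_mkcond.
apply: eq_Rintegral => s _; rewrite patchE indicE.
by case: ifPn => _; rewrite ?mulr1 ?mulr0.
Unshelve. all: by end_near. Qed.
End leb0_theory.

(** * Completeness of powers and of waves on an interval *)

Section separating.
Context {R : realType}.

Lemma bernoulli_ineq (x : R) n : -1 <= x -> 1 + n%:R * x <= (1 + x) ^+ n.
Proof.
move=> x1; elim: n => [|n IH]; first by rewrite mul0r addr0 expr0.
rewrite exprS; apply: (@le_trans _ _ ((1 + x) * (1 + n%:R * x))).
  rewrite -natr1; have := sqr_ge0 x; have := ler0n R n => n0 x0; nra.
by rewrite ler_wpM2l//; lra.
Qed.

(** The polynomials of the Brosowski-Deutsch proof of the Stone-Weierstrass theorem. Since 2^n v^n =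
    (2 v)^n, they jump from 1 to 0 at v = 1/2 in the limit. *)
Definition heaviside_poly n (v : R) := (1 - v ^+ n) ^+ (2 ^ n).

Lemma heaviside_poly_01 n v : 0 <= v <= 1 -> 0 <= heaviside_poly n v <= 1.
Proof.
move=> /andP[v0 v1]; have vn0 : 0 <= v ^+ n by rewrite exprn_ge0.
have vn1 : v ^+ n <= 1 by rewrite exprn_ile1.
by rewrite exprn_ge0 ?subr_ge0//= exprn_ile1//; lra.
Qed.

Lemma heaviside_poly_cvg1 v : 0 <= v < 2^-1 ->
  heaviside_poly n v @[n --> \oo] --> (1 : R).
Proof.
move=> /andP[v0 v1].
have c0 : (2 * v) ^+ n @[n --> \oo] --> 0.
  by apply: cvg_expr; rewrite ger0_norm ?mulr_ge0//; lra.
have c1 : 1 - (2 * v) ^+ n @[n --> \oo] --> (1 : R).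
  rewrite -[X in _ --> X]subr0.
  by apply: cvgB; [exact: cvg_cst|exact: c0].
apply: squeeze_cvgr; [|exact: c1|exact: cvg_cst].
apply: nearW => n; apply/andP; split; last first.
  have v01 : 0 <= v <= 1 by apply/andP; split; lra.
  by have /andP[] := heaviside_poly_01 n v01.
have vn1 : v ^+ n <= 1 by rewrite exprn_ile1//; lra.
have := @bernoulli_ineq (- v ^+ n) (2 ^ n); rewrite lerN2 => /(_ vn1).
by rewrite mulrN natrX -exprMn.
Qed.

(** With x = v^n and N = 2^n, (1 - x)^N (1 + x)^N <= 1, while Bernoulli's inequality gives (1 + x)^N
    >= (2 v)^n, which grows. *)
Lemma heaviside_poly_cvg0 v : 2^-1 < v <= 1 ->
  heaviside_poly n v @[n --> \oo] --> (0 : R).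
Proof.
move=> /andP[v0 v1]; have vp : 0 < v by apply: lt_trans v0; rewrite invr_gt0.
have c0 : (2 * v)^-1 ^+ n @[n --> \oo] --> 0.
  apply: cvg_expr; rewrite ger0_norm ?invr_ge0 ?mulr_ge0// ?ltW//.
  by rewrite invf_lt1 ?mulr_gt0//; lra.
apply: squeeze_cvgr; [|exact: cvg_cst|exact: c0].
apply: nearW => n; apply/andP; split.
  have v01 : 0 <= v <= 1 by apply/andP; split; lra.
  by have /andP[] := heaviside_poly_01 n v01.
have vn0 : 0 < v ^+ n by rewrite exprn_gt0.
have vn1 : v ^+ n <= 1 by rewrite exprn_ile1// ltW.
have B : (2 * v) ^+ n <= (1 + v ^+ n) ^+ (2 ^ n).
  have := @bernoulli_ineq (v ^+ n) (2 ^ n); rewrite natrX -exprMn => H.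
  by have := H (le_trans (lerN10 _) (ltW vn0)); lra.
have t0 : 0 < (2 * v) ^+ n by rewrite exprn_gt0// mulr_gt0.
have q0 : 0 <= heaviside_poly n v.
  have v01 : 0 <= v <= 1 by apply/andP; split; lra.
  by have /andP[] := heaviside_poly_01 n v01.
have q1 : heaviside_poly n v * (1 + v ^+ n) ^+ (2 ^ n) <= 1.
  rewrite /heaviside_poly -exprMn exprn_ile1//; first by nra.
  by have := sqr_ge0 (v ^+ n); nra.
rewrite exprVn -[leRHS]mul1r ler_pdivlMr//.
by apply: le_trans q1; rewrite ler_wpM2l.
Qed.

(** The polynomials [heaviside_poly n] composed with u stay between 0 and 1 and converge to the
    indicator of ]a, b[ off the endpoints. Their integrals against g vanish because those of the
    powers of u do, so dominated convergence gives the hypothesis of [leb0_ae0]. *)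
Lemma leb0_ae0_separating (T : R) (g : R -> R) : L1 (leb0 T) g ->
  (forall a b, 0 < a -> a < b -> b < T -> exists u : R -> R,
    [/\ measurable_fun setT u, forall t, 0 <= t <= T -> 0 <= u t <= 1,
      forall t, a < t < b -> u t < 2^-1,
      forall t, 0 <= t <= T -> (t < a) || (b < t) -> 2^-1 < u t
      & forall n, \int[leb0 T]_t (u t ^+ n * g t) = 0]) ->
  \forall t \ae leb0 T, g t = 0.
Proof.
move=> Lg Hu; apply: leb0_ae0 => // a b a0 ab bT.
have [u [mu_ u01 uab uNab Iu]] := Hu a b a0 ab bT.
have mg := L1_meas Lg.
have Lug n : L1 (leb0 T) (fun t => u t ^+ n * g t).
  apply: (@L1_bddM _ _ _ _ _ _ 1) => //; first exact: measurable_funX.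
  apply: filterS (leb0_ae_itv T) => t /u01 /andP[ut0 ut1].
  by rewrite ger0_norm ?exprn_ge0// exprn_ile1.
have Lq n N m : L1 (leb0 T) (fun t => (1 - u t ^+ n) ^+ N * (u t ^+ m * g t)).
  apply: (@L1_bddM _ _ _ _ _ _ 1) => //.
    by apply: measurable_funX; apply: measurable_funB => //; exact: measurable_funX.
  apply: filterS (leb0_ae_itv T) => t /u01 /andP[ut0 ut1].
  have un0 : 0 <= u t ^+ n by rewrite exprn_ge0.
  have un1 : u t ^+ n <= 1 by rewrite exprn_ile1.
  by rewrite ger0_norm ?exprn_ge0 ?subr_ge0// exprn_ile1//; lra.
(* Induction on N for all m at once: expanding one factor 1 - u^n replaces m by n + m. *)
have Iq n N m : \int[leb0 T]_t ((1 - u t ^+ n) ^+ N * (u t ^+ m * g t)) = 0.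
  elim: N m => [|N IH] m.
    by under eq_Rintegral do rewrite expr0 mul1r; exact: Iu.
  transitivity (\int[leb0 T]_t ((1 - u t ^+ n) ^+ N * (u t ^+ m * g t) -
      (1 - u t ^+ n) ^+ N * (u t ^+ (n + m) * g t))).
    by apply: eq_Rintegral => t _; rewrite exprSr exprD; ring.
  by rewrite RintgB// !IH subrr.
have c0 : \int[leb0 T]_t (heaviside_poly n (u t) * g t) @[n --> \oo] -->
    \int[leb0 T]_t (g t * \1_(`]a, b[) t).
  apply: (@dominated_cvg_Rintg _ _ _ _ (fun n t => heaviside_poly n (u t) * g t)
      _ (fun t => `|g t|)).
  - move=> n; apply: measurable_funM => //.
    apply: (measurable_funX (2 ^ n)); apply: measurable_funB => //.
    exact: measurable_funX.
  - by apply: measurable_funM.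
  - exact: L1_norm.
  - have aea := leb0_ae_of_leb T (leb_ae_neq a).
    have aeb := leb0_ae_of_leb T (leb_ae_neq b).
    apply: filterS3 (leb0_ae_itv T) aea aeb => t tT /eqP ta /eqP tb.
    have /andP[ut0 ut1] := u01 _ tT.
    rewrite mulrC indicE; apply: cvgMl.
    have [tab|] := boolP (a < t < b).
      rewrite mem_set ?in_itv//; apply: heaviside_poly_cvg1.
      by rewrite ut0 uab.
    rewrite negb_and -!leNgt => tab.
    rewrite memNset; last first.
      by rewrite /= in_itv/= => /andP[at_ tb_]; move: tab; rewrite leNgt at_ leNgt tb_.
    apply: heaviside_poly_cvg0; rewrite ut1 andbT; apply: uNab => //.
    by rewrite !lt_neqAle ta eq_sym tb.
  - apply: filterS (leb0_ae_itv T) => t tT n.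
    have /andP[q0 q1] := heaviside_poly_01 n (u01 _ tT).
    by rewrite normrM ger0_norm// ler_piMl.
have cz : \int[leb0 T]_t (heaviside_poly n (u t) * g t) @[n --> \oo] --> (0 : R).
  apply: cvg_near_cst; apply: nearW => n; rewrite -[RHS](Iq n (2 ^ n)%N 0%N).
  by apply: eq_Rintegral => t _; rewrite expr0 mul1r.
exact: (cvg_unique _ c0 cz).
Qed.

Lemma monomials_total (T : R) (g : R -> R) : L1 (leb0 T) g ->
  (forall n, \int[leb0 T]_t (t ^+ n * g t) = 0) ->
  \forall t \ae leb0 T, g t = 0.
Proof.
move=> Lg Ig; apply: leb0_ae0_separating => // a b a0 ab bT.
pose c := (a + b) / 2; pose r := (b - a) / 2.
pose k := (4 * T ^+ 2)^-1.
have T0 : 0 < T by lra.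
(* A parabola that takes the value 1/2 exactly at a and b; the factor [k] flattens it so that its
   values on [0, T] stay in [0, 1]. *)
exists (fun t => 2^-1 + k * ((t - c) ^+ 2 - r ^+ 2)).
have k0 : 0 < k by rewrite invr_gt0 mulr_gt0// exprn_gt0.
have kT : k * (2 * T ^+ 2) = 2^-1 by rewrite /k; field; rewrite gt_eqF.
split.
- apply: measurable_funD => //.
  apply: measurable_funM => //; apply: measurable_funB => //.
  by apply: measurable_funX; exact: measurable_funB.
- move=> t /andP[t0 tT].
  have H1 : `|(t - c) ^+ 2 - r ^+ 2| <= T ^+ 2.
    rewrite ler_norml; apply/andP; split; rewrite /c /r; nra.
  have H2 : `|k * ((t - c) ^+ 2 - r ^+ 2)| <= 2^-1.
    rewrite normrM gtr0_norm// -kT (ler_wpM2l (ltW k0))// (le_trans H1)//.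
    by have := sqr_ge0 T; lra.
  by move: H2; rewrite ler_norml => /andP[]; lra.
- move=> t /andP[at_ tb]; suff : k * ((t - c) ^+ 2 - r ^+ 2) < 0 by lra.
  by rewrite pmulr_rlt0// /c /r; nra.
- move=> t /andP[t0 tT] tab; suff : 0 < k * ((t - c) ^+ 2 - r ^+ 2) by lra.
  by rewrite pmulr_rgt0// /c /r; case/orP: tab => ?; nra.
- move=> n.
  pose p : {poly R} := (2^-1)%:P + k *: (('X - c%:P) ^+ 2 - (r ^+ 2)%:P).
  have Lt i : L1 (leb0 T) (fun t => t ^+ i * g t).
    apply: (@L1_bddM _ _ _ _ _ _ (T ^+ i)) => //.
    apply: filterS (leb0_ae_itv T) => t /andP[t0 tT].
    by rewrite normrX ger0_norm// lerXn2r ?nnegrE// ltW.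
  transitivity (\int[leb0 T]_t (\sum_(i < size (p ^+ n)%R) (p ^+ n)`_i * (t ^+ i * g t))).
    apply: eq_Rintegral => t _.
    under eq_bigr do rewrite mulrA.
    by rewrite -mulr_suml -horner_coef /p horner_exp !hornerE.
  rewrite Rintg_sum; last by move=> i _; exact: L1Z.
  by apply: big1 => i _; rewrite RintgZ// Ig mulr0.
Qed.
End separating.

Section quarter_phase.
Context {R : realType}.
Implicit Types z : R.

(* The phases m pi/2 make the family closed under differentiation. *)
Definition cosq (m : nat) z : R := cos (z + m%:R * (pi / 2)).

Lemma cosqS m z : cosq m.+1 z = - sin (z + m%:R * (pi / 2)).
Proof. by rewrite /cosq -natr1 mulrDl mul1r addrA cosDpihalf. Qed.

Lemma cosqSS m z : cosq m.+2 z = - cosq m z.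
Proof.
by rewrite cosqS -natr1 mulrDl mul1r addrA sinDpihalf.
Qed.

Lemma cosq3 m z : cosq m.+3 z = sin (z + m%:R * (pi / 2)).
Proof. by rewrite cosqSS cosqS opprK. Qed.

Lemma cosq_le1 m z : `|cosq m z| <= 1.
Proof. exact: cos_max. Qed.

Lemma measurable_cosq m : measurable_fun [set: R] (cosq m).
Proof.
apply: (measurableT_comp (continuous_measurable_fun (@continuous_cos R))).
by apply: measurable_funD.
Qed.

Lemma cosq0_0 : cosq 0 0 = 1 :> R.
Proof. by rewrite /cosq mul0r addr0 cos0. Qed.

(** The product formula for cosines. The phase of the difference term is a - m, which is a + 3 m
    modulo 4; the second form stays within the natural numbers. *)
Lemma cosqM (m a : nat) z w : cosq a z * cosq m w =
  2^-1 * (cosq (a + m) (z + w) + cosq (a + m + m + m) (z - w)).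
Proof.
have E y : cosq (a + m + m + m) y = cos (y + a%:R * (pi / 2) - m%:R * (pi / 2)).
  rewrite -[RHS](periodicn (@cosD2pi R) m) /cosq; congr cos.
  by rewrite !natrD -mulrnA -[pi *+ (2 * m)]mulr_natr natrM; field.
rewrite E /cosq natrD.
rewrite (_ : z + w + _ = (z + a%:R * (pi / 2)) + (w + m%:R * (pi / 2))); last by ring.
rewrite (_ : z - w + _ - _ = (z + a%:R * (pi / 2)) - (w + m%:R * (pi / 2))); last by ring.
set X := z + _; set W := w + _; by rewrite (cosD X W) (cosB X W); field.
Qed.

End quarter_phase.

Section trig_total_1d.
Context {R : realType}.

Lemma cosq_total_1d (g : R -> R) : L1 (leb0 1) g ->
  (forall (k : int) m, \int[leb0 1]_t (cosq m (2 * pi * (k%:~R * t)) * g t) = 0) ->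
  \forall t \ae leb0 1, g t = 0.
Proof.
move=> Lg Ig; apply: leb0_ae0_separating => // a b a0 ab b1.
have pi0 := pi_gt0 R.
(* Inside [0, 1] the product of the two sines changes sign at a and b only. It equals (cos (pi (b -
   a)) - cos (2 pi t - pi (a + b))) / 2, so u is a trigonometric polynomial with frequencies 0 and
   1. *)
pose u (t : R) : R := 2^-1 + 2^-1 * (sin (pi * (t - a)) * sin (pi * (t - b))).
have mu_ : measurable_fun setT u.
  have ms (c : R) : measurable_fun setT (fun t : R => sin (pi * (t - c))).
    apply: (measurableT_comp (continuous_measurable_fun (@continuous_sin R))).
    by apply: measurable_funM => //; exact: measurable_funB.
  by apply: measurable_funD => //; apply: measurable_funM => //; exact: measurable_funM.
have u01 t : 0 <= u t <= 1.
  have := sin_max (pi * (t - a)); have := sin_max (pi * (t - b)).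
  rewrite !ler_norml => /andP[? ?] /andP[? ?].
  by rewrite /u; apply/andP; split; nra.
have sp (x : R) : 0 < x < 1 -> 0 < sin (pi * x).
  by move=> /andP[x0 x1]; apply: sin_gt0_pi; rewrite mulr_gt0//= gtr_pMr.
have sn (x : R) : -1 < x < 0 -> sin (pi * x) < 0.
  move=> /andP[x0 x1]; rewrite -oppr_gt0 -sinN -mulrN; apply: sp.
  by apply/andP; split; lra.
exists u; split => //.
- move=> t /andP[at_ tb].
  have H1 := sp (t - a); have H2 := sn (t - b).
  have := H1 ltac:(by apply/andP; split; lra).
  have := H2 ltac:(by apply/andP; split; lra).
  by rewrite /u => ? ?; nra.
- move=> t /andP[t0 t1] /orP[ta|bt].
    have := sn (t - a) ltac:(by apply/andP; split; lra).
    have := sn (t - b) ltac:(by apply/andP; split; lra).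
    by rewrite /u => ? ?; nra.
  have := sp (t - a) ltac:(by apply/andP; split; lra).
  have := sp (t - b) ltac:(by apply/andP; split; lra).
  by rewrite /u => ? ?; nra.
pose e (k : int) m (t : R) : R := cosq m (2 * pi * (k%:~R * t)).
have me k m : measurable_fun setT (e k m).
  apply: (measurableT_comp (measurable_cosq m)).
  by apply: measurable_funM => //; exact: measurable_funM.
have Lu n k m : L1 (leb0 1) (fun t => u t ^+ n * (e k m t * g t)).
  apply: (@L1_bddM _ _ _ _ _ _ 1) => //; first exact: measurable_funX.
    apply: aeW => t; have /andP[ut0 ut1] := u01 t.
    by rewrite ger0_norm ?exprn_ge0// exprn_ile1.
  by apply: (@L1_bddM _ _ _ _ _ _ 1) => //; apply: aeW => t; exact: cosq_le1.
(* Multiplication by u maps the wave of frequency k to waves of frequencies k and k +- 1; the phase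
   [m.+3] stands for the sine. Iterating, all powers of u are orthogonal to g. *)
have uE (k : int) m t : u t * e k m t =
    (2^-1 + 4^-1 * cos (pi * (b - a))) * e k m t
    - 8^-1 * (cos (pi * (a + b)) * (e (k + 1) m t + e (k - 1) m t)
             + sin (pi * (a + b)) * (e (k + 1) m.+3 t - e (k - 1) m.+3 t)).
  rewrite /e !cosq3 /cosq.
  set X := 2 * pi * (k%:~R * t) + m%:R * (pi / 2).
  have -> : 2 * pi * ((k + 1)%:~R * t) + m%:R * (pi / 2) = X + (pi * t + pi * t).
    by rewrite intrD /X; ring.
  have -> : 2 * pi * ((k - 1)%:~R * t) + m%:R * (pi / 2) = X - (pi * t + pi * t).
    by rewrite intrD mulrN1z /X; ring.
  set Y := pi * t + pi * t; set phi := pi * (a + b).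
  have sM x y : sin x * sin y = 2^-1 * (cos (x - y) - cos (x + y)) :> R.
    by rewrite cosB cosD; field.
  rewrite /u sM.
  rewrite (_ : pi * (t - a) - _ = pi * (b - a)); last by ring.
  rewrite (_ : pi * (t - a) + _ = Y - phi); last by rewrite /Y /phi; ring.
  by move: X Y phi => X Y phi; rewrite cosB !cosD !sinD !cosN !sinN; field.
have H n : forall k m, \int[leb0 1]_t (u t ^+ n * (e k m t * g t)) = 0.
  elim: n => [|n IH] k m.
    by under eq_Rintegral do rewrite expr0 mul1r; exact: Ig.
  set al := 2^-1 + 4^-1 * cos (pi * (b - a)).
  set be := cos (pi * (a + b)); set ga := sin (pi * (a + b)).
  pose F k m t := u t ^+ n * (e k m t * g t).
  have LF k' m' : L1 (leb0 1) (F k' m') by exact: Lu.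
  transitivity (\int[leb0 1]_t (al * F k m t - 8^-1 * (be * (F (k + 1) m t + F (k - 1) m t)
             + ga * (F (k + 1) m.+3 t - F (k - 1) m.+3 t)))).
    apply: eq_Rintegral => t _; rewrite exprSr -mulrA [u t * _]mulrA uE.
    by rewrite /F -/al -/be -/ga; ring.
  have IF k' m' : \int[leb0 1]_t F k' m' t = 0 by exact: IH.
  have LD : L1 (leb0 1) (fun t => F (k + 1) m t + F (k - 1) m t) by exact: L1D.
  have LB : L1 (leb0 1) (fun t => F (k + 1) m.+3 t - F (k - 1) m.+3 t) by exact: L1B.
  have LS : L1 (leb0 1) (fun t => be * (F (k + 1) m t + F (k - 1) m t)
             + ga * (F (k + 1) m.+3 t - F (k - 1) m.+3 t)).
    by apply: L1D; exact: L1Z.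
  rewrite RintgB; [|exact: L1Z|exact: L1Z].
  rewrite RintgZ// RintgZ// RintgD; [|exact: L1Z|exact: L1Z].
  by rewrite RintgZ// RintgZ// RintgD// RintgB// !IF; ring.
move=> n; rewrite -[RHS](H n 0 0%N); apply: eq_Rintegral => t _.
by rewrite /e mul0r mulr0 cosq0_0 mul1r.
Qed.

End trig_total_1d.

(** * Fubini's theorem for real-valued integrals *)

Section real_fubini.
Context {d1 d2} {X : measurableType d1} {Y : measurableType d2} {R : realType}.
Variables (m1 : {finite_measure set X -> \bar R}) (m2 : {finite_measure set Y -> \bar R}).
Variable f : X * Y -> R.
Hypothesis If : (m1 \x m2)%E.-integrable setT (EFin \o f).

Lemma L1_ae_section1 : \forall x \ae m1, L1 m2 (fun y => f (x, y)).
Proof. by have := ae_integrable1 If. Qed.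

Lemma L1_integral1 : L1 m1 (fun x => \int[m2]_y f (x, y)).
Proof.
have iF := integrable_fubini_F If.
apply: (le_integrable measurableT _ _ iF).
  apply/measurable_EFinP; apply: measurableT_comp => //.
  exact: measurable_int iF.
(* Where the inner integral is infinite its real version is 0, so it is dominated by the
   extended-real one. *)
by move=> x _; rewrite /= /Rintegral /fubini_F/=; case: (integral _ _ _) => [r||] //=; rewrite ?normr0 leey.
Qed.

Lemma Rintg_fubini1 : \int[m1]_x \int[m2]_y f (x, y) = \int[(m1 \x m2)%E]_z f z.
Proof.
rewrite /Rintegral -integral12_prod_meas1//; congr fine.
apply: ae_eq_integral => //.
- exact: measurable_int L1_integral1.
- exact: measurable_int (integrable_fubini_F If).
- by apply: filterS L1_ae_section1 => x Lx _; rewrite fineK//; exact: integrable_fin_num.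
Qed.

End real_fubini.

Section real_fubini_swap.
Context {d1 d2} {X : measurableType d1} {Y : measurableType d2} {R : realType}.
Variables (m1 : {finite_measure set X -> \bar R}) (m2 : {finite_measure set Y -> \bar R}).
Variable f : X * Y -> R.
Hypothesis If : (m1 \x m2)%E.-integrable setT (EFin \o f).
Let fs (z : Y * X) := f (z.2, z.1).

Let Ifs : (m2 \x m1)%E.-integrable setT (EFin \o fs).
Proof.
have mf := measurable_int _ If.
have mfs : measurable_fun setT (EFin \o fs).
  by apply: (measurableT_comp mf); exact: measurable_swap.
by apply/(integrable12ltyP m2 m1 mfs); exact/(integrable21ltyP m1 m2 mf).
Qed.

Lemma Rintg_fubini_swap :
  \int[m1]_x \int[m2]_y f (x, y) = \int[m2]_y \int[m1]_x f (x, y).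
Proof.
rewrite (Rintg_fubini1 If) [RHS](Rintg_fubini1 Ifs) /Rintegral.
by rewrite -(integral21_prod_meas1 If) -(integral12_prod_meas1 Ifs).
Qed.

Lemma L1_integral2 : L1 m2 (fun y => \int[m1]_x f (x, y)).
Proof. exact: (L1_integral1 Ifs). Qed.

End real_fubini_swap.

(** * Complete families on products and on the torus *)

Section complete_family.
Context {R : realType}.

(** Duality is tested on all of L^1, a class that Fubini's theorem preserves under partial
    integration, which allows an induction on the dimension. *)
Definition complete_family {disp} {U : measurableType disp}
    (mu : {finite_measure set U -> \bar R}) {Q : Type} (F : Q -> U -> R) :=
  forall g, L1 mu g -> (forall q, \int[mu]_x (F q x * g x) = 0) ->
  \forall x \ae mu, g x = 0.

Lemma ae_forall_countable {disp} {U : measurableType disp}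
    (mu : {measure set U -> \bar R}) (Q : countType) (P : Q -> U -> Prop) :
  (forall q, \forall x \ae mu, P q x) -> \forall x \ae mu, forall q, P q x.
Proof.
move=> H.
have : \forall x \ae mu, forall n, oapp (fun q => P q x) True (unpickle n).
  apply: ae_foralln => n; case: (unpickle n) => [q|] /=; first exact: H.
  exact: aeW.
by apply: filterS => x Hx q; have := Hx (pickle q); rewrite pickleK.
Qed.

Lemma ae_time_product_fst n (mu : {finite_measure set 'rV[R]_n -> \bar R}) (T : R)
    (P : R -> Prop) :
  (\forall t \ae leb0 T, P t) -> \forall z \ae time_product mu T, P z.1.
Proof.
move=> [N [mN N0 PN]]; exists (N `*` setT); split.
- exact: measurableX.
- rewrite /time_product product_measure1E//.
  by rewrite [X in (X * _)%E](_ : _ = 0%E) ?mul0e.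
- by move=> z /= /PN.
Qed.

(** For each q2, the integral of [G q2] g(t, .) over space is orthogonal to the family F, hence zero
    for almost every t. Since Q2 is countable, one null set of times serves all q2, and off it the
    completeness of G applies to the slice. *)
Lemma complete_time_product n (mu : {finite_measure set 'rV[R]_n -> \bar R}) (T : R)
    (Q1 : Type) (Q2 : countType) (F : Q1 -> R -> R) (G : Q2 -> 'rV[R]_n -> R) :
  (forall q, measurable_fun setT (F q)) -> (forall q, measurable_fun setT (G q)) ->
  (forall q, exists C, \forall t \ae leb0 T, `|F q t| <= C) ->
  (forall q, exists C, forall x, `|G q x| <= C) ->
  complete_family (leb0 T) F -> complete_family mu G ->
  complete_family (time_product mu T) (fun q z => F q.1 z.1 * G q.2 z.2).
Proof.
move=> mF mG bF bG tF tG g Lg Ig.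
have mg := L1_meas Lg.
have LGg q : (leb0 T \x mu)%E.-integrable setT (EFin \o (fun z => G q z.2 * g z)).
  have [C HC] := bG q.
  apply: (@L1_bddM _ _ _ (time_product mu T) (fun z => G q z.2) g C) => //.
    exact: measurableT_comp.
  by apply: aeW => z.
have H q : \forall t \ae leb0 T, \int[mu]_x (G q x * g (t, x)) = 0.
  apply: tF; first by apply: (L1_integral1 (LGg q)).
  move=> p; rewrite -[RHS](Ig (p, q)).
  have [C HC] := bF p.
  have LFGg : (leb0 T \x mu)%E.-integrable setT
      (EFin \o (fun z => F p z.1 * G q z.2 * g z)).
    apply: (@L1_ae _ _ _ (time_product mu T) _ (fun z => F p z.1 * (G q z.2 * g z))).
    - apply: measurable_funM => //; apply: measurable_funM; exact: measurableT_comp.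
    - apply: (@L1_bddM _ _ _ _ (fun z => F p z.1) _ C) => //.
      - exact: measurableT_comp.
      - exact: (ae_time_product_fst _ HC).
      - exact: LGg q.
    - by apply: aeW => z; rewrite mulrA.
  rewrite -(Rintg_fubini1 LFGg); apply: ae_eq_Rintg.
  - apply: measurable_funM => //; exact: L1_meas (L1_integral1 (LGg q)).
  - exact: L1_meas (L1_integral1 LFGg).
  apply: filterS (L1_ae_section1 (LGg q)) => t Lt.
  by rewrite -RintgZ//; apply: eq_Rintegral => x _ /=; rewrite mulrA.
have {}H := ae_forall_countable H.
(* Slicewise vanishing becomes vanishing almost everywhere on the product through the integral of
   |g|. *)
have Lng : (leb0 T \x mu)%E.-integrable setT (EFin \o (fun z => `|g z|)) := L1_norm Lg.
have : \forall z \ae time_product mu T, `|g z| = 0.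
  apply: Rintg_eq0 => //.
  rewrite -[LHS](Rintg_fubini1 Lng).
  rewrite -[RHS](Rintg0 (leb0 T)); apply: ae_eq_Rintg => //.
    exact: L1_meas (L1_integral1 Lng).
  apply: filterS2 H (L1_ae_section1 (f := g) Lg) => t Ht Lgt.
  rewrite -[RHS](Rintg0 mu); apply: ae_eq_Rintg => //.
    by apply: measurableT_comp => //; exact: L1_meas Lgt.
  by have := tG _ Lgt Ht; apply: filterS => x ->; rewrite normr0.
by apply: filterS => z /normr0_eq0.
Qed.

End complete_family.

Section torus_step.
Context {R : realType} (n : nat).
Notation mu := (torus_measure n : {finite_measure set 'rV[R]_n -> \bar R}).
Notation mu1 := (torus_measure n.+1 : {finite_measure set 'rV[R]_n.+1 -> \bar R}).

Lemma torusS_integrable (g : 'rV[R]_n.+1 -> R) : L1 mu1 g ->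
  L1 (time_product mu 1) (g \o @rV_cons R n).
Proof.
move=> Lg; have mg := L1_meas Lg.
have /integrableP[_ Ig] := Lg; apply/integrableP; split.
  apply/measurable_EFinP; exact: (measurableT_comp mg (@measurable_rV_cons R n)).
have := @ge0_integral_pushforward _ _ _ _ R (@rV_cons R n) (@measurable_rV_cons R n)
  (time_product mu 1) setT (fun z => `|(g z)%:E|)%E measurableT.
rewrite preimage_setT => <-//.
by apply: measurableT_comp => //; exact/measurable_EFinP.
Qed.

Lemma torusS_integral (g : 'rV[R]_n.+1 -> R) : measurable_fun setT g ->
  L1 (time_product mu 1) (g \o @rV_cons R n) ->
  L1 mu1 g /\ \int[mu1]_x g x = \int[time_product mu 1]_z g (rV_cons z).
Proof.
move=> mg Lg; have mg' : measurable_fun setT (EFin \o g) by exact/measurable_EFinP.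
split.
  exact: (@integrable_pushforward _ _ _ _ _ (@rV_cons R n) (@measurable_rV_cons R n)
    (time_product mu 1) setT (EFin \o g) mg' Lg measurableT).
rewrite /Rintegral; congr fine.
exact: (@integral_pushforward _ _ _ _ _ (@rV_cons R n) (@measurable_rV_cons R n)
    (time_product mu 1) setT (EFin \o g) mg' Lg measurableT).
Qed.

End torus_step.

Section waves.
Context {R : realType}.

Definition wave {d} (k : 'rV[int]_d) (m : nat) (x : 'rV[R]_d) : R :=
  cosq m (2 * pi * \sum_i (k 0 i)%:~R * x 0 i).

Lemma measurable_wave d (k : 'rV[int]_d) m : measurable_fun setT (wave k m).
Proof.
apply: (measurableT_comp (measurable_cosq m)).
apply: measurable_funM => //; apply: measurable_sum => i.
by apply: measurable_funM => //; exact: measurable_rV_coord.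
Qed.

Lemma wave_le1 d (k : 'rV[int]_d) m x : `|wave k m x| <= 1.
Proof. exact: cosq_le1. Qed.

(** Induction on the dimension. By [cosqM] a one-dimensional wave of frequency k0 times a wave of
    frequency k is half the sum of waves of frequencies (k0, k) and (k0, -k), so orthogonality to
    waves implies orthogonality to the products. In dimension 0 the measure is a Dirac mass. *)
Lemma waves_complete d : complete_family (torus_measure d)
  (fun q : 'rV[int]_d * nat => wave q.1 q.2).
Proof.
elim: d => [|d IH] g Lg Ig.
  have E x : g x = g 0 by rewrite (thinmx0 x).
  have mg := L1_meas Lg.
  have : g 0 = 0.
    rewrite -[RHS](Ig (0, 0%N)) /Rintegral integral_dirac//; last first.
      by apply/measurable_EFinP; apply: measurable_funM => //; exact: measurable_wave.
    by rewrite diracT mul1e /= /wave big_ord0 mulr0 cosq0_0 mul1r.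
  by move=> g0; apply: aeW => x; rewrite E.
have mg := L1_meas Lg.
have Lgc := torusS_integrable Lg.
pose F (q : int * nat) (t : R) := cosq q.2 (2 * pi * (q.1%:~R * t)).
have H : \forall z \ae time_product (torus_measure d) 1, g (rV_cons z) = 0.
  apply: (@complete_time_product _ _ (torus_measure d) 1 _ _ F
    (fun q : 'rV[int]_d * nat => wave q.1 q.2) _ _ _ _ _ IH _ Lgc).
  - move=> [k m]; apply: (measurableT_comp (measurable_cosq m)).
    by apply: measurable_funM => //; exact: measurable_funM.
  - by move=> [k m]; exact: measurable_wave.
  - by move=> [k m]; exists 1; apply: aeW => t; exact: cosq_le1.
  - by move=> [k m]; exists 1 => x; exact: wave_le1.
  - move=> h Lh Ih; apply: cosq_total_1d => // k m; exact: (Ih (k, m)).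
  move=> [[k0 a] [k m]] /=; rewrite /F /=.
  pose kp : 'rV[int]_d.+1 := row_mx (const_mx k0 : 'rV_1) k.
  pose kn : 'rV[int]_d.+1 := row_mx (const_mx k0 : 'rV_1) (- k).
  have kE (l : 'rV[int]_d) z : \sum_i ((row_mx (const_mx k0 : 'rV_1) l : 'rV[int]_d.+1) 0 i)%:~R *
      (rV_cons z : 'rV[R]_d.+1) 0 i = k0%:~R * z.1 + \sum_i (l 0 i)%:~R * z.2 0 i.
    rewrite /rV_cons (@big_split_ord _ _ _ 1 d) big_ord1.
    have rl (S : Type) (A : 'rV[S]_1) (B : 'rV[S]_d) :
      (row_mx A B : 'rV[S]_d.+1) 0 (lshift d (ord0 : 'I_1) : 'I_(1 + d)) = A 0 ord0 := row_mxEl A B 0 ord0.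
    have rr (S : Type) (A : 'rV[S]_1) (B : 'rV[S]_d) i :
      (row_mx A B : 'rV[S]_d.+1) 0 (rshift 1 i : 'I_(1 + d)) = B 0 i := row_mxEr A B 0 i.
    rewrite !rl !mxE; congr (_ + _); apply: eq_bigr => i _.
    by rewrite !rr.
  have wE z : cosq a (2 * pi * (k0%:~R * z.1)) * wave k m z.2 =
      2^-1 * (wave kp (a + m) (rV_cons z) + wave kn (a + m + m + m) (rV_cons z)).
    rewrite /wave cosqM !kE; congr (_ * (cosq _ _ + cosq _ _)); first by ring.
    under [in RHS]eq_bigr do rewrite mxE mulrNz mulNr.
    by rewrite sumrN; ring.
  have Lw k' m' : L1 (torus_measure d.+1) (fun x => wave k' m' x * g x).
    apply: (@L1_bddM _ _ _ _ (wave k' m') g 1) => //; first exact: measurable_wave.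
    by apply: aeW => x; exact: wave_le1.
  have Lwc k' m' := torusS_integrable (Lw k' m').
  have Iw k' m' : \int[time_product (torus_measure d) 1]_z
      (wave k' m' (rV_cons z) * g (rV_cons z)) = 0.
    have [_ <-] := torusS_integral (L1_meas (Lw k' m')) (Lwc k' m').
    exact: (Ig (k', m')).
  transitivity (\int[time_product (torus_measure d) 1]_z
    (2^-1 * (wave kp (a + m) (rV_cons z) * g (rV_cons z) +
             wave kn (a + m + m + m) (rV_cons z) * g (rV_cons z)))).
    by apply: eq_Rintegral => z _; rewrite wE /=; ring.
  rewrite RintgZ ?RintgD ?Iw ?addr0 ?mulr0//; [exact: Lwc|exact: Lwc|].
  by apply: L1D; exact: Lwc.
have Lag : L1 (torus_measure d.+1) (fun x => `|g x|) := L1_norm Lg.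
have : \forall x \ae torus_measure d.+1, `|g x| = 0.
  apply: Rintg_eq0 => //.
  have [|_ ->] := torusS_integral (L1_meas Lag); first exact: torusS_integrable.
  rewrite -[RHS](Rintg0 (time_product (torus_measure d) 1)); apply: ae_eq_Rintg => //.
    exact: L1_meas (torusS_integrable Lag).
  by apply: filterS H => z ->; rewrite normr0.
by apply: filterS => x /normr0_eq0.
Qed.

End waves.

(** * Smooth functions on the torus *)

Section Ck_theory.
Context {R : realType}.

(** Both difference quotients are the same function of h, hence so are their limits. This is the
    chain rule for the directional derivatives on which [Ck] is built. *)
Lemma derive_affine (V W : normedModType R) (A : V -> W) (f : W -> R) (v : V) (w : W) (x : V) :
  (forall h : R, A (h *: v + x) = h *: w + A x) ->
  'D_v (f \o A) x = 'D_w f (A x) /\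
  (derivable (f \o A) x v <-> derivable f (A x) w).
Proof.
move=> HA.
have E : (fun h : R => h^-1 *: ((f \o A) (h *: v + x) - (f \o A) x)) =
    (fun h : R => h^-1 *: (f (h *: w + A x) - f (A x))).
  by apply/funext => h /=; rewrite HA.
by rewrite /derive /derivable E.
Qed.

Lemma Ck_cont (V : normedModType R) k (f : V -> R) : Ck k f -> continuous f.
Proof. by case: k => [|k] []. Qed.

Lemma CkS (V : normedModType R) k (f : V -> R) : Ck k.+1 f -> Ck k f.
Proof.
elim: k f => [|k IH] f [cf Hf]; first by split.
by split=> // v; have [df Cf] := Hf v; split=> //; exact: IH.
Qed.

Lemma Ck_derivable (V : normedModType R) k (f : V -> R) v x : Ck k.+1 f -> derivable f x v.
Proof. by move=> [_ /(_ v)[]]. Qed.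

Lemma Ck_derive (V : normedModType R) k (f : V -> R) v : Ck k.+1 f ->
  Ck k (fun x => 'D_v f x).
Proof. by move=> [_ /(_ v)[]]. Qed.

Lemma Ck_cst (V : normedModType R) k (c : R) : Ck k (fun _ : V => c).
Proof.
elim: k c => [|k IH] c; first by split => //; exact: cst_continuous.
split; first exact: cst_continuous.
move=> v; split; first by move=> x; exact: derivable_cst.
by under eq_fun do rewrite derive_cst; exact: IH.
Qed.

Lemma CkD (V : normedModType R) k (f g : V -> R) : Ck k f -> Ck k g ->
  Ck k (fun x => f x + g x).
Proof.
elim: k f g => [|k IH] f g [cf Hf] [cg Hg].
  by split => // x; apply: cvgD; [exact: cf|exact: cg].
split; first by move=> x; apply: cvgD; [exact: cf|exact: cg].
move=> v; have [df Cf] := Hf v; have [dg Cg] := Hg v; split.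
  by move=> x; exact: derivableD.
under eq_fun do rewrite deriveD//.
exact: IH.
Qed.

Lemma CkM (V : normedModType R) k (f g : V -> R) : Ck k f -> Ck k g ->
  Ck k (fun x => f x * g x).
Proof.
elim: k f g => [|k IH] f g Cf Cg.
  by split => // x; apply: cvgM; [exact: (Ck_cont Cf)|exact: (Ck_cont Cg)].
split; first by move=> x; apply: cvgM; [exact: (Ck_cont Cf)|exact: (Ck_cont Cg)].
move=> v; have [df Cf'] := Cf.2 v; have [dg Cg'] := Cg.2 v; split.
  by move=> x; exact: derivableM.
under eq_fun do rewrite deriveM//.
by apply: CkD; apply: IH => //; exact: CkS.
Qed.

Lemma CkZ (V : normedModType R) k (c : R) (f : V -> R) : Ck k f -> Ck k (fun x => c * f x).
Proof. by apply: CkM; exact: Ck_cst. Qed.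

Lemma Ck_sum (V : normedModType R) k (I : Type) (s : seq I) (f : I -> V -> R) :
  (forall i, Ck k (f i)) -> Ck k (fun x => \sum_(i <- s) f i x).
Proof.
move=> Cf; elim: s => [|i s IH].
  by under eq_fun do rewrite big_nil; exact: Ck_cst.
by under eq_fun do rewrite big_cons; exact: CkD.
Qed.

(** [L] is the linear part of [A]. The derivative of f o A in direction v is the derivative of f in
    direction L v, composed with A, so the induction closes over all directions at once. *)
Lemma Ck_comp_affine (V W : normedModType R) k (A : V -> W) (L : V -> W) (f : W -> R) :
  continuous A -> (forall (h : R) v x, A (h *: v + x) = h *: L v + A x) ->
  Ck k f -> Ck k (f \o A).
Proof.
move=> cA HA; elim: k f => [|k IH] f [cf Hf].
  by split=> // x; apply: continuous_comp; [exact: cA|exact: cf].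
split; first by move=> x; apply: continuous_comp; [exact: cA|exact: cf].
move=> v; split=> [x|].
  have [_ [_]] := derive_affine f (fun h => HA h v x); apply.
  exact: (Hf (L v)).1.
have -> : (fun x => 'D_v (f \o A) x) = (fun y => 'D_(L v) f y) \o A.
  by apply/funext => x; have [-> _] := derive_affine f (fun h => HA h v x).
exact: IH (Hf (L v)).2.
Qed.

Lemma Ck_id k : Ck k (fun t : R => t).
Proof.
case: k => [|k]; first by split => // x; exact: cvg_id.
split; first by move=> x; exact: cvg_id.
move=> v; split=> [x|]; first exact: derivable_id.
by under eq_fun do rewrite derive_id; exact: Ck_cst.
Qed.

Lemma Ck_exp k n : Ck k (fun t : R => t ^+ n).
Proof.
elim: n => [|n IH]; first by under eq_fun do rewrite expr0; exact: Ck_cst.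
by under eq_fun do rewrite exprS; apply: CkM => //; exact: Ck_id.
Qed.

Lemma is_derive_cosq m (t v : R) : is_derive t v (@cosq R m) (v * cosq m.+1 t).
Proof.
have H1 : is_derive t 1 (@cosq R m) (cosq m.+1 t).
  have Hs : is_derive t 1 (fun t : R => t + m%:R * (pi / 2)) 1.
    by rewrite -[X in is_derive _ _ _ X]addr0; apply: is_deriveD.
  have := @is_derive1_comp R cos (fun t => t + m%:R * (pi / 2)) t _ _ (is_derive_cos _) Hs.
  by rewrite cosqS ?mulr1 ?mul1r.
have df : differentiable (@cosq R m) t by apply/derivable1_diffP; have [] := H1.
split; first exact: diff_derivable.
rewrite deriveE// -[v in LHS]mulr1 -[v * 1]/(v *: (1 : R)) linearZ -deriveE//.
by have [_ ->] := H1.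
Qed.

Lemma Ck_cosq k m : Ck k (@cosq R m).
Proof.
have cc n : continuous (@cosq R n).
  move=> t; apply: (@continuous_comp _ _ _ (fun t => t + _) cos).
    by apply: cvgD; [exact: cvg_id|exact: cvg_cst].
  exact: continuous_cos.
elim: k m => [|k IH] m; first by split.
split => // v; split => [t|]; first by have [] := is_derive_cosq m t v.
have -> : (fun t => 'D_v (@cosq R m) t) = fun t => v * cosq m.+1 t.
  by apply/funext => t; have [_] := is_derive_cosq m t v.
exact: CkZ.
Qed.

End Ck_theory.

(** * Measurability and boundedness of continuous functions *)

Section continuous_measurable.
Context {R : realType}.

Lemma cvg_rV (T : Type) (F : set_system T) (FF : Filter F) d (a : T -> 'rV[R]_d) (x : 'rV[R]_d) :
  (forall i, a t 0 i @[t --> F] --> x 0 i) -> a @ F --> x.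
Proof.
move=> H; apply/cvg_ballP => e e0.
have : \forall t \near F, forall i : 'I_d, ball (x 0 i) e (a t 0 i).
  by apply: filter_forall => i; move/cvg_ballP : (H i); exact.
apply: filterS => t Ht; split => // i j; rewrite !ord1; exact: Ht.
Qed.

(* A continuous function is the limit of its values at the points of the grids
   (1/(m+1)) Z^d, each of which takes countably many values on measurable boxes. *)
Lemma continuous_rV_measurable d (f : 'rV[R]_d -> R) : continuous f ->
  measurable_fun setT f.
Proof.
move=> cf.
pose K m (x : 'rV[R]_d) : 'rV[int]_d := \row_i Num.floor (m.+1%:R * x 0 i).
pose c m (k : 'rV[int]_d) : 'rV[R]_d := \row_i ((k 0 i)%:~R / m.+1%:R).
have mK m k : measurable [set x | K m x = k].
  have -> : [set x | K m x = k] = \bigcap_(i in [set: 'I_d])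
      ((fun x : 'rV[R]_d => m.+1%:R * x 0 i) @^-1` `[(k 0 i)%:~R, (k 0 i + 1)%:~R[).
    apply/seteqP; split => x /=.
      by move=> <- i _ /=; rewrite in_itv/= !mxE floor_itv.
    move=> H; apply/rowP => i; rewrite mxE.
    by have := H i I; rewrite /= in_itv/= => /floor_def.
  apply: fin_bigcap_measurable => // i _; rewrite -[X in measurable X]setTI.
  have mi : measurable_fun setT (fun x : 'rV[R]_d => m.+1%:R * x 0 i).
    by apply: measurable_funM => //; exact: measurable_rV_coord.
  exact: mi.
have mfm m : measurable_fun setT (fun x => f (c m (K m x))).
  move=> _ Y mY; rewrite setTI.
  have -> : (fun x => f (c m (K m x))) @^-1` Y =
      \bigcup_k ([set x | K m x = k] `&` [set x | Y (f (c m k))]).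
    apply/seteqP; split => x /=; first by move=> Yx; exists (K m x).
    by move=> [k _ /= [<-]].
  apply: countable_bigcupT_measurable; first exact: countableP.
  move=> k; have [Yk|nYk] := pselect (Y (f (c m k))).
    by rewrite (_ : [set x | Y _] = setT) ?setIT//; apply/seteqP; split.
  by rewrite (_ : [set x | Y _] = set0) ?setI0//; apply/seteqP; split.
have lim x : f (c m (K m x)) @[m --> \oo] --> f x.
  apply: (@cvg_comp _ _ _ (fun m => c m (K m x)) f _ (nbhs x)); last exact: cf.
  apply: cvg_rV => i.
  have H m : x 0 i - m.+1%:R^-1 <= c m (K m x) 0 i <= x 0 i.
    rewrite !mxE; have /andP[H1 H2] := floor_itv (m.+1%:R * x 0 i).
    have m0 : (0 : R) < m.+1%:R by rewrite ltr0n.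
    apply/andP; split; last by rewrite ler_pdivrMr// [leRHS]mulrC.
    rewrite ler_pdivlMr// mulrBl mulVf ?gt_eqF// [X in X - _]mulrC.
    by move: H2; rewrite intrD => /ltW; rewrite lerBlDr.
  apply: squeeze_cvgr; [exact: nearW H| |exact: cvg_cst].
  rewrite -[X in _ --> X]subr0; apply: cvgB; first exact: cvg_cst.
  exact: cvg_harmonic.
have -> : f = fun x => seq_lim (fun m => f (c m (K m x))).
  by apply/funext => x; rewrite (seq_limE (lim x)).
exact: measurable_seq_lim.
Qed.

Definition rV_split d (y : 'rV[R]_d.+1) : R * 'rV[R]_d :=
  ((y : 'rV_(1 + d)) 0 (lshift d ord0), \row_j (y : 'rV_(1 + d)) 0 (rshift 1 j)).

Lemma rV_consK d : cancel (@rV_cons R d) (@rV_split d).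
Proof.
move=> [t x]; rewrite /rV_split /rV_cons /=; congr (_, _).
  by rewrite row_mxEl mxE.
by apply/rowP => j; rewrite mxE row_mxEr.
Qed.

Lemma cvg_to_pair (T : Type) (F : set_system T) (FF : Filter F)
    (V W : normedModType R) (a : T -> V) (b : T -> W) (x : V) (y : W) :
  a @ F --> x -> b @ F --> y -> (a t, b t) @[t --> F] --> (x, y).
Proof.
move=> ax by_; apply/cvg_ballP => e e0.
have A : \forall t \near F, ball x e (a t) by move/cvg_ballP : ax; exact.
have B : \forall t \near F, ball y e (b t) by move/cvg_ballP : by_; exact.
by near=> t; split => /=; near: t.
Unshelve. all: by end_near. Qed.

Lemma cvg_to_fst (V W : normedModType R) (z : V * W) : u.1 @[u --> z] --> z.1.
Proof. by case: z => x y; exact: cvg_fst. Qed.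

Lemma cvg_to_snd (V W : normedModType R) (z : V * W) : u.2 @[u --> z] --> z.2.
Proof. by case: z => x y; exact: cvg_snd. Qed.

Lemma rV_split_continuous d : continuous (@rV_split d).
Proof.
move=> y; apply: (@cvg_to_pair _ _ (nbhs_filter y)).
  exact: (@coord_continuous R 1 (1 + d) 0 (lshift d ord0) y).
apply: (@cvg_rV _ _ (nbhs_filter y)) => j; under eq_fun do rewrite mxE; rewrite mxE.
exact: (@coord_continuous R 1 (1 + d) 0 (rshift 1 j) y).
Qed.

Lemma rV_cons_continuous d : continuous (@rV_cons R d).
Proof.
move=> z; apply: cvg_rV => i; rewrite /rV_cons.
rewrite -(fintype.splitK (i : 'I_(1 + d)%N)).
case: (fintype.split _) => j /=.
  under eq_fun do rewrite mxE (unsplitK (inl j)) mxE.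
  by rewrite mxE (unsplitK (inl j)) mxE; exact: cvg_to_fst.
under eq_fun do rewrite mxE (unsplitK (inr j)).
rewrite mxE (unsplitK (inr j)).
apply: (@cvg_comp _ _ _ snd (fun x : 'rV[R]_d => x 0 j) _ (nbhs z.2)); first exact: cvg_to_snd.
exact: coord_continuous.
Qed.

(** Time is treated as one more coordinate: the function is continuous on R^(d+1), where the grid
    argument applies, and [rV_cons] carries measurability back to the product sigma-algebra. *)
Lemma continuous_spacetime_measurable d (f : R * 'rV[R]_d -> R) : continuous f ->
  measurable_fun setT f.
Proof.
move=> cf.
have -> : f = (f \o @rV_split d) \o @rV_cons R d.
  by apply/funext => z /=; rewrite rV_consK.
apply: (@measurableT_comp _ _ _ _ _ _ (f \o @rV_split d)); last exact: measurable_rV_cons.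
apply: continuous_rV_measurable => y.
by apply: continuous_comp; [exact: rV_split_continuous|exact: cf].
Qed.

Lemma periodic_shift d (f : 'rV[R]_d -> R) (k : 'rV[int]_d) x : torus_periodic f ->
  f (x + map_mx intr k) = f x.
Proof.
move=> pf.
have pn i (n : nat) y : f (y + n%:R *: delta_mx 0 i) = f y.
  elim: n y => [|n IH] y; first by rewrite scale0r addr0.
  by rewrite -natr1 scalerDl scale1r addrA pf IH.
have pz i (n : int) y : f (y + n%:~R *: delta_mx 0 i) = f y.
  case: n => n; first exact: pn.
  by rewrite NegzE mulrNz scaleNr -[LHS](pn i n.+1) subrK.
have ps (s : seq 'I_d) y : f (y + \sum_(i <- s) (k 0 i)%:~R *: delta_mx 0 i) = f y.
  elim: s y => [|i s IH] y; first by rewrite big_nil addr0.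
  by rewrite big_cons addrA IH pz.
rewrite -[RHS](ps (index_enum _)); congr (f (_ + _)).
rewrite [LHS]row_sum_delta; apply: eq_bigr => i _.
by rewrite mxE.
Qed.

Lemma rV_cube_reduction d (x : 'rV[R]_d) : exists k : 'rV[int]_d,
  forall i, (x + map_mx intr k) 0 i \in `[0, 1]%R.
Proof.
exists (\row_i (- Num.floor (x 0 i))) => i; rewrite !mxE in_itv/= mulrNz.
by have := floor_itv (x 0 i); rewrite intrD => /andP[? ?]; apply/andP; split; lra.
Qed.

Lemma rV_cube_compact d : compact [set x : 'rV[R]_d | forall i, x 0 i \in `[0, 1]%R].
Proof.
exact: (@rV_compact R d (fun=> `[0, 1]%classic) (fun=> @segment_compact R 0 1)).
Qed.

Lemma continuous_compact_bounded (V : topologicalType) (A : set V) (f : V -> R) :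
  A !=set0 -> compact A -> continuous f -> exists C, forall x, A x -> `|f x| <= C.
Proof.
move=> A0 cA cf.
have cnf : {within A, continuous (fun x => `|f x|)}.
  apply: continuous_subspaceT => x.
  by apply: continuous_comp; [exact: cf|exact: norm_continuous].
have [c _ Hc] := compact_EVT_max A0 cA cnf.
by exists `|f c| => x Ax; apply: Hc; rewrite inE.
Qed.

Lemma continuous_periodic_bounded d (f : 'rV[R]_d -> R) : continuous f ->
  torus_periodic f -> exists C, forall x, `|f x| <= C.
Proof.
move=> cf pf.
have [|C HC] := continuous_compact_bounded _ (@rV_cube_compact d) cf.
  by exists 0 => i; rewrite mxE in_itv/= lexx ler01.
exists C => x; have [k Hk] := rV_cube_reduction x.
by rewrite -(periodic_shift k x pf); exact: HC.
Qed.

Lemma continuous_spacetime_bounded d (T : R) (f : R * 'rV[R]_d -> R) : 0 <= T ->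
  continuous f -> (forall t, torus_periodic (fun x => f (t, x))) ->
  exists C, forall t x, 0 <= t <= T -> `|f (t, x)| <= C.
Proof.
move=> T0 cf pf.
have [||C HC] := continuous_compact_bounded (A := `[0, T]%classic `*` [set x : 'rV[R]_d | forall i, x 0 i \in `[0, 1]%R]) _ _ cf.
- exists (0, 0); split => /=; first by rewrite in_itv/= lexx T0.
  by move=> i; rewrite mxE in_itv/= lexx ler01.
- by apply: compact_setX; [exact: segment_compact|exact: rV_cube_compact].
exists C => t x tT; have [k Hk] := rV_cube_reduction x.
by rewrite -(periodic_shift k x (pf t)); apply: HC; split => //=; rewrite in_itv.
Qed.

End continuous_measurable.

(** * Integration by parts on the torus *)

Section torus_calculus.
Context {R : realType}.

Lemma L2_continuous_periodic d (f : 'rV[R]_d -> R) : continuous f ->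
  torus_periodic f -> L2 (torus_measure d) f.
Proof.
move=> cf pf; have [C HC] := continuous_periodic_bounded cf pf.
apply: (@L2_bounded _ _ _ _ _ C); first exact: continuous_rV_measurable.
exact: aeW.
Qed.

Lemma spartial_periodic d (f : 'rV[R]_d -> R) i : torus_periodic f ->
  torus_periodic (spartial i f).
Proof.
move=> pf x j; rewrite /spartial.
have [e _] := @derive_affine R _ _ (fun x : 'rV[R]_d => x + delta_mx 0 j) f (delta_mx 0 i)
  (delta_mx 0 i) x (fun h => esym (addrA _ _ _)).
have fE : f \o (fun x : 'rV[R]_d => x + delta_mx 0 j) = f by apply/funext => y; exact: pf.
by rewrite -e fE.
Qed.

Lemma leb0_FTC (T s : R) (phi : R -> R) : Ck 1 phi -> 0 <= s <= T ->
  \int[leb0 T]_t (\1_(`[0, s]) t * 'D_1 phi t) = phi s - phi 0.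
Proof.
move=> [cphi Hphi] /andP[s0 sT].
have [dphi [cdphi _]] := Hphi 1.
have [->|sN0] := eqVneq s 0.
  rewrite subrr -[RHS](Rintg0 (leb0 T)); apply: ae_eq_Rintg => //.
    apply: measurable_funM; first exact: measurable_indic.
    by apply: continuous_measurable_fun; exact: cdphi.
  apply: filterS (leb0_ae_of_leb T (leb_ae_neq 0)) => t t0.
  rewrite indicE memNset ?mul0r//= in_itv/= => /andP[? ?].
  by apply: t0; apply/eqP; rewrite eq_le; apply/andP.
have sp : 0 < s by rewrite lt_neqAle eq_sym sN0.
have sT' : `[0, s]%classic `<=` `[0, T]%classic.
  by move=> t /=; rewrite !in_itv/= => /andP[-> ts] /=; exact: le_trans ts sT.
have Ld : L1 (leb0 T) (fun t => \1_(`[0, T]) t * 'D_1 phi t).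
  have [|C HC] := @continuous_compact_bounded R R `[0, T]%classic _ _ (@segment_compact R 0 T) cdphi.
    by exists 0; rewrite /= in_itv/= lexx (le_trans s0).
  apply: (@L1_bounded _ _ _ _ _ C).
    apply: measurable_funM; first exact: measurable_indic.
    by apply: continuous_measurable_fun; exact: cdphi.
  apply: filterS (leb0_ae_itv T) => t tT.
  by rewrite indicE mem_set ?mul1r ?HC //= in_itv.
transitivity (\int[leb0 T]_(t in `[0, s]) (\1_(`[0, T]) t * 'D_1 phi t)).
  rewrite [RHS]Rintegral_mkcond; apply: eq_Rintegral => t _.
  rewrite patchE indicE; case: ifPn => ts; last by rewrite mul0r.
  by rewrite indicE mem_set//; apply: sT'; exact: set_mem.
rewrite eq_leb0_Rintegral//.
transitivity (\int[lebesgue_measure]_(t in `[0, s]) ('D_1 phi t)).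
  by apply: eq_Rintegral => t /[!inE] ts; rewrite indicE mem_set ?mul1r//; exact: sT'.
rewrite /Rintegral (continuous_FTC2 sp (F := phi))//=.
- by apply: continuous_subspaceT; exact: cdphi.
- split.
  + by move=> x _; exact: dphi.
  + by apply: cvg_at_right_filter; exact: cphi.
  + by apply: cvg_at_left_filter; exact: cphi.
- by move=> x _; rewrite derive1E.
Qed.

Lemma rV_consD d (h t t0 : R) (v x : 'rV[R]_d) :
  rV_cons (h * t + t0, h *: v + x) = h *: rV_cons (t, v) + rV_cons (t0, x).
Proof.
have E (a b : 'rV[R]_1) : row_mx (h *: a + b) (h *: v + x) = h *: row_mx a v + row_mx b x.
  by rewrite scale_row_mx add_row_mx.
have e : const_mx (h * t + t0) = h *: const_mx t + const_mx t0 :> 'rV[R]_1.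
  by apply/rowP => i; rewrite !mxE.
by rewrite /rV_cons /= e; exact: E.
Qed.

Lemma rV_cons_delta0 d : rV_cons (1, 0) = delta_mx 0 (lshift d ord0 : 'I_(1 + d)) :> 'rV[R]_d.+1.
Proof.
have e : const_mx 1 = delta_mx 0 ord0 :> 'rV[R]_1.
  by apply/rowP => i; rewrite !mxE !ord1 eqxx.
by rewrite /rV_cons /= e; symmetry; exact: (@delta_mx_lshift R 1 1 d 0 ord0).
Qed.

Lemma rV_cons_deltaS d j : rV_cons (0, delta_mx 0 j) =
  delta_mx 0 (rshift 1 j : 'I_(1 + d)) :> 'rV[R]_d.+1.
Proof.
have e : const_mx 0 = 0 :> 'rV[R]_1 by apply/rowP => i; rewrite !mxE.
by rewrite /rV_cons /= e; symmetry; exact: (@delta_mx_rshift R 1 1 d 0 j).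
Qed.

Lemma rV_cons_continuous_l d (x : 'rV[R]_d) : continuous (fun t : R => rV_cons (t, x)).
Proof.
move=> t; have H : (s, x) @[s --> t] --> (t, x).
  by apply: (cvg_to_pair (nbhs_filter t)); [exact: cvg_id|exact: cvg_cst].
exact: cvg_comp H (@rV_cons_continuous R d (t, x)).
Qed.

Lemma rV_cons_continuous_r d (t : R) : continuous (fun x : 'rV[R]_d => rV_cons (t, x)).
Proof.
move=> x; have H : (t, y) @[y --> x] --> (t, x).
  by apply: (cvg_to_pair (nbhs_filter x)); [exact: cvg_cst|exact: cvg_id].
exact: cvg_comp H (@rV_cons_continuous R d (t, x)).
Qed.

(** Induction on the dimension. In the first coordinate, integrating it first leaves the difference
    of f at opposite faces, which periodicity cancels. Any other derivative acts on the slices at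
    fixed first coordinate, which are periodic in one variable less. *)
Lemma integral_spartial d (f : 'rV[R]_d -> R) i : Ck 1 f -> torus_periodic f ->
  \int[torus_measure d]_x spartial i f x = 0.
Proof.
elim: d f i => [|d IH] f i Cf pf; first by case: i.
have [cf df] := Cf.
have cg : continuous (spartial i f) := (df (delta_mx 0 i)).2.1.
have pg : torus_periodic (spartial i f) by exact: spartial_periodic.
have mg := continuous_rV_measurable cg.
have [C HC] := continuous_periodic_bounded cg pg.
have Lg : L1 (time_product (torus_measure d) 1) (spartial i f \o @rV_cons R d).
  apply: (@L1_bounded _ _ _ _ _ C).
    exact: (measurableT_comp mg (@measurable_rV_cons R d)).
  by apply: aeW => z; exact: HC.
have [_ ->] := torusS_integral mg Lg.
have Fub : \int[time_product (torus_measure d) 1]_z spartial i f (rV_cons z) =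
    \int[leb0 1]_t \int[torus_measure d]_x spartial i f (rV_cons (t, x)).
  by rewrite (Rintg_fubini1 (f := spartial i f \o @rV_cons R d) Lg).
have cA_t := @rV_cons_continuous_r d.
have cA_x := @rV_cons_continuous_l d.
have hA_t (t h : R) (v x : 'rV[R]_d) : rV_cons (t, h *: v + x) = h *: rV_cons (0, v) + rV_cons (t, x).
  by rewrite -rV_consD mulr0 add0r.
have hA_x (x : 'rV[R]_d) (h v t : R) : rV_cons (h * v + t, x) = h *: rV_cons (v, 0) + rV_cons (t, x).
  by rewrite -rV_consD scaler0 add0r.
rewrite Fub; case: (fintype.split_ordP (i : 'I_(1 + d))) => j ij.
- rewrite (Rintg_fubini_swap (f := spartial i f \o @rV_cons R d) Lg) /=.
  rewrite -[RHS](Rintg0 (torus_measure d)); apply: eq_Rintegral => x _.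
  pose phi := f \o (fun t : R => rV_cons (t, x)).
  have Cphi : Ck 1 phi.
    apply: (@Ck_comp_affine R R _ 1 (fun t : R => rV_cons (t, x)) (fun v : R => rV_cons (v, 0)) f) => //.
    by move=> h v t; exact: (hA_x x h v t).
  have d0 : delta_mx 0 i = rV_cons (1, 0) :> 'rV[R]_d.+1.
    by rewrite rV_cons_delta0 ij ord1.
  have E t : spartial i f (rV_cons (t, x)) = 'D_1 phi t.
    have [e _] := @derive_affine R R _ (fun t : R => rV_cons (t, x)) f 1 (rV_cons (1, 0)) t (fun h => hA_x x h 1 t).
    by rewrite /spartial d0 -e.
  transitivity (\int[leb0 1]_t (\1_(`[0, 1]) t * 'D_1 phi t)).
    have mphi : measurable_fun setT (fun t => 'D_1 phi t).
      by apply: continuous_measurable_fun; exact: (Cphi.2 1).2.1.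
    transitivity (\int[leb0 1]_t 'D_1 phi t); first by apply: eq_Rintegral => t _; exact: E.
    apply: ae_eq_Rintg => //.
      by apply: measurable_funM => //; exact: measurable_indic.
    apply: filterS (leb0_ae_itv 1) => t t1.
    by rewrite indicE mem_set ?mul1r//= in_itv.
  rewrite leb0_FTC ?ler01 ?lexx// /phi /=.
  have -> : rV_cons (1, x) = rV_cons (0, x) + delta_mx 0 i :> 'rV[R]_d.+1.
    by rewrite d0 addrC -[rV_cons (1, 0)]scale1r -rV_consD mulr1 addr0 scaler0 add0r.
  by rewrite pf subrr.
rewrite -[RHS](Rintg0 (leb0 1)); apply: eq_Rintegral => t _.
pose F := f \o (fun x : 'rV[R]_d => rV_cons (t, x)).
have d0 : delta_mx 0 i = rV_cons (0, delta_mx 0 j) :> 'rV[R]_d.+1.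
  by rewrite rV_cons_deltaS ij.
have E x : spartial i f (rV_cons (t, x)) = spartial j F x.
  have [e _] := @derive_affine R _ _ (fun x : 'rV[R]_d => rV_cons (t, x)) f (delta_mx 0 j) (rV_cons (0, delta_mx 0 j)) x (fun h => hA_t t h (delta_mx 0 j) x).
  by rewrite /spartial d0 -e.
transitivity (\int[torus_measure d]_x spartial j F x); first by apply: eq_Rintegral => x _; exact: E.
apply: IH.
  exact: (@Ck_comp_affine R _ _ 1 _ (fun v => rV_cons (0, v)) f (cA_t t) (hA_t t)).
move=> x l; rewrite /F /=.
have -> : rV_cons (t, x + delta_mx 0 l) = rV_cons (t, x) + rV_cons (0, delta_mx 0 l) :> 'rV[R]_d.+1.
  by rewrite addrC [RHS]addrC -[rV_cons (0, _)]scale1r -rV_consD mulr0 add0r scale1r.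
by rewrite rV_cons_deltaS pf.
Qed.

Lemma torus_periodicM d (f g : 'rV[R]_d -> R) : torus_periodic f -> torus_periodic g ->
  torus_periodic (fun x => f x * g x).
Proof. by move=> pf pg x i; rewrite pf pg. Qed.

Lemma torus_IBP d (f g : 'rV[R]_d -> R) i : Ck 1 f -> torus_periodic f ->
  Ck 1 g -> torus_periodic g ->
  \int[torus_measure d]_x (spartial i f x * g x) =
  - \int[torus_measure d]_x (f x * spartial i g x).
Proof.
move=> Cf pf Cg pg.
have L (f' : 'rV[R]_d -> R) : Ck 1 f' -> torus_periodic f' -> L2 (torus_measure d) f'.
  by move=> C p; apply: L2_continuous_periodic => //; exact: Ck_cont C.
have Ls (f' : 'rV[R]_d -> R) : Ck 1 f' -> torus_periodic f' -> L2 (torus_measure d) (spartial i f').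
  move=> C p; apply: L2_continuous_periodic; last exact: spartial_periodic.
  exact: (C.2 (delta_mx 0 i)).2.1.
have := integral_spartial i (CkM Cf Cg) (torus_periodicM pf pg).
have -> : spartial i (fun x => f x * g x) = fun x => f x * spartial i g x + spartial i f x * g x.
  apply/funext => x; rewrite /spartial deriveM; [|exact: Ck_derivable Cf|exact: Ck_derivable Cg].
  by rewrite /GRing.scale/= [g x * _]mulrC.
rewrite RintgD; [|by apply: L2_mul; auto|by apply: L2_mul; auto].
by move=> /eqP; rewrite addrC addr_eq0 => /eqP.
Qed.

End torus_calculus.

(** * Trigonometric polynomials *)

Section trig_polynomials.
Context {R : realType} {d : nat}.
Implicit Types (k : 'rV[int]_d) (s : seq (R * ('rV[int]_d * nat))).

Let form k (x : 'rV[R]_d) : R := 2 * pi * \sum_i (k 0 i)%:~R * x 0 i.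

Let formD k (h : R) v x : form k (h *: v + x) = h *: form k v + form k x.
Proof.
rewrite /form /GRing.scale/=.
have -> : \sum_i (k 0 i)%:~R * (h *: v + x) 0 i =
    h * (\sum_i (k 0 i)%:~R * v 0 i) + \sum_i (k 0 i)%:~R * x 0 i.
  by rewrite mulr_sumr -big_split; apply: eq_bigr => i _ /=; rewrite !mxE; ring.
by ring.
Qed.

Let form_continuous k : continuous (form k).
Proof.
apply: (@Ck_cont _ _ 0); apply: CkZ; apply: Ck_sum => i; apply: CkZ.
by split => //; exact: coord_continuous.
Qed.

Lemma Ck_wave n k m : Ck n (@wave R d k m).
Proof. exact: (Ck_comp_affine (@form_continuous k) (@formD k) (@Ck_cosq R n m)). Qed.

Lemma spartial_wave i k m :
  spartial i (@wave R d k m) = fun x => 2 * pi * (k 0 i)%:~R * wave k m.+1 x.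
Proof.
apply/funext => x; rewrite /spartial.
have [-> _] := @derive_affine R _ _ (form k) (@cosq R m) (delta_mx 0 i)
  (form k (delta_mx 0 i)) x (fun h => formD k h (delta_mx 0 i) x).
have [_ ->] := @is_derive_cosq R m (form k x) (form k (delta_mx 0 i)).
congr (_ * _); rewrite /form; congr (_ * _).
rewrite (bigD1 i)//= big1 ?addr0; last first.
  by move=> j ji; rewrite mxE eqxx (negbTE ji) mulr0.
by rewrite mxE !eqxx mulr1.
Qed.

Lemma wave_periodic k m : torus_periodic (@wave R d k m).
Proof.
move=> x i; rewrite /wave -/(form k _) -[delta_mx 0 i]scale1r addrC formD.
rewrite /GRing.scale/= mul1r addrC.
have -> : form k (delta_mx 0 i) = 2 * pi * (k 0 i)%:~R.
  rewrite /form (bigD1 i)//= big1 ?addr0; last first.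
    by move=> j ji; rewrite mxE eqxx (negbTE ji) mulr0.
  by rewrite mxE !eqxx mulr1.
rewrite /cosq -addrA [_ + m%:R * _]addrC addrA -/(form k x).
set y := form k x + _.
have H (n : nat) (z : R) : cos (z + 2 * pi * n%:R) = cos z.
  rewrite -[RHS](periodicn (@cosD2pi R) n); congr (cos (_ + _)).
  by rewrite -mulrnA -[RHS]mulr_natr natrM; ring.
case: (k 0 i) => n; first exact: H.
by rewrite NegzE mulrNz mulrN -[LHS](H n.+1) subrK.
Qed.

Lemma wave2 k m x : wave k m.+2 x = - wave k m x :> R.
Proof. exact: cosqSS. Qed.

(** A list may repeat frequencies, so that sums are concatenations and derivatives and multipliers
    act entry by entry. *)
Definition tpoly s (x : 'rV[R]_d) : R := \sum_(p <- s) p.1 * wave p.2.1 p.2.2 x.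

Definition diff_tp (i : 'I_d) s :=
  [seq (p.1 * (2 * pi * (p.2.1 0 i)%:~R), (p.2.1, p.2.2.+1)) | p : R * ('rV[int]_d * nat) <- s].

(* Fourier multiplier of Delta^-1 d_i d_j; the division by 0 at k = 0 gives 0. *)
Definition riesz i j k : R :=
  (k 0 i)%:~R * (k 0 j)%:~R / \sum_l (k 0 l)%:~R ^+ 2.

Definition riesz_tp i j s := [seq (p.1 * riesz i j p.2.1, p.2) | p <- s].

Lemma Ck_tpoly n s : Ck n (tpoly s).
Proof. by apply: Ck_sum => p; apply: CkZ; exact: Ck_wave. Qed.

Lemma tpoly_periodic s : torus_periodic (tpoly s).
Proof. by move=> x i; apply: eq_bigr => p _; rewrite wave_periodic. Qed.

Lemma spartialD (f g : 'rV[R]_d -> R) i : Ck 1 f -> Ck 1 g ->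
  spartial i (fun x => f x + g x) = fun x => spartial i f x + spartial i g x.
Proof.
by move=> Cf Cg; apply/funext => x; rewrite /spartial deriveD//;
  [exact: Ck_derivable Cf|exact: Ck_derivable Cg].
Qed.

Lemma spartialZ (f : 'rV[R]_d -> R) (c : R) i : Ck 1 f ->
  spartial i (fun x => c * f x) = fun x => c * spartial i f x.
Proof.
move=> Cf; apply/funext => x; rewrite /spartial.
exact: (deriveZ c (Ck_derivable Cf)).
Qed.

Lemma spartial_tpoly i s : spartial i (tpoly s) = tpoly (diff_tp i s).
Proof.
elim: s => [|p s IH].
  apply/funext => x; rewrite /tpoly big_nil /spartial.
  by under eq_fun do rewrite big_nil; rewrite derive_cst.
have E q r : tpoly (q :: r) = fun x => q.1 * wave q.2.1 q.2.2 x + tpoly r x.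
  by apply/funext => x; rewrite /tpoly big_cons.
rewrite E spartialD; [|by apply: CkZ; exact: Ck_wave|exact: Ck_tpoly].
rewrite IH spartialZ; last exact: Ck_wave.
by apply/funext => x; rewrite spartial_wave /= E /= !mulrA.
Qed.

Lemma L2_tpoly s : L2 (torus_measure d) (tpoly s).
Proof. exact: (L2_continuous_periodic (Ck_cont (Ck_tpoly 0 s)) (@tpoly_periodic s)). Qed.

Lemma diff_tpC i j s x : tpoly (diff_tp i (diff_tp j s)) x = tpoly (diff_tp j (diff_tp i s)) x.
Proof. by rewrite /tpoly !big_map; apply: eq_bigr => p _ /=; congr (_ * _); rewrite mulrAC. Qed.

Lemma sum_sqr_eq0 k : \sum_l (k 0 l)%:~R ^+ 2 = 0 :> R -> k = 0.
Proof.
move=> H; apply/rowP => i; rewrite mxE; apply/eqP.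
have : \sum_l (k 0 l)%:~R ^+ 2 == 0 :> R by apply/eqP.
rewrite psumr_eq0; last by move=> l _; exact: sqr_ge0.
by move=> /allP /(_ i (mem_index_enum _)) /=; rewrite sqrf_eq0 intr_eq0.
Qed.

(** At k = 0 both sides vanish, so the default value of the division does no harm. *)
Lemma riesz_mul i j k : riesz i j k * \sum_l (k 0 l)%:~R ^+ 2 = (k 0 i)%:~R * (k 0 j)%:~R.
Proof.
have [H|H] := eqVneq (\sum_l (k 0 l)%:~R ^+ 2) (0 : R).
  by rewrite H mulr0 (sum_sqr_eq0 H) mxE mul0r.
by rewrite /riesz divfK.
Qed.

Lemma laplacian_riesz i j s x :
  laplacian (tpoly (riesz_tp i j s)) x = tpoly (diff_tp i (diff_tp j s)) x.
Proof.
rewrite /laplacian.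
under eq_bigr do rewrite !spartial_tpoly.
rewrite /tpoly; under eq_bigr do rewrite !big_map /=.
rewrite exchange_big /= !big_map; apply: eq_bigr => p _ /=.
have := riesz_mul i j p.2.1; set r := riesz _ _ _; set sm := \sum_l _ => H.
transitivity (p.1 * (r * sm) * (2 * pi) ^+ 2 * wave p.2.1 p.2.2.+2 x).
  rewrite /sm !mulr_sumr !mulr_suml; apply: eq_bigr => l _; ring.
by rewrite H; ring.
Qed.

Lemma L1_wave k m : L1 (torus_measure d) (@wave R d k m).
Proof.
exact: (L2_L1 (L2_continuous_periodic (Ck_cont (Ck_wave 0 k m)) (@wave_periodic k m))).
Qed.

(** If k_l is nonzero, the wave is a multiple of the l-th derivative of the wave of phase m + 3,
    since four quarter turns are the identity. *)
Lemma integral_wave k m : k != 0 -> \int[torus_measure d]_x wave k m x = 0 :> R.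
Proof.
move=> k0; have [l kl] : exists l, k 0 l != 0.
  apply/existsP; apply: contraNT k0 => /existsPn H; apply/eqP/rowP => l.
  by rewrite mxE; apply/eqP; have := H l; rewrite negbK.
have := integral_spartial l (@Ck_wave 1 k m.+3) (@wave_periodic k m.+3).
rewrite spartial_wave RintgZ; last first.
  exact: L1_wave.
under eq_Rintegral do rewrite !wave2 opprK.
move=> /eqP; rewrite !mulf_eq0 intr_eq0 (negbTE kl) pnatr_eq0 (gt_eqF (pi_gt0 R)) /=.
by move=> /eqP.
Qed.

Local Notation mu := (torus_measure d).

Lemma tpoly_IBP i s s' : \int[mu]_x (tpoly (diff_tp i s) x * tpoly s' x) =
  - \int[mu]_x (tpoly s x * tpoly (diff_tp i s') x).
Proof.
rewrite -!spartial_tpoly; apply: torus_IBP; [exact: Ck_tpoly|exact: tpoly_periodic|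
  exact: Ck_tpoly|exact: tpoly_periodic].
Qed.

Lemma L1_tpolyM s s' : L1 mu (fun x => tpoly s x * tpoly s' x).
Proof. by apply: L2_mul; exact: L2_tpoly. Qed.

(** With eta = [tpoly s], integration by parts and Delta phi = d_i d_j eta turn the left side into
    the integral of d_i phi d_j eta. Young's inequality leaves half of the integral of (d_i phi)^2,
    which is absorbed because it is one of the terms on the left. *)
Lemma riesz_grad_bound i j s (phi := riesz_tp i j s) :
  \sum_l \int[mu]_x tpoly (diff_tp l phi) x ^+ 2 <=
  \int[mu]_x tpoly (diff_tp j s) x ^+ 2.
Proof.
set S := \sum_l _.
have E : S = \int[mu]_x (tpoly (diff_tp i phi) x * tpoly (diff_tp j s) x).
  rewrite tpoly_IBP /S.
  transitivity (- \sum_l \int[mu]_x (tpoly phi x * tpoly (diff_tp l (diff_tp l phi)) x)).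
    rewrite -sumrN; apply: eq_bigr => l _; rewrite -tpoly_IBP.
    by apply: eq_Rintegral => x _; rewrite expr2.
  rewrite -Rintg_sum; last by move=> l _; exact: L1_tpolyM.
  congr (- _); apply: eq_Rintegral => x _; rewrite -mulr_sumr -laplacian_riesz.
  by congr (_ * _); apply: eq_bigr => l _; rewrite !spartial_tpoly.
have H : S <= 2^-1 * \int[mu]_x tpoly (diff_tp i phi) x ^+ 2 +
    2^-1 * \int[mu]_x tpoly (diff_tp j s) x ^+ 2.
  have [[_ ?] [_ ?]] := (L2_tpoly (diff_tp i phi), L2_tpoly (diff_tp j s)).
  rewrite E -!RintgZ// -RintgD; [|exact: L1Z|exact: L1Z].
  apply: le_Rintg; [exact: L1_tpolyM|by apply: L1D; exact: L1Z|].
  move=> x; have := sqr_ge0 (tpoly (diff_tp i phi) x - tpoly (diff_tp j s) x); nra.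
have H2 : \int[mu]_x tpoly (diff_tp i phi) x ^+ 2 <= S.
  rewrite /S (bigD1 i)//= lerDl; apply: sumr_ge0 => l _.
  by apply: Rintg_ge0 => x; exact: sqr_ge0.
by lra.
Qed.

(** Two integrations by parts replace (d_l d_m phi)^2 by (d_l d_l phi)(d_m d_m phi); the double sum
    is then the integral of (Delta phi)^2. *)
Lemma riesz_hess_bound i j s (phi := riesz_tp i j s) :
  \sum_l \sum_m \int[mu]_x tpoly (diff_tp l (diff_tp m phi)) x ^+ 2 =
  \int[mu]_x tpoly (diff_tp i (diff_tp j s)) x ^+ 2.
Proof.
transitivity (\sum_l \sum_m \int[mu]_x (tpoly (diff_tp l (diff_tp l phi)) x *
    tpoly (diff_tp m (diff_tp m phi)) x)).
  apply: eq_bigr => l _; apply: eq_bigr => m _.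
  rewrite tpoly_IBP.
  transitivity (\int[mu]_x (tpoly (diff_tp m (diff_tp l phi)) x * tpoly (diff_tp l (diff_tp m phi)) x)).
    by apply: eq_Rintegral => x _; rewrite expr2 (diff_tpC m l).
  rewrite tpoly_IBP; congr (- _); apply: eq_Rintegral => x _; congr (_ * _).
  exact: diff_tpC.
under eq_bigr do rewrite -(Rintg_sum _ (fun m _ => L1_tpolyM _ _)).
rewrite -Rintg_sum; last by move=> l _; apply: L1_sum => m _; exact: L1_tpolyM.
apply: eq_Rintegral => x _.
  rewrite -laplacian_riesz expr2 /laplacian mulr_suml.
  apply: eq_bigr => l _; rewrite mulr_sumr; apply: eq_bigr => m _.
  by rewrite !spartial_tpoly.
Qed.

End trig_polynomials.

(** * The constraint equation *)

Section tested_equation.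
Context {R : realType} {d : nat}.
Variables (T nu : R).
Local Notation point := (R * 'rV[R]_d)%type.
Local Notation Q := (spacetime d T).

(** The right-hand integrand of the constraint for the test field S eta, with phi in the place of
    Delta^-1 d_i d_j (S_ij eta) and the time factor removed. *)
Definition flux (S : 'M[R]_d) (eta phi : 'rV[R]_d -> R)
    (E : point -> 'rV[R]_d) (chi : point -> 'M[R]_d) (z : point) : R :=
  - (\sum_i \sum_j E z 0 i * (S i j * spartial j eta z.2))
  + \sum_l E z 0 l * spartial l phi z.2
  + 2 * nu * (\sum_l \sum_k chi z l k * spartial l (spartial k phi) z.2)
  - 2 * nu * (\sum_i \sum_j \sum_l
      chi z l i * (S i j * spartial l (spartial j eta) z.2)).

(** The multiplier by which the map eta |-> Delta^-1 d_i d_j (S_ij eta) acts on waves of frequency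
    k. *)
Definition riesz_mx (S : 'M[R]_d) (k : 'rV[int]_d) : R :=
  \sum_i \sum_j S i j * riesz i j k.

Lemma Ck_fst n : Ck n (fun z : point => z.1).
Proof.
have := @Ck_comp_affine R _ R n (fun z : point => z.1) (fun z : point => z.1) id.
by apply; [move=> z; exact: cvg_to_fst| |exact: Ck_id].
Qed.

Lemma Ck_comp_snd n (f : 'rV[R]_d -> R) : Ck n f -> Ck n (fun z : point => f z.2).
Proof.
move=> Cf; apply: (@Ck_comp_affine R _ _ n (fun z : point => z.2) (fun z : point => z.2) f) => //.
by move=> z; exact: cvg_to_snd.
Qed.

Lemma smooth_monomial_wave n c (k : 'rV[int]_d) m :
  smooth_spacetime (fun t x => t ^+ n * (c * @wave R d k m x)).
Proof.
split=> [j|t x i]; last by rewrite wave_periodic.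
apply: (@CkM R point j (fun z => z.1 ^+ n) (fun z => c * wave k m z.2)).
  elim: n => [|n IH]; first exact: Ck_cst.
  under eq_fun do rewrite exprS.
  by apply: CkM => //; exact: Ck_fst.
by apply: CkZ; apply: Ck_comp_snd; exact: Ck_wave.
Qed.

(** The test field is t^(n+1) times S times a wave. The exponent n + 1 makes it vanish at t = 0, as
    the constraint demands, and on a wave the inverse Laplacian is the factor [riesz_mx S k]. *)
Lemma EB_equation_monomial_wave E B chi (S : 'M[R]_d) n (k : 'rV[int]_d) m :
  EB_equation T nu E B chi -> symmetric_mx S ->
  - (\int[Q]_z (\sum_i \sum_j B z i j * (n.+1%:R * z.1 ^+ n * (S i j * wave k m z.2)))) =
  \int[Q]_z (z.1 ^+ n.+1 *
    flux S (wave k m) (fun x => riesz_mx S k * wave k m x) E chi z).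
Proof.
move=> heq symS.
pose psi (t : R) (x : 'rV[R]_d) : 'M[R]_d := \matrix_(i, j) (t ^+ n.+1 * (S i j * wave k m x)).
pose phi (t : R) (x : 'rV[R]_d) : R := t ^+ n.+1 * (riesz_mx S k * wave k m x).
have psiE t i j : (fun x => psi t x i j) = fun x => t ^+ n.+1 * S i j * wave k m x.
  by apply/funext => x; rewrite mxE mulrA.
have phiE t : phi t = fun x => t ^+ n.+1 * riesz_mx S k * wave k m x.
  by apply/funext => x; rewrite /phi mulrA.
have Cw i l m' : Ck l (fun x => i * @wave R d k m' x) by apply: CkZ; exact: Ck_wave.
have sp i c m' : spartial i (fun x => c * @wave R d k m' x) =
    fun x => c * (2 * pi * (k 0 i)%:~R) * wave k m'.+1 x.
  rewrite spartialZ ?spartial_wave; last exact: Ck_wave.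
  by apply/funext => x; rewrite mulrA.
have sw i m' : spartial i (@wave R d k m') = fun x => 2 * pi * (k 0 i)%:~R * wave k m'.+1 x := spartial_wave i k m'.
have H1 i j : smooth_spacetime (fun t x => psi t x i j).
  have -> : (fun t x => psi t x i j) = fun t x => t ^+ n.+1 * (S i j * wave k m x).
    by apply/funext => t; apply/funext => x; rewrite mxE.
  exact: smooth_monomial_wave.
have H2 t x : symmetric_mx (psi t x).
  by apply/matrixP => i j; rewrite !mxE -[in RHS]symS mxE.
have H3 x : psi 0 x = 0.
  by apply/matrixP => i j; rewrite !mxE expr0n mul0r.
have H4 : smooth_spacetime phi by exact: smooth_monomial_wave.
have H5 t : is_invlaplacian (divdiv (psi t)) (phi t).
  split.
  + split; last by move=> x i; rewrite /phi wave_periodic.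
    by move=> l; rewrite phiE; exact: Cw.
  + rewrite phiE RintgZ; last exact: L1_wave.
    (* The potential must have zero mean: a wave of nonzero frequency does, and at frequency zero
       the multiplier is 0. *)
    have [->|k0] := eqVneq k 0; last by rewrite integral_wave ?mulr0.
    rewrite /riesz_mx big1 ?mulr0 ?mul0r// => i _; rewrite big1// => j _.
    by rewrite /riesz !mxE mul0r mul0r mulr0.
  + move=> x; rewrite /laplacian /divdiv phiE.
    transitivity (t ^+ n.+1 * (\sum_i \sum_j S i j * (riesz i j k * \sum_l (k 0 l)%:~R ^+ 2)) *
       (2 * pi) ^+ 2 * wave k m.+2 x).
      under eq_bigr do rewrite !sp.
      rewrite -mulr_suml; congr (_ * _).
      have -> : \sum_i \sum_j S i j * (riesz i j k * \sum_l (k 0 l)%:~R ^+ 2) =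
          riesz_mx S k * \sum_l (k 0 l)%:~R ^+ 2.
        rewrite /riesz_mx mulr_suml; apply: eq_bigr => i _.
        by rewrite mulr_suml; apply: eq_bigr => j _; rewrite mulrA.
      move: (riesz_mx S k) => r; rewrite !mulr_sumr mulr_suml; apply: eq_bigr => l _; ring.
    rewrite mulr_sumr !mulr_suml; apply: eq_bigr => i _.
    rewrite mulr_sumr !mulr_suml; apply: eq_bigr => j _.
    by rewrite psiE !sp riesz_mul; ring.
have -> : \int[Q]_z (\sum_i \sum_j B z i j * (n.+1%:R * z.1 ^+ n * (S i j * wave k m z.2))) =
   \int[Q]_z (\sum_i \sum_j B z i j * tpartial (fun t x => psi t x i j) z.1 z.2).
  apply: eq_Rintegral => z _; apply: eq_bigr => i _; apply: eq_bigr => j _.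
  congr (_ * _); rewrite /tpartial.
  have -> : (fun s => psi s z.2 i j) = fun s => (S i j * wave k m z.2) * s ^+ n.+1.
    by apply/funext => s; rewrite mxE mulrC.
  rewrite derive1E (deriveZ (S i j * wave k m z.2) (Ck_derivable (Ck_exp 1 n.+1))).
  by rewrite exp_derive /GRing.scale/= mulr1 mulrC.
rewrite (heq psi phi H1 H2 H3 H4 H5); apply: eq_Rintegral => z _.
rewrite /flux phiE mulrBr !mulrDr; congr (_ + _ + _ - _).
- rewrite mulrN; congr (- _); rewrite mulr_sumr; apply: eq_bigr => i _.
  rewrite mulr_sumr; apply: eq_bigr => j _; rewrite psiE sp sw; ring.
- rewrite [RHS]mulr_sumr; apply: eq_bigr => l _; rewrite !sp; ring.
- rewrite [RHS]mulrCA; congr (_ * _); rewrite [RHS]mulr_sumr; apply: eq_bigr => l _.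
  rewrite [RHS]mulr_sumr; apply: eq_bigr => h _; rewrite !sp; ring.
- rewrite [RHS]mulrCA; congr (_ * _); rewrite mulr_sumr; apply: eq_bigr => i _.
  rewrite mulr_sumr; apply: eq_bigr => j _.
  rewrite mulr_sumr; apply: eq_bigr => l _; rewrite psiE !sp sw sp; ring.
Qed.

End tested_equation.

Section Linfty.
Context {disp} {U : measurableType disp} {R : realType}.
Variable mu : {finite_measure set U -> \bar R}.
Implicit Types f : U -> R.

Lemma Lfuny_meas f : f \in Lfun mu +oo%E -> measurable_fun setT f.
Proof. by rewrite inE => /andP[]; rewrite inE. Qed.

Lemma Lfuny_bounded f : f \in Lfun mu +oo%E ->
  exists C, \forall x \ae mu, `|f x| <= C.
Proof.
move=> Lf; have mf := Lfuny_meas Lf.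
move: Lf; rewrite inE => /andP[_]; rewrite inE /= /finite_norm unlock /=.
case: ifPn => [mu0 Hf|mu0 _].
  have : (0 <= ess_sup mu (abse \o (EFin \o f)))%E by apply: ess_sup_gee => //; apply: aeW => x; rewrite abse_ge0.
  have : \forall x \ae mu, ((abse \o (EFin \o f)) x <= ess_sup mu (abse \o (EFin \o f)))%E by exact: ess_sup_ge.
  move: Hf; case: (ess_sup _ _) => [C _ HC _|//|//].
  by exists C; apply: filterS HC => x; rewrite /= lee_fin.
exists 0; exists setT; split => //.
by apply/eqP; rewrite eq_le measure_ge0 andbT leNgt.
Qed.

Lemma bounded_Lfuny f C : measurable_fun setT f ->
  (\forall x \ae mu, `|f x| <= C) -> f \in Lfun mu +oo%E.
Proof.
move=> mf fC; rewrite inE; apply/andP; split; first by rewrite inE.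
rewrite inE /= /finite_norm unlock /=; case: ifPn => // _.
apply: (@le_lt_trans _ _ C%:E); last exact: ltry.
apply/ess_supP; apply: filterS fC => x; rewrite /= lee_fin.
exact.
Qed.

End Linfty.

Section spacetime_facts.
Context {R : realType} {d : nat}.
Variables (T : R).
Hypothesis T0 : 0 <= T.
Local Notation point := (R * 'rV[R]_d)%type.
Local Notation Q := (spacetime d T).

Lemma leb0_monomial_bounded n : exists C, \forall t \ae leb0 T, `|t ^+ n| <= C.
Proof.
exists (T ^+ n); apply: filterS (leb0_ae_itv T) => t /andP[t0 tT].
by rewrite normrX ger0_norm// lerXn2r ?nnegrE.
Qed.

Lemma spacetime_complete : complete_family Q
  (fun q : nat * ('rV[int]_d * nat) => fun z => z.1 ^+ q.1 * wave q.2.1 q.2.2 z.2).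
Proof.
apply: (@complete_time_product _ _ (torus_measure d) T _ _ (fun n t => t ^+ n)
    (fun q : 'rV[int]_d * nat => wave q.1 q.2)).
- by move=> n; exact: exprn_measurable.
- by move=> q; exact: measurable_wave.
- exact: leb0_monomial_bounded.
- by move=> q; exists 1 => x; exact: wave_le1.
- by move=> g Lg Ig; apply: monomials_total.
- exact: waves_complete.
Qed.

(** The multiplier of the identity matrix is 1 except at k = 0, where the factor k_l brought by a
    derivative hides the difference. *)
Lemma riesz_mx_id (k : 'rV[int]_d) l :
  riesz_mx 1%:M k * (k 0 l)%:~R = (k 0 l)%:~R :> R.
Proof.
have -> : riesz_mx 1%:M k = \sum_i riesz i i k :> R.
  apply: eq_bigr => i _; rewrite (bigD1 i)//= big1 ?addr0 ?mxE ?eqxx ?mul1r// => j ji.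
  by rewrite mxE eq_sym (negbTE ji) mul0r.
have [H|H] := eqVneq (\sum_l (k 0 l)%:~R ^+ 2) (0 : R).
  by rewrite (sum_sqr_eq0 H) mxE mulr0.
by rewrite /riesz -mulr_suml divff ?mul1r.
Qed.

(** For S = I the potential is eta up to a constant, so the two terms in E cancel, and so do the two
    in chi. *)
Lemma flux_id nu (E : point -> 'rV[R]_d) (chi : point -> 'M[R]_d) (k : 'rV[int]_d) m z :
  flux nu 1%:M (wave k m) (fun x => riesz_mx 1%:M k * wave k m x) E chi z = 0.
Proof.
have e (F : 'I_d -> R) i : \sum_j (1%:M : 'M[R]_d) i j * F j = F i.
  rewrite (bigD1 i)//= big1 ?addr0 ?mxE ?eqxx ?mul1r// => j ji.
  by rewrite mxE eq_sym (negbTE ji) mul0r.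
have sk l : spartial l (fun x => riesz_mx 1%:M k * @wave R d k m x) = spartial l (@wave R d k m).
  rewrite spartialZ; last exact: Ck_wave.
  by apply/funext => x; rewrite spartial_wave mulrA [_ * (2 * pi * _)]mulrCA riesz_mx_id.
rewrite /flux.
have -> : \sum_i \sum_j E z 0 i * ((1%:M : 'M[R]_d) i j * spartial j (wave k m) z.2) =
    \sum_l E z 0 l * spartial l (fun x => riesz_mx 1%:M k * wave k m x) z.2.
  by apply: eq_bigr => i _; rewrite -mulr_sumr e sk.
rewrite addNr add0r -mulrBr.
have -> : \sum_l \sum_k0 chi z l k0 * spartial l (spartial k0 (fun x => riesz_mx 1%:M k * wave k m x)) z.2 =
  \sum_i \sum_j \sum_l chi z l i * ((1%:M : 'M[R]_d) i j * spartial l (spartial j (wave k m)) z.2).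
  rewrite exchange_big /=; apply: eq_bigr => i _.
  rewrite exchange_big /=; apply: eq_bigr => l _.
  by rewrite -mulr_sumr (e (fun j => spartial l (spartial j (wave k m)) z.2)) sk.
by rewrite subrr mulr0.
Qed.

Lemma L1_spacetime_test (g : point -> R) n (k : 'rV[int]_d) m : L1 Q g ->
  L1 Q (fun z => z.1 ^+ n * wave k m z.2 * g z).
Proof.
move=> Lg; have [C HC] := leb0_monomial_bounded n.
apply: (@L1_bddM _ _ _ _ _ _ C) => //.
  apply: measurable_funM.
    by apply: (measurableT_comp (@exprn_measurable R setT n)).
  by apply: measurableT_comp => //; exact: measurable_wave.
apply: filterS (ae_time_product_fst (torus_measure d) HC) => z Hz.
by rewrite normrM (le_trans _ Hz)// ler_piMr// wave_le1.
Qed.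

Lemma EB_trace0 nu E (B chi : point -> 'M[R]_d) :
  EB_equation T nu E B chi -> (forall i j, L1 Q (fun z => B z i j)) ->
  \forall z \ae Q, \sum_i B z i i = 0.
Proof.
move=> heq LB.
have LtB : L1 Q (fun z => \sum_i B z i i) by exact: L1_sum.
apply: spacetime_complete => // -[n [k m]] /=.
have s1 : symmetric_mx (1%:M : 'M[R]_d) by rewrite /symmetric_mx trmx1.
have := EB_equation_monomial_wave n k m heq s1.
under [in RHS]eq_Rintegral do rewrite flux_id mulr0.
rewrite Rintg0 => /eqP; rewrite oppr_eq0 => /eqP H.
have : n.+1%:R * \int[Q]_z (z.1 ^+ n * wave k m z.2 * \sum_i B z i i) = 0.
  rewrite -RintgZ; last exact: L1_spacetime_test.
  rewrite -[RHS]H; apply: eq_Rintegral => z _.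
  rewrite !mulr_sumr; apply: eq_bigr => i _.
  rewrite (bigD1 i)//= big1 ?addr0; last first.
    by move=> j ji; rewrite mxE eq_sym (negbTE ji) mul0r !mulr0.
  by rewrite mxE eqxx mulr1n mul1r [RHS]mulrC -!mulrA.
by move=> /eqP; rewrite mulf_eq0 pnatr_eq0 /= => /eqP.
Qed.

End spacetime_facts.

(** * The constraint as a family of linear forms *)

Section smooth_spacetime_theory.
Context {R : realType} {d : nat}.
Local Notation point := (R * 'rV[R]_d)%type.

(** As a directional derivative on the product space, a partial derivative inherits joint smoothness
    through [Ck_derive]. *)
Lemma spartial_uncurry (f : R -> 'rV[R]_d -> R) j (z : point) :
  spartial j (f z.1) z.2 = 'D_((0, delta_mx 0 j) : point) (fun y : point => f y.1 y.2) z.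
Proof.
case: z => t x /=.
have HA (h : R) : (t, h *: delta_mx 0 j + x) = h *: ((0, delta_mx 0 j) : point) + (t, x) :> point.
  by congr (_, _); rewrite /= /GRing.scale/= mulr0 add0r.
by have [e _] := @derive_affine R _ _ (fun x : 'rV[R]_d => (t, x) : point)
  (fun y : point => f y.1 y.2) (delta_mx 0 j) ((0, delta_mx 0 j) : point) x HA; rewrite -e.
Qed.

Lemma tpartial_uncurry (f : R -> 'rV[R]_d -> R) (z : point) :
  tpartial f z.1 z.2 = 'D_((1, 0) : point) (fun y : point => f y.1 y.2) z.
Proof.
rewrite /tpartial derive1E; case: z => t x /=.
have HA (h : R) : (h * 1 + t, x) = h *: ((1, 0) : point) + (t, x) :> point.
  by congr (_, _); rewrite /= scaler0 add0r.
by have [e _] := @derive_affine R R _ (fun s : R => (s, x) : point)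
  (fun y : point => f y.1 y.2) 1 ((1, 0) : point) t HA; rewrite -e.
Qed.

Lemma smooth_spacetime_spartial (f : R -> 'rV[R]_d -> R) j : smooth_spacetime f ->
  smooth_spacetime (fun t => spartial j (f t)).
Proof.
move=> [sf pf]; split=> [k|t]; last exact: spartial_periodic.
under eq_fun do rewrite spartial_uncurry.
exact: Ck_derive (sf k.+1).
Qed.

Lemma smooth_spacetime_tpartial (f : R -> 'rV[R]_d -> R) : smooth_spacetime f ->
  smooth_spacetime (tpartial f).
Proof.
move=> [sf pf]; split=> [k|t x i].
  under eq_fun do rewrite tpartial_uncurry.
  exact: Ck_derive (sf k.+1).
by rewrite /tpartial; under eq_fun do rewrite pf.
Qed.

Lemma L2_smooth_spacetime T (f : R -> 'rV[R]_d -> R) : 0 <= T -> smooth_spacetime f ->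
  L2 (spacetime d T) (fun z => f z.1 z.2).
Proof.
move=> T0 [sf pf].
have cf : continuous (fun z : point => f z.1 z.2) := Ck_cont (sf 0%N).
have [C HC] := continuous_spacetime_bounded T0 cf pf.
apply: (@L2_bounded _ _ _ _ _ C); first exact: continuous_spacetime_measurable.
apply: filterS (ae_time_product_fst (torus_measure d) (leb0_ae_itv T)) => z zT.
exact: HC.
Qed.

Section linear_form.
Variables (T nu : R).
Hypothesis T0 : 0 <= T.
Local Notation Q := (spacetime d T).

Definition pairing (wE : point -> 'rV[R]_d) (wB wchi : point -> 'M[R]_d)
    (E : point -> 'rV[R]_d) (B chi : point -> 'M[R]_d) : R :=
  (\sum_i \int[Q]_z (E z 0 i * wE z 0 i)) +
  (\sum_i \sum_j \int[Q]_z (B z i j * wB z i j)) +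
  (\sum_i \sum_j \int[Q]_z (chi z i j * wchi z i j)).

(** For fixed psi and phi the constraint is the vanishing of one linear form in (E, B, chi) with L^2
    coefficients. Linearity makes it stable under midpoints, and continuity under L^2 limits. *)
Lemma EB_equation_pairing (psi : R -> 'rV[R]_d -> 'M[R]_d) (phi : R -> 'rV[R]_d -> R) :
  (forall i j, smooth_spacetime (fun t x => psi t x i j)) -> smooth_spacetime phi ->
  exists (wE : point -> 'rV[R]_d) (wB wchi : point -> 'M[R]_d), [/\ forall i, L2 Q (fun z => wE z 0 i),
    forall i j, L2 Q (fun z => wB z i j), forall i j, L2 Q (fun z => wchi z i j) &
    forall (E : point -> 'rV[R]_d) (B chi : point -> 'M[R]_d), (forall i, L2 Q (fun z => E z 0 i)) ->
      (forall i j, L2 Q (fun z => B z i j)) -> (forall i j, L2 Q (fun z => chi z i j)) ->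
      (- (\int[Q]_z (\sum_i \sum_j
        B z i j * tpartial (fun t x => psi t x i j) z.1 z.2)) =
      (\int[Q]_z (
      - (\sum_i \sum_j E z 0 i * spartial j (fun x => psi z.1 x i j) z.2)
      + \sum_l E z 0 l * spartial l (phi z.1) z.2
      + 2 * nu * (\sum_l \sum_k
          chi z l k * spartial l (spartial k (phi z.1)) z.2)
      - 2 * nu * (\sum_i \sum_j \sum_l
          chi z l i * spartial l (spartial j (fun x => psi z.1 x i j)) z.2)))
      <-> pairing wE wB wchi E B chi = 0)].
Proof.
move=> spsi sphi.
pose wE (z : point) : 'rV[R]_d := \row_i (spartial i (phi z.1) z.2
  - \sum_j spartial j (fun x => psi z.1 x i j) z.2).
pose wB (z : point) : 'M[R]_d := \matrix_(i, j) tpartial (fun t x => psi t x i j) z.1 z.2.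
pose wchi (z : point) : 'M[R]_d := \matrix_(l, i) (2 * nu * (spartial l (spartial i (phi z.1)) z.2
  - \sum_j spartial l (spartial j (fun x => psi z.1 x i j)) z.2)).
have L2sm (f : R -> 'rV[R]_d -> R) : smooth_spacetime f -> L2 Q (fun z => f z.1 z.2) by exact: L2_smooth_spacetime.
have sp1 (f : R -> 'rV[R]_d -> R) j : smooth_spacetime f -> smooth_spacetime (fun t => spartial j (f t)).
  exact: smooth_spacetime_spartial.
have LwE i : L2 Q (fun z => wE z 0 i).
  under eq_fun do rewrite mxE.
  apply: L2B; first exact: (L2sm _ (sp1 _ _ sphi)).
  by apply: L2_sum => j _; exact: (L2sm _ (sp1 _ j (spsi i j))).
have LwB i j : L2 Q (fun z => wB z i j).
  under eq_fun do rewrite mxE.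
  exact: (L2sm _ (smooth_spacetime_tpartial (spsi i j))).
have Lwchi i j : L2 Q (fun z => wchi z i j).
  under eq_fun do rewrite mxE.
  apply: L2Z; apply: L2B; first exact: (L2sm _ (sp1 _ _ (sp1 _ _ sphi))).
  by apply: L2_sum => l _; exact: (L2sm _ (sp1 _ i (sp1 _ l (spsi j l)))).
exists wE, wB, wchi; split => // E B chi LE LB Lchi.
have -> : \int[Q]_z (\sum_i \sum_j B z i j * tpartial (fun t x => psi t x i j) z.1 z.2) =
    \sum_i \sum_j \int[Q]_z (B z i j * wB z i j).
  rewrite -(eq_bigr _ (fun i _ => Rintg_sum _ (fun j _ => L2_mul (LB i j) (LwB i j)))).
  rewrite -Rintg_sum; last by move=> i _; apply: L1_sum => j _; exact: L2_mul.
  by apply: eq_Rintegral => z _; apply: eq_bigr => i _; apply: eq_bigr => j _; rewrite mxE.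
set I0 := Rintegral _ _ _.
have -> : I0 = (\sum_i \int[Q]_z (E z 0 i * wE z 0 i)) +
    (\sum_i \sum_j \int[Q]_z (chi z i j * wchi z i j)).
  rewrite -(Rintg_sum _ (fun i _ => L2_mul (LE i) (LwE i))).
  rewrite -(eq_bigr _ (fun i _ => Rintg_sum _ (fun j _ => L2_mul (Lchi i j) (Lwchi i j)))).
  rewrite -Rintg_sum; last by move=> i _; apply: L1_sum => j _; exact: L2_mul.
  rewrite -RintgD; last first.
  - by apply: L1_sum => i _; apply: L1_sum => j _; exact: L2_mul.
  - by apply: L1_sum => i _; exact: L2_mul.
  apply: eq_Rintegral => z _.
  rewrite -addrA; congr (_ + _).
    rewrite addrC -sumrB; apply: eq_bigr => i _.
    by rewrite mxE mulrBr mulr_sumr.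
  have alg (c : R) (a p : 'I_d -> 'I_d -> R) (y : 'I_d -> 'I_d -> 'I_d -> R) :
      c * (\sum_l \sum_k a l k * p l k) - c * (\sum_i \sum_j \sum_l a l i * y l i j) =
      \sum_l \sum_i a l i * (c * (p l i - \sum_j y l i j)).
    rewrite -mulrBr.
    have -> : \sum_i \sum_j \sum_l a l i * y l i j = \sum_l \sum_i \sum_j a l i * y l i j.
      transitivity (\sum_i \sum_l \sum_j a l i * y l i j); last exact: exchange_big.
      by apply: eq_bigr => i _; exact: exchange_big.
    rewrite -sumrB mulr_sumr; apply: eq_bigr => l _.
    rewrite -sumrB mulr_sumr; apply: eq_bigr => i _.
    by rewrite -mulr_sumr -mulrBr mulrCA.
  rewrite (alg (2 * nu) (fun l k => chi z l k) (fun l k => spartial l (spartial k (phi z.1)) z.2)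
    (fun l i j => spartial l (spartial j (fun x => psi z.1 x i j)) z.2)).
  by apply: eq_bigr => l _; apply: eq_bigr => i _; rewrite mxE.
rewrite /pairing; split => [H|H].
  by rewrite addrAC -H addrC addrN.
by apply/eqP; rewrite eq_sym -addr_eq0 addrAC H.
Qed.

Lemma pairing_midpoint (wE : point -> 'rV[R]_d) (wB wchi : point -> 'M[R]_d)
    (E : point -> 'rV[R]_d) (B chi : point -> 'M[R]_d)
    (E' : point -> 'rV[R]_d) (B' chi' : point -> 'M[R]_d) :
  (forall i, L2 Q (fun z => wE z 0 i)) -> (forall i j, L2 Q (fun z => wB z i j)) ->
  (forall i j, L2 Q (fun z => wchi z i j)) ->
  (forall i, L2 Q (fun z => E z 0 i)) -> (forall i j, L2 Q (fun z => B z i j)) ->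
  (forall i j, L2 Q (fun z => chi z i j)) ->
  (forall i, L2 Q (fun z => E' z 0 i)) -> (forall i j, L2 Q (fun z => B' z i j)) ->
  (forall i j, L2 Q (fun z => chi' z i j)) ->
  pairing wE wB wchi (fun z => 2^-1 *: (E z + E' z)) (fun z => 2^-1 *: (B z + B' z))
    (fun z => 2^-1 *: (chi z + chi' z)) =
  2^-1 * (pairing wE wB wchi E B chi + pairing wE wB wchi E' B' chi').
Proof.
move=> LwE LwB Lwc LE LB Lc LE' LB' Lc'.
have key (f f' w : point -> R) : L2 Q f -> L2 Q f' -> L2 Q w ->
    \int[Q]_z (2^-1 * (f z + f' z) * w z) =
    2^-1 * (\int[Q]_z (f z * w z) + \int[Q]_z (f' z * w z)).
  move=> Lf Lf' Lw; rewrite -RintgD; [|exact: L2_mul|exact: L2_mul].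
  rewrite -RintgZ; last by apply: L1D; exact: L2_mul.
  by apply: eq_Rintegral => z _; ring.
rewrite /pairing.
have -> : \sum_i \int[Q]_z ((2^-1 *: (E z + E' z)) 0 i * wE z 0 i) =
    2^-1 * (\sum_i \int[Q]_z (E z 0 i * wE z 0 i) + \sum_i \int[Q]_z (E' z 0 i * wE z 0 i)).
  rewrite -big_split mulr_sumr; apply: eq_bigr => i _.
  by rewrite -key//; apply: eq_Rintegral => z _; rewrite !mxE.
have mx2 (A A' w : point -> 'M[R]_d) : (forall i j, L2 Q (fun z => A z i j)) ->
    (forall i j, L2 Q (fun z => A' z i j)) -> (forall i j, L2 Q (fun z => w z i j)) ->
    \sum_i \sum_j \int[Q]_z ((2^-1 *: (A z + A' z)) i j * w z i j) =
    2^-1 * (\sum_i \sum_j \int[Q]_z (A z i j * w z i j) +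
            \sum_i \sum_j \int[Q]_z (A' z i j * w z i j)).
  move=> LA LA' Lw; rewrite -big_split mulr_sumr; apply: eq_bigr => i _.
  rewrite -big_split mulr_sumr; apply: eq_bigr => j _.
  by rewrite -key//; apply: eq_Rintegral => z _; rewrite !mxE.
by rewrite (mx2 B B' wB LB LB' LwB) (mx2 chi chi' wchi Lc Lc' Lwc) [RHS]mulrDr; ring.
Qed.

End linear_form.
End smooth_spacetime_theory.

(** * The Lagrangian *)

Section lagrangian_theory.
Context {R : realType} {d : nat}.
Variables (T nu aV aW : R).
Hypotheses (T0 : 0 <= T) (haV : 0 < aV) (haW : 0 < aW).
Local Notation point := (R * 'rV[R]_d)%type.
Local Notation Q := (spacetime d T).
Variables (V0 : 'rV[R]_d -> 'rV[R]_d) (gradV0 : 'rV[R]_d -> 'M[R]_d).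
Hypotheses (LV0 : forall i, L2 (torus_measure d) (fun x => V0 x 0 i))
  (LG : forall i j, L2 (torus_measure d) (fun x => gradV0 x i j)).
Variables (Vbar : point -> 'rV[R]_d) (Wbar : point -> 'M[R]_d).
Hypotheses (LVb : forall i, L2 Q (fun z => Vbar z 0 i))
  (LWb : forall i j, L2 Q (fun z => Wbar z i j)).

Lemma L2_comp_snd (f : 'rV[R]_d -> R) : L2 (torus_measure d) f ->
  L2 Q (fun z => f z.2).
Proof.
move=> [mf Lf]; have mf2 : measurable_fun setT (fun z : point => f z.2).
  exact: measurableT_comp.
split => //; apply/(integrable12ltyP (leb0 T) (torus_measure d)).
  by apply/measurable_EFinP; exact: measurable_funX.
have -> : (fun x : R => (\int[torus_measure d]_y `|((EFin \o (fun z : point => (f z.2 ^+ 2)%R)) (x, y))|)%E) =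
    cst (\int[torus_measure d]_y (f y ^+ 2))%R%:E.
  apply/funext => t /=; rewrite EFin_Rintg//; apply: eq_integral => x _.
  by rewrite ger0_norm ?sqr_ge0.
rewrite integral_cst//= lte_mul_pinfty// ?lee_fin ?Rintg_ge0 ?ltry//.
- by move=> x; exact: sqr_ge0.
- by rewrite -ge0_fin_numE//; exact: fin_num_measure.
Qed.

Let LV02 i : L2 Q (fun z => V0 z.2 0 i). Proof. exact: (L2_comp_snd (LV0 i)). Qed.
Let LG2 i j : L2 Q (fun z => gradV0 z.2 i j). Proof. exact: (L2_comp_snd (LG i j)). Qed.

(** The Lagrangian is affine in (E, B, chi): this is its linear part, and [control_cost] collects
    what does not involve the triple. *)
Definition dual_density (E : point -> 'rV[R]_d) (B chi : point -> 'M[R]_d)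
    (V : point -> 'rV[R]_d) (W : point -> 'M[R]_d) (z : point) : R :=
  (\sum_i E z 0 i * (V z 0 i - V0 z.2 0 i)) +
  (\sum_i \sum_j B z i j * (V z 0 i * V z 0 j - W z i j)) +
  (\sum_i \sum_j chi z i j * (W z i j - 2 * nu * gradV0 z.2 j i)).

Definition control_cost (V : point -> 'rV[R]_d) (W : point -> 'M[R]_d) (z : point) : R :=
  aV / 2 * (\sum_i (V z 0 i ^+ 2 + Vbar z 0 i * (Vbar z 0 i - 2 * V z 0 i))) +
  aW / 2 * (\sum_i \sum_j (W z i j ^+ 2 + Wbar z i j ^+ 2 - 2 * (Wbar z i j * W z i j))).

(** The integrability part of [EBPsi], separated from symmetry and from the constraint, with one
    bound for all entries of B. *)
Definition admissible (E : point -> 'rV[R]_d) (B chi : point -> 'M[R]_d) :=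
  [/\ forall i, L2 Q (fun z => E z 0 i),
      forall i j, measurable_fun setT (fun z => B z i j),
      exists C, forall i j, \forall z \ae Q, `|B z i j| <= C &
      forall i j, L2 Q (fun z => chi z i j)].

Lemma L1_dual_density (E : point -> 'rV[R]_d) (B chi : point -> 'M[R]_d)
    (V : point -> 'rV[R]_d) (W : point -> 'M[R]_d) : admissible E B chi ->
  (forall i, L2 Q (fun z => V z 0 i)) -> (forall i j, L2 Q (fun z => W z i j)) ->
  L1 Q (dual_density E B chi V W).
Proof.
move=> [LE mB [C HC] Lc] LV LW.
apply: L1D; first apply: L1D.
- by apply: L1_sum => i _; apply: L2_mul => //; exact: L2B.
- apply: L1_sum => i _; apply: L1_sum => j _.
  apply: (L1_bddM (mB i j) (HC i j)); apply: L1B; [exact: L2_mul|exact: L2_L1].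
- apply: L1_sum => i _; apply: L1_sum => j _; apply: L2_mul => //.
  by apply: L2B => //; exact: L2Z.
Qed.

Lemma L1_control_cost (V : point -> 'rV[R]_d) (W : point -> 'M[R]_d) :
  (forall i, L2 Q (fun z => V z 0 i)) -> (forall i j, L2 Q (fun z => W z i j)) ->
  L1 Q (control_cost V W).
Proof.
move=> LV LW; apply: L1D; apply: L1Z; apply: L1_sum => i _.
  apply: L1D; first exact: (LV i).2.
  by apply: L2_mul => //; apply: L2B => //; exact: L2Z.
apply: L1_sum => j _; apply: L1B; first by apply: L1D; [exact: (LW i j).2|exact: (LWb i j).2].
by apply: L1Z; exact: L2_mul.
Qed.

Lemma lagrangianE (E : point -> 'rV[R]_d) (B chi : point -> 'M[R]_d)
    (V : point -> 'rV[R]_d) (W : point -> 'M[R]_d) : admissible E B chi ->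
  (forall i, L2 Q (fun z => V z 0 i)) -> (forall i j, L2 Q (fun z => W z i j)) ->
  lagrangian T nu aV aW Vbar Wbar V0 gradV0 E B chi V W =
  \int[Q]_z (dual_density E B chi V W z) + \int[Q]_z (control_cost V W z).
Proof.
move=> adm LV LW; have [LE mB [C HC] Lc] := adm.
have Ld := L1_dual_density adm LV LW; have Lcc := L1_control_cost LV LW.
have LVE : L1 Q (fun z => \sum_i V z 0 i * E z 0 i) by apply: L1_sum => i _; exact: L2_mul.
have LVVB : L1 Q (fun z => \sum_i \sum_j V z 0 i * V z 0 j * (2 * B z i j + aV * (i == j)%:R)).
  apply: L1_sum => i _; apply: L1_sum => j _.
  have H : L1 Q (fun z => B z i j * (2 * (V z 0 i * V z 0 j)) + aV * (i == j)%:R * (V z 0 i * V z 0 j)).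
    by apply: L1D; [apply: (L1_bddM (mB i j) (HC i j)); apply: L1Z|apply: L1Z]; exact: L2_mul.
  apply: L1_ae H _; last by apply: aeW => z; ring.
  apply: measurable_funM; first by apply: measurable_funM; exact: L2_meas.
  by apply: measurable_funD => //; exact: measurable_funM.
have LVb2 : L1 Q (fun z => \sum_i Vbar z 0 i * (Vbar z 0 i - 2 * V z 0 i)).
  by apply: L1_sum => i _; apply: L2_mul => //; apply: L2B => //; exact: L2Z.
have LWW : L1 Q (fun z => \sum_i \sum_j W z i j * W z i j).
  by apply: L1_sum => i _; apply: L1_sum => j _; exact: L2_mul.
have LWB : L1 Q (fun z => \sum_i \sum_j W z i j * (B z i j - chi z i j)).
  apply: L1_sum => i _; apply: L1_sum => j _; apply: L2_mul => //; apply: L2B => //.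
  exact: (L2_bounded (mB i j) (HC i j)).
have LWb2 : L1 Q (fun z => \sum_i \sum_j Wbar z i j * Wbar z i j).
  by apply: L1_sum => i _; apply: L1_sum => j _; exact: L2_mul.
have LWbW : L1 Q (fun z => \sum_i \sum_j Wbar z i j * W z i j).
  by apply: L1_sum => i _; apply: L1_sum => j _; exact: L2_mul.
have LV0E : L1 Q (fun z => \sum_i V0 z.2 0 i * E z 0 i).
  by apply: L1_sum => i _; exact: L2_mul.
have LGc : L1 Q (fun z => \sum_l \sum_i gradV0 z.2 l i * chi z i l).
  by apply: L1_sum => i _; apply: L1_sum => j _; exact: L2_mul.
rewrite /lagrangian.
rewrite -[RHS]RintgD//.
set f1 := (X in \int[_]_z X z + _ - _).
set f2 := (X in _ + \int[_]_z X z - _).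
set f3 := (X in _ - \int[_]_z X z).
have L1f1 : L1 Q f1 by apply: L1D; [apply: L1D => //; exact: L1Z|exact: L1Z].
have L1f2 : L1 Q f2.
  by apply: L1B; [apply: L1D; [apply: L1B => //; exact: L1Z|exact: L1Z]|exact: L1Z].
have L1f3 : L1 Q f3 by apply: L1D => //; exact: L1Z.
rewrite -RintgD// -RintgB//; last exact: L1D.
apply: eq_Rintegral => z _; rewrite /f1 /f2 /f3 /dual_density /control_cost.
have e1 : \sum_i E z 0 i * (V z 0 i - V0 z.2 0 i) =
    \sum_i V z 0 i * E z 0 i - \sum_i V0 z.2 0 i * E z 0 i.
  by rewrite -sumrB; apply: eq_bigr => i _; ring.
have e2 : \sum_i \sum_j V z 0 i * V z 0 j * (2 * B z i j + aV * (i == j)%:R) =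
    2 * (\sum_i \sum_j B z i j * (V z 0 i * V z 0 j)) + aV * \sum_i V z 0 i ^+ 2.
  rewrite !mulr_sumr -big_split; apply: eq_bigr => i _ /=.
  have -> : aV * V z 0 i ^+ 2 = \sum_j aV * (i == j)%:R * (V z 0 i * V z 0 j).
    rewrite (bigD1 i)//= big1 ?addr0 ?eqxx; first by rewrite mulr1 expr2.
    by move=> j ji; rewrite eq_sym (negbTE ji) mulr0 mul0r.
  by rewrite mulr_sumr -big_split; apply: eq_bigr => j _ /=; ring.
have e3 : \sum_i \sum_j B z i j * (V z 0 i * V z 0 j - W z i j) =
    \sum_i \sum_j B z i j * (V z 0 i * V z 0 j) - \sum_i \sum_j B z i j * W z i j.
  by rewrite -sumrB; apply: eq_bigr => i _; rewrite -sumrB; apply: eq_bigr => j _; ring.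
have e4 : \sum_i \sum_j W z i j * (B z i j - chi z i j) =
    \sum_i \sum_j B z i j * W z i j - \sum_i \sum_j chi z i j * W z i j.
  by rewrite -sumrB; apply: eq_bigr => i _; rewrite -sumrB; apply: eq_bigr => j _; ring.
have e5 : \sum_i \sum_j chi z i j * (W z i j - 2 * nu * gradV0 z.2 j i) =
    \sum_i \sum_j chi z i j * W z i j - 2 * nu * \sum_l \sum_i gradV0 z.2 l i * chi z i l.
  rewrite [in X in _ = _ - _ * X]exchange_big mulr_sumr -sumrB; apply: eq_bigr => i _ /=.
  by rewrite mulr_sumr -sumrB; apply: eq_bigr => j _; ring.
have e6 : \sum_i (V z 0 i ^+ 2 + Vbar z 0 i * (Vbar z 0 i - 2 * V z 0 i)) =
  \sum_i V z 0 i ^+ 2 + \sum_i Vbar z 0 i * (Vbar z 0 i - 2 * V z 0 i) by rewrite big_split.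
have e7 : \sum_i \sum_j (W z i j ^+ 2 + Wbar z i j ^+ 2 - 2 * (Wbar z i j * W z i j)) =
   \sum_i \sum_j W z i j * W z i j + \sum_i \sum_j Wbar z i j * Wbar z i j
   - 2 * \sum_i \sum_j Wbar z i j * W z i j.
  rewrite mulr_sumr -big_split -sumrB; apply: eq_bigr => i _ /=.
  by rewrite mulr_sumr -big_split -sumrB; apply: eq_bigr => j _ /=; ring.
by rewrite e1 e2 e3 e4 e5 e6 e7; field.
Qed.

(** The infimum may be -oo; expressing it through its real lower bounds c keeps the later arguments
    within the reals. *)
Lemma dual_functional_geP (E : point -> 'rV[R]_d) (B chi : point -> 'M[R]_d) (c : R) :
  (c%:E <= dual_functional T nu aV aW Vbar Wbar V0 gradV0 E B chi)%E <->
  forall (V : point -> 'rV[R]_d) (W : point -> 'M[R]_d),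
    (forall i, L2 Q (fun z => V z 0 i)) -> (forall i j, L2 Q (fun z => W z i j)) ->
    c <= lagrangian T nu aV aW Vbar Wbar V0 gradV0 E B chi V W.
Proof.
split=> [H V W LV LW|H].
  rewrite -lee_fin (le_trans H)//; apply: ereal_inf_lbound; exists V, W; split => //.
  - by move=> i; apply: L2_Lfun2.
  - by move=> i j; apply: L2_Lfun2.
apply: le_ereal_inf_tmp => _ [V [W [LV LW ->]]].
rewrite lee_fin; apply: H => [i|i j]; apply: Lfun2_L2; [exact: LV|exact: LW].
Qed.

End lagrangian_theory.

Lemma quadratic_leading_ge0 (R : realFieldType) (a b c H : R) :
  (forall r, c <= b + r * a + r ^+ 2 * H) -> 0 <= H.
Proof.
move=> Hr; rewrite leNgt; apply/negP => H0.
have cb : c <= b by have := Hr 0; rewrite expr0n /= mul0r !addr0 mul0r addr0.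
(* Adding the bounds at r and -r removes the linear term and leaves c - b <= r^2 H. This r is at
   least 1 and satisfies r H = c - b + H, which is too small when H < 0. *)
pose r := 1 + (b - c) / (- H).
have r1 : 1 <= r by rewrite /r lerDl divr_ge0 ?subr_ge0// oppr_ge0 ltW.
have rH : r * H = H - (b - c) by rewrite /r; field; lra.
have r2 : r ^+ 2 * H <= r * H by rewrite ler_nM2r// expr2 ler_peMl//; lra.
have := Hr r; have := Hr (- r); rewrite sqrrN mulNr; lra.
Qed.

(** * A priori bounds from finiteness of the infimum *)

Section bounds.
Context {R : realType} {d : nat}.
Variables (T nu aV aW : R).
Hypotheses (T0 : 0 <= T) (haV : 0 < aV) (haW : 0 < aW).
Local Notation point := (R * 'rV[R]_d)%type.
Local Notation Q := (spacetime d T).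
Variables (V0 : 'rV[R]_d -> 'rV[R]_d) (gradV0 : 'rV[R]_d -> 'M[R]_d).
Hypotheses (LV0 : forall i, L2 (torus_measure d) (fun x => V0 x 0 i))
  (LG : forall i j, L2 (torus_measure d) (fun x => gradV0 x i j)).
Variables (Vbar : point -> 'rV[R]_d) (Wbar : point -> 'M[R]_d).
Hypotheses (LVb : forall i, L2 Q (fun z => Vbar z 0 i))
  (LWb : forall i j, L2 Q (fun z => Wbar z i j)).
Local Notation dual := (dual_functional T nu aV aW Vbar Wbar V0 gradV0).
Local Notation density := (dual_density nu V0 gradV0).
Local Notation cost := (control_cost aV aW Vbar Wbar).

Let LV02 i : L2 Q (fun z => V0 z.2 0 i). Proof. exact: (L2_comp_snd _ (LV0 i)). Qed.
Let LG2 i j : L2 Q (fun z => gradV0 z.2 i j). Proof. exact: (L2_comp_snd _ (LG i j)). Qed.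

(* Testing with V = r 1_A xi and letting r tend to infinity. *)
Lemma dual_finite_quadratic (E : point -> 'rV[R]_d) (B chi : point -> 'M[R]_d) (c : R)
    (xi : 'I_d -> R) : admissible T E B chi -> (c%:E <= dual E B chi)%E ->
  \forall z \ae Q, 0 <= \sum_i \sum_j B z i j * (xi i * xi j) + aV / 2 * \sum_i xi i ^+ 2.
Proof.
move=> adm Hc; have [LE mB [C HC] Lc] := adm.
set h := fun z : point => \sum_i \sum_j B z i j * (xi i * xi j) + aV / 2 * \sum_i xi i ^+ 2.
have Lh : L1 Q h.
  apply: L1D; last exact: L1_cst.
  apply: L1_sum => i _; apply: L1_sum => j _.
  exact: (L1_bddM (mB i j) (HC i j) (L1_cst _ _)).
(* The set where the claim fails. Its indicator is idempotent, so h 1_A is the coefficient of r^2 in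
   the integrand, and a nonnegative integral forces h 1_A to vanish almost everywhere. *)
pose A := [set z | h z < 0].
have mA : measurable A.
  have -> : A = setT `&` h @^-1` `]-oo, 0[%classic.
    by rewrite setTI; apply/seteqP; split => z /=; rewrite in_itv.
  by apply: (L1_meas Lh) => //; exact: measurable_itv.
pose a z := \1_A z : R.
have ma : measurable_fun setT a by exact: measurable_indic.
have a01 z : `|a z| <= 1 by rewrite /a indicE; case: (z \in A); rewrite ?normr1 ?normr0.
have aa z : a z * a z = a z by rewrite /a indicE; case: (z \in A); rewrite ?mulr1 ?mulr0.
have La f : L1 Q f -> L1 Q (fun z => a z * f z).
  by move=> Lf; apply: (L1_bddM ma (aeW _ a01) Lf).
have La2 : L2 Q a by exact: (L2_bounded ma (aeW _ a01)).
pose V r (z : point) : 'rV[R]_d := \row_i (r * xi i * a z).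
pose W (z : point) : 'M[R]_d := 0.
have LV r i : L2 Q (fun z => V r z 0 i).
  by under eq_fun do rewrite mxE; exact: L2Z.
have LW i j : L2 Q (fun z => W z i j).
  by under eq_fun do rewrite mxE; exact: L2_cst.
pose f1 z := \sum_i (xi i * E z 0 i) - aV * \sum_i (xi i * Vbar z 0 i).
pose f0 z := - (\sum_i E z 0 i * V0 z.2 0 i)
  - 2 * nu * (\sum_i \sum_j chi z i j * gradV0 z.2 j i)
  + aV / 2 * (\sum_i Vbar z 0 i ^+ 2) + aW / 2 * (\sum_i \sum_j Wbar z i j ^+ 2).
have Lf1 : L1 Q f1.
  apply: L1B; last apply: L1Z.
    by apply: L1_sum => i _; apply: L1Z; exact: L2_L1.
  by apply: L1_sum => i _; apply: L1Z; exact: L2_L1.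
have Lf0 : L1 Q f0.
  apply: L1D; first apply: L1D; first apply: L1B.
  - by apply: L1N; apply: L1_sum => i _; exact: L2_mul.
  - by apply: L1Z; apply: L1_sum => i _; apply: L1_sum => j _; exact: L2_mul.
  - by apply: L1Z; apply: L1_sum => i _; exact: (LVb i).2.
  - by apply: L1Z; apply: L1_sum => i _; apply: L1_sum => j _; exact: (LWb i j).2.
have FE r z : density E B chi (V r) W z + cost (V r) W z =
    f0 z + r * (a z * f1 z) + r ^+ 2 * (a z * h z).
  rewrite /dual_density /control_cost /f0 /f1 /h.
  have -> : \sum_i E z 0 i * (V r z 0 i - V0 z.2 0 i) =
      r * a z * (\sum_i xi i * E z 0 i) - \sum_i E z 0 i * V0 z.2 0 i.
    by rewrite mulr_sumr -sumrB; apply: eq_bigr => i _; rewrite mxE; ring.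
  have -> : \sum_i \sum_j B z i j * (V r z 0 i * V r z 0 j - W z i j) =
      r ^+ 2 * a z * (\sum_i \sum_j B z i j * (xi i * xi j)).
    rewrite mulr_sumr; apply: eq_bigr => i _; rewrite mulr_sumr; apply: eq_bigr => j _.
    by rewrite !mxE -[in RHS](aa z); ring.
  have -> : \sum_i \sum_j chi z i j * (W z i j - 2 * nu * gradV0 z.2 j i) =
      - (2 * nu * (\sum_i \sum_j chi z i j * gradV0 z.2 j i)).
    rewrite mulr_sumr -sumrN; apply: eq_bigr => i _; rewrite mulr_sumr -sumrN; apply: eq_bigr => j _.
    by rewrite !mxE; ring.
  have -> : \sum_i (V r z 0 i ^+ 2 + Vbar z 0 i * (Vbar z 0 i - 2 * V r z 0 i)) =
      r ^+ 2 * a z * (\sum_i xi i ^+ 2) + \sum_i Vbar z 0 i ^+ 2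
      - 2 * (r * a z) * (\sum_i xi i * Vbar z 0 i).
    rewrite !mulr_sumr -big_split -sumrB; apply: eq_bigr => i _ /=.
    have e : (r * xi i * a z) ^+ 2 = r ^+ 2 * a z * xi i ^+ 2 by rewrite -[in RHS](aa z); ring.
    by rewrite !mxE e; ring.
  have -> : \sum_i \sum_j (W z i j ^+ 2 + Wbar z i j ^+ 2 - 2 * (Wbar z i j * W z i j)) =
      \sum_i \sum_j Wbar z i j ^+ 2.
    by apply: eq_bigr => i _; apply: eq_bigr => j _; rewrite !mxE; ring.
  by field.
have IH : 0 <= \int[Q]_z (a z * h z).
  apply: (@quadratic_leading_ge0 _ (\int[Q]_z (a z * f1 z)) (\int[Q]_z f0 z) c) => r.
  have := (dual_functional_geP _ _ _ _ _ _ _ _ _ _ _ _).1 Hc (V r) W (LV r) LW.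
  rewrite (lagrangianE nu aV aW LV0 LG LVb LWb adm (LV r) LW) -RintgD; last 2 first.
  - exact: (L1_dual_density nu LV0 LG adm (LV r) LW).
  - exact: (L1_control_cost aV aW LVb LWb (LV r) LW).
  under eq_Rintegral do rewrite FE.
  rewrite RintgD; last 2 first.
  - by apply: L1D => //; apply: L1Z; exact: La.
  - by apply: L1Z; exact: La.
  by rewrite RintgD//; [rewrite !RintgZ//; exact: La|apply: L1Z; exact: La].
have ah z : a z * h z <= 0.
  by rewrite /a indicE; have [/[!inE]/ltW|_] := boolP (z \in A); rewrite ?mul1r ?mul0r.
have : \forall z \ae Q, - (a z * h z) = 0.
  apply: Rintg_eq0.
  - by apply: L1N; exact: La.
  - by move=> z; rewrite oppr_ge0.
  - rewrite RintgN; last exact: La.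
    apply/eqP; rewrite oppr_eq0 eq_le IH andbT -oppr_ge0 -RintgN; last exact: La.
    by apply: Rintg_ge0 => z; rewrite oppr_ge0.
apply: filterS => z /eqP; rewrite oppr_eq0 /a indicE -/(h z).
by rewrite leNgt; have [/[!inE] Az|/negP zA _] := boolP (z \in A); [rewrite mul1r (lt_eqF Az)|apply/negP; rewrite inE in zA].
Qed.

(** The directions e_i give B_ii >= - a_V / 2; with zero trace each diagonal entry is then at most d
    a_V, the others being bounded below. The directions e_i + e_j and e_i - e_j bound 2 |B_ij| by
    B_ii + B_jj + a_V when i and j differ. *)
Lemma dual_finite_bound (E : point -> 'rV[R]_d) (B chi : point -> 'M[R]_d) (c : R) :
  admissible T E B chi -> (c%:E <= dual E B chi)%E ->
  (forall z, symmetric_mx (B z)) -> (\forall z \ae Q, \sum_i B z i i = 0) ->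
  forall i j, \forall z \ae Q, `|B z i j| <= (d%:R + 1) * aV.
Proof.
move=> adm Hc symB tr0 i0 j0.
have ds (F : 'I_d -> R) i : \sum_a (i == a)%:R * F a = F i.
  rewrite (bigD1 i)//= big1 ?addr0 ?eqxx ?mul1r// => j ji.
  by rewrite eq_sym (negbTE ji) mul0r.
have qE (z : point) (s : R) (i j : 'I_d) : \sum_a \sum_b B z a b * (((i == a)%:R + s * (j == a)%:R) * ((i == b)%:R + s * (j == b)%:R)) =
    B z i i + s * (B z i j + B z j i) + s ^+ 2 * B z j j.
  have inner a : \sum_b B z a b * (((i == a)%:R + s * (j == a)%:R) * ((i == b)%:R + s * (j == b)%:R)) =
      (i == a)%:R * (B z a i + s * B z a j) + (j == a)%:R * (s * (B z a i + s * B z a j)).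
    transitivity (((i == a)%:R + s * (j == a)%:R) *
        (\sum_b (i == b)%:R * B z a b + s * \sum_b (j == b)%:R * B z a b)).
      by rewrite mulr_sumr -big_split mulr_sumr; apply: eq_bigr => b _ /=; ring.
    by rewrite (ds (B z a) i) (ds (B z a) j); ring.
  by rewrite (eq_bigr _ (fun a _ => inner a)) big_split /= (ds (fun a => B z a i + s * B z a j) i)
    (ds (fun a => s * (B z a i + s * B z a j)) j); ring.
have nE (s : R) (i j : 'I_d) : \sum_a ((i == a)%:R + s * (j == a)%:R) ^+ 2 = 1 + s ^+ 2 + 2 * s * (i == j)%:R :> R.
  transitivity (\sum_a (i == a)%:R * ((i == a)%:R + 2 * s * (j == a)%:R) +
      \sum_a (j == a)%:R * (s ^+ 2 * (j == a)%:R)).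
    by rewrite -big_split; apply: eq_bigr => a _ /=; ring.
  rewrite (ds (fun a => (i == a)%:R + 2 * s * (j == a)%:R)) (ds (fun a => s ^+ 2 * (j == a)%:R)).
  by rewrite !eqxx (eq_sym j i) /=; ring.
have Hq (s : R) (i j : 'I_d) := dual_finite_quadratic (fun a => (i == a)%:R + s * (j == a)%:R) adm Hc.
have d1 : \forall z \ae Q, forall i, - (aV / 2) <= B z i i.
  apply: filter_forall => i; have := Hq 0 i i; apply: filterS => z.
  by rewrite qE nE; lra.
have aV0 := haV.
have aV2 : - aV <= - (aV / 2) by lra.
have dub : \forall z \ae Q, forall i, B z i i <= d%:R * aV.
  apply: filterS2 d1 tr0 => z z1 z0 i.
  have : B z i i + \sum_(j | j != i) B z j j = 0 by have := z0; rewrite (bigD1 i).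
  have : \sum_(j | j != i) - (aV / 2) <= \sum_(j | j != i) B z j j by apply: ler_sum.
  have : - (d%:R * aV) <= \sum_(j | j != i) - (aV / 2).
    have -> : - (d%:R * aV) = \sum_(j < d) - aV by rewrite sumr_const card_ord mulr_natl mulNrn.
    rewrite (bigD1 i)//= -[leRHS]add0r lerD ?oppr_le0 ?(ltW haV)//.
    by apply: ler_sum => j _; exact: aV2.
  by lra.
have := Hq 1 i0 j0; have := Hq (-1) i0 j0.
move=> H1 H2; apply: filterS3 (filterI d1 dub) H1 H2 => z [z1 z2].
rewrite !qE !nE.
have -> : B z j0 i0 = B z i0 j0 by rewrite -[in LHS](symB z) mxE.
have := z1 i0; have := z1 j0; have := z2 i0; have := z2 j0.
have dn : 0 <= d%:R * aV by rewrite mulr_ge0// ltW.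
have [->|ij] := eqVneq i0 j0.
  by move=> ? ? ? ? _ _; rewrite ler_norml; apply/andP; split; lra.
by rewrite mulr0 ?mulr0 => ? ? ? ? ? ?; rewrite ler_norml; apply/andP; split; lra.
Qed.

(* Testing with V = V0 - eps E and W = 2 nu (grad V0)^T - eps chi cancels the
   terms that are linear in (E, chi). *)
Lemma dual_coercive (Cb : R) : 0 <= Cb -> exists kappa K : R, 0 < kappa /\
  forall (E : point -> 'rV[R]_d) (B chi : point -> 'M[R]_d) (c : R),
  admissible T E B chi -> (c%:E <= dual E B chi)%E ->
  (forall i j, \forall z \ae Q, `|B z i j| <= Cb) ->
  kappa * (\sum_i \int[Q]_z E z 0 i ^+ 2 + \sum_i \sum_j \int[Q]_z chi z i j ^+ 2) <= K - c.
Proof.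
move=> Cb0; have [haV' haW'] := (haV, haW).
(* [alpha] and [beta] bound the coefficients of V_i^2 and W_ij^2 once the B-term and the cost are
   estimated; [eps] makes their products with it at most 1/4. *)
pose alpha := aV + Cb * d%:R; pose beta := Cb / 2 + aW.
have dn : 0 <= Cb * d%:R by rewrite mulr_ge0.
have al0 : 0 < alpha by rewrite /alpha; lra.
have be0 : 0 < beta by rewrite /beta; lra.
pose eps := (4 * (alpha + beta))^-1.
have eps0 : 0 < eps by rewrite invr_gt0; lra.
have epsE : eps * (4 * (alpha + beta)) = 1 by rewrite mulVf//; lra.
have ale : alpha * eps <= 1 / 4 by nra.
have bee : beta * eps <= 1 / 4 by nra.
pose k1 i z := 2 * alpha * V0 z.2 0 i ^+ 2 + aV * Vbar z 0 i ^+ 2.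
pose k2 i j z := 2 * beta * (2 * nu * gradV0 z.2 j i) ^+ 2 + Cb / 2 + aW * Wbar z i j ^+ 2.
have Lk1 i : L1 Q (k1 i) by apply: L1D; apply: L1Z; [exact: (LV02 i).2|exact: (LVb i).2].
have Lk2 i j : L1 Q (k2 i j).
  apply: L1D; last by apply: L1Z; exact: (LWb i j).2.
  by apply: L1D; [apply: L1Z; exact: (L2Z (2 * nu) (LG2 j i)).2|exact: L1_cst].
exists (eps / 2), (\int[Q]_z (\sum_i k1 i z + \sum_i \sum_j k2 i j z)); split.
  by rewrite divr_gt0.
move=> E B chi c adm Hc HB; have [LE mB _ Lc] := adm.
pose V z : 'rV[R]_d := \row_i (V0 z.2 0 i - eps * E z 0 i).
pose W z : 'M[R]_d := \matrix_(i, j) (2 * nu * gradV0 z.2 j i - eps * chi z i j).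
have LV i : L2 Q (fun z => V z 0 i).
  by under eq_fun do rewrite mxE; apply: L2B => //; exact: L2Z.
have LW i j : L2 Q (fun z => W z i j).
  by under eq_fun do rewrite mxE; apply: L2B; exact: L2Z.
have := (dual_functional_geP _ _ _ _ _ _ _ _ _ _ _ _).1 Hc V W LV LW.
rewrite (lagrangianE nu aV aW LV0 LG LVb LWb adm LV LW) -RintgD; last 2 first.
- exact: (L1_dual_density nu LV0 LG adm LV LW).
- exact: (L1_control_cost aV aW LVb LWb LV LW).
move=> H.
have LEs i : L1 Q (fun z => E z 0 i ^+ 2) by exact: (LE i).2.
have Lcs i j : L1 Q (fun z => chi z i j ^+ 2) by exact: (Lc i j).2.
have LK : L1 Q (fun z => \sum_i k1 i z + \sum_i \sum_j k2 i j z).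
  by apply: L1D; apply: L1_sum => i _ //; apply: L1_sum.
have LN : L1 Q (fun z => \sum_i E z 0 i ^+ 2 + \sum_i \sum_j chi z i j ^+ 2).
  by apply: L1D; apply: L1_sum => i _ //; apply: L1_sum.
have NE : \sum_i \int[Q]_z E z 0 i ^+ 2 + \sum_i \sum_j \int[Q]_z chi z i j ^+ 2 =
    \int[Q]_z (\sum_i E z 0 i ^+ 2 + \sum_i \sum_j chi z i j ^+ 2).
  rewrite RintgD; [|by apply: L1_sum|by apply: L1_sum => i _; apply: L1_sum].
  rewrite Rintg_sum//; congr (_ + _).
  rewrite Rintg_sum; last by move=> i _; apply: L1_sum.
  by apply: eq_bigr => i _; rewrite Rintg_sum.
rewrite NE lerBrDr -lerBrDl -RintgZ// -RintgB//; last exact: L1Z.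
apply: (le_trans H).
apply: ae_le_Rintg.
- by apply: L1D; [exact: (L1_dual_density nu LV0 LG adm LV LW)|exact: (L1_control_cost aV aW LVb LWb LV LW)].
- by apply: L1B => //; exact: L1Z.
have HB' : \forall z \ae Q, forall i j, `|B z i j| <= Cb.
  by apply: filter_forall => i; apply: filter_forall => j; exact: HB.
apply: filterS HB' => z Bz; rewrite /dual_density /control_cost.
(* From |V_i V_j| <= (V_i^2 + V_j^2) / 2 and |W_ij| <= (1 + W_ij^2) / 2; the factor d counts the
   indices j. *)
have b1 : \sum_i \sum_j B z i j * (V z 0 i * V z 0 j - W z i j) <=
    \sum_i Cb * d%:R * V z 0 i ^+ 2 + \sum_i \sum_j Cb / 2 * (1 + W z i j ^+ 2).
  have -> : \sum_i Cb * d%:R * V z 0 i ^+ 2 = \sum_i \sum_j Cb / 2 * (V z 0 i ^+ 2 + V z 0 j ^+ 2).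
    transitivity (\sum_i \sum_(j < d) Cb / 2 * V z 0 i ^+ 2 + \sum_(i < d) \sum_j Cb / 2 * V z 0 j ^+ 2).
      rewrite [X in _ = _ + X]exchange_big /= -big_split; apply: eq_bigr => i _ /=.
      by rewrite !sumr_const card_ord -mulr_natr; field.
    rewrite -big_split; apply: eq_bigr => i _ /=; rewrite -big_split; apply: eq_bigr => j _ /=.
    by rewrite mulrDr.
  rewrite -big_split; apply: ler_sum => i _; rewrite -big_split; apply: ler_sum => j _ /=.
  have := Bz i j; rewrite ler_norml => /andP[].
  set v := V z 0 i; set w := V z 0 j; set x := W z i j; set b := B z i j => B1 B2.
  have C1 : 0 <= Cb - b by rewrite subr_ge0.
  have C2 : 0 <= Cb + b by lra.
  have := mulr_ge0 C1 (sqr_ge0 (v + w)); have := mulr_ge0 C2 (sqr_ge0 (v - w)).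
  have := mulr_ge0 C1 (sqr_ge0 (1 - x)); have := mulr_ge0 C2 (sqr_ge0 (1 + x)).
  by lra.
(* The substitution of V and W yields -eps e^2 from the linear terms. The quadratic terms give back
   at most half of it, because 2 al eps^2 e^2 <= (eps / 2) e^2. *)
have shrink (al v0 e : R) : 0 < al -> al * eps <= 1 / 4 ->
    al * (v0 - eps * e) ^+ 2 <= 2 * al * v0 ^+ 2 + eps / 2 * e ^+ 2.
  move=> al_gt0 ale'; have h1 : 0 <= al * (v0 + eps * e) ^+ 2 by rewrite mulr_ge0 ?sqr_ge0// ltW.
  have h2 : 0 <= (1 / 4 - al * eps) * (eps * e ^+ 2).
    by rewrite mulr_ge0 ?subr_ge0// mulr_ge0 ?sqr_ge0// ltW.
  by lra.
have young (a x y : R) : 0 < a -> a / 2 * (x ^+ 2 + y ^+ 2 - 2 * (y * x)) <= a * x ^+ 2 + a * y ^+ 2.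
  by move=> a0; have : 0 <= a * (x + y) ^+ 2; [rewrite mulr_ge0 ?sqr_ge0// ltW|lra].
have g1 : \sum_i E z 0 i * (V z 0 i - V0 z.2 0 i) + \sum_i Cb * d%:R * V z 0 i ^+ 2 +
    aV / 2 * (\sum_i (V z 0 i ^+ 2 + Vbar z 0 i * (Vbar z 0 i - 2 * V z 0 i))) <=
    \sum_i k1 i z - eps / 2 * \sum_i E z 0 i ^+ 2.
  rewrite !mulr_sumr -!big_split -sumrB; apply: ler_sum => i _ /=.
  have := shrink alpha (V0 z.2 0 i) (E z 0 i) al0 ale.
  have := young aV (V z 0 i) (Vbar z 0 i) haV'.
  rewrite /V mxE /k1 /alpha; set v0 := V0 _ _ _; set e := E _ _ _; set vb := Vbar _ _ _.
  by lra.
have g2 : \sum_i \sum_j Cb / 2 * (1 + W z i j ^+ 2) +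
    \sum_i \sum_j chi z i j * (W z i j - 2 * nu * gradV0 z.2 j i) +
    aW / 2 * (\sum_i \sum_j (W z i j ^+ 2 + Wbar z i j ^+ 2 - 2 * (Wbar z i j * W z i j))) <=
    \sum_i \sum_j k2 i j z - eps / 2 * \sum_i \sum_j chi z i j ^+ 2.
  rewrite !mulr_sumr -!big_split -sumrB; apply: ler_sum => i _ /=.
  rewrite !mulr_sumr -!big_split -sumrB; apply: ler_sum => j _ /=.
  have := shrink beta (2 * nu * gradV0 z.2 j i) (chi z i j) be0 bee.
  have := young aW (W z i j) (Wbar z i j) haW'.
  rewrite /W mxE /k2 /beta; set g := 2 * nu * _; set x := chi _ _ _; set wb := Wbar _ _ _.
  by lra.
by lra.
Qed.

End bounds.

(** * Existence of a maximiser *)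

Section convergence_lemmas.
Context {disp} {U : measurableType disp} {R : realType}.
Variable mu : {finite_measure set U -> \bar R}.

Lemma cvg_Rintg_mul (u : nat -> U -> R) (v w : U -> R) :
  (forall n, L2 mu (u n)) -> L2 mu v -> L2 mu w ->
  (forall n, \int[mu]_x (u n x - v x) ^+ 2 <= (2 ^- n) ^+ 2) ->
  \int[mu]_x (u n x * w x) @[n --> \oo] --> \int[mu]_x (v x * w x).
Proof.
move=> Lu Lv Lw Huv.
pose c := Num.sqrt (\int[mu]_x w x ^+ 2).
have H n : `|\int[mu]_x (u n x * w x) - \int[mu]_x (v x * w x)| <= 2^-1 ^+ n * c.
  rewrite -RintgB; [|exact: L2_mul|exact: L2_mul].
  have -> : \int[mu]_x (u n x * w x - v x * w x) = \int[mu]_x ((u n x - v x) * w x).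
    by apply: eq_Rintegral => x _; ring.
  have := cauchy_schwarz (L2B (Lu n) Lv) Lw.
  have w0 : 0 <= \int[mu]_x w x ^+ 2 by apply: Rintg_ge0 => x; exact: sqr_ge0.
  move=> /le_trans /(_ (ler_wpM2r w0 (Huv n))).
  rewrite -(sqr_sqrtr w0) -/c -exprMn -exprVn -[X in X <= _ -> _]real_normK ?num_real//.
  by rewrite ler_pXn2r ?nnegrE// mulr_ge0 ?exprn_ge0 ?invr_ge0// sqrtr_ge0.
have cz : 2^-1 ^+ n * c @[n --> \oo] --> (0 : R).
  rewrite -[X in _ --> X](mul0r c); apply: cvgMl; apply: cvg_expr.
  by rewrite ger0_norm ?invr_ge0// invf_lt1// ltr1n.
apply/cvgrPdist_le => /= e e0.
have : \forall n \near \oo, 2^-1 ^+ n * c <= e by exact: (cvgr_le _ cz).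
by apply: filterS => n; apply: le_trans; rewrite distrC.
Qed.

(** Meant for the entries of B, whose cofactor V_i V_j - W_ij is only integrable, so that L^2
    convergence of B would not suffice. *)
Lemma cvg_Rintg_bounded_mul (u : nat -> U -> R) (v w : U -> R) (C : R) :
  (forall n, measurable_fun setT (u n)) -> measurable_fun setT v -> L1 mu w ->
  (forall n, \forall x \ae mu, `|u n x| <= C) ->
  (\forall x \ae mu, u n x @[n --> \oo] --> v x) ->
  \int[mu]_x (u n x * w x) @[n --> \oo] --> \int[mu]_x (v x * w x).
Proof.
move=> mu_ mv Lw uC uv; have mw := L1_meas Lw.
apply: (@dominated_cvg_Rintg _ _ _ _ (fun n x => u n x * w x) _ (fun x => C * `|w x|)).
- by move=> n; exact: measurable_funM.
- exact: measurable_funM.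
- by apply: L1Z; exact: L1_norm.
- by apply: filterS uv => x ux; apply: cvgMl.
- have := ae_foralln uC; apply: filterS => x ux n.
  by rewrite normrM ler_wpM2r.
Qed.

Lemma ae_lim_bounded (u : nat -> U -> R) (v : U -> R) (C : R) :
  (forall n, \forall x \ae mu, `|u n x| <= C) ->
  (\forall x \ae mu, u n x @[n --> \oo] --> v x) ->
  \forall x \ae mu, `|v x| <= C.
Proof.
move=> uC uv; apply: filterS2 (ae_foralln uC) uv => x ux cx.
apply: (ler_cvg_to (cvg_norm cx) (cvg_cst C)).
exact: nearW.
Qed.

End convergence_lemmas.

Lemma cvg_sum_seq (R : realType) (I : Type) (s : seq I) (F : I -> nat -> R) (l : I -> R) :
  (forall i, F i n @[n --> \oo] --> l i) ->
  \sum_(i <- s) F i n @[n --> \oo] --> \sum_(i <- s) l i.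
Proof.
move=> H; elim: s => [|i s IHs].
  by rewrite big_nil; under eq_fun do rewrite big_nil; exact: cvg_cst.
by rewrite big_cons; under eq_fun do rewrite big_cons; exact: cvgD.
Qed.

Section admissible_controls.
Context {R : realType} {d : nat}.
Variables (T nu aV aW : R).
Hypotheses (T0 : 0 <= T) (haV : 0 < aV) (haW : 0 < aW).
Local Notation point := (R * 'rV[R]_d)%type.
Local Notation Q := (spacetime d T).
Variables (V0 : 'rV[R]_d -> 'rV[R]_d) (gradV0 : 'rV[R]_d -> 'M[R]_d).
Hypotheses (LV0 : forall i, L2 (torus_measure d) (fun x => V0 x 0 i))
  (LG : forall i j, L2 (torus_measure d) (fun x => gradV0 x i j)).
Variables (Vbar : point -> 'rV[R]_d) (Wbar : point -> 'M[R]_d).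
Hypotheses (LVb : forall i, L2 Q (fun z => Vbar z 0 i))
  (LWb : forall i j, L2 Q (fun z => Wbar z i j)).
Local Notation dual := (dual_functional T nu aV aW Vbar Wbar V0 gradV0).
Local Notation density := (dual_density nu V0 gradV0).
Local Notation cost := (control_cost aV aW Vbar Wbar).
Local Notation dual_geP := (dual_functional_geP T nu aV aW V0 gradV0 Vbar Wbar).

Lemma EBPsi_admissible (E : point -> 'rV[R]_d) (B chi : point -> 'M[R]_d) :
  EBPsi T nu E B chi -> admissible T E B chi.
Proof.
case=> LE LB Lc _ _; split.
- by move=> i; exact: Lfun2_L2 (LE i).
- by move=> i j; exact: Lfuny_meas (LB i j).
- have [C HC] := choice (fun p : 'I_d * 'I_d => Lfuny_bounded (LB p.1 p.2)).
  exists (\sum_p `|C p|) => i j; apply: filterS (HC (i, j)) => z /= Cz.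
  rewrite (bigD1 (i, j))//= (le_trans Cz)// (le_trans (ler_norm _))// lerDl.
  by apply: sumr_ge0.
- by move=> i j; exact: Lfun2_L2 (Lc i j).
Qed.

Lemma admissible_L2B (E : point -> 'rV[R]_d) (B chi : point -> 'M[R]_d) :
  admissible T E B chi -> forall i j, L2 Q (fun z => B z i j).
Proof. by case=> _ mB [C HC] _ i j; exact: L2_bounded (mB i j) (HC i j). Qed.

(** The bound involves neither c nor the norms of E and chi, hence it is uniform over all almost
    maximisers. *)
Lemma EBPsi_bound (E : point -> 'rV[R]_d) (B chi : point -> 'M[R]_d) (c : R) :
  EBPsi T nu E B chi -> (c%:E <= dual E B chi)%E ->
  forall i j, \forall z \ae Q, `|B z i j| <= (d%:R + 1) * aV.
Proof.
move=> EB Hc; have adm := EBPsi_admissible EB; have [_ _ _ [symB _] heq] := EB.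
apply: (dual_finite_bound haV LV0 LG LVb LWb adm Hc symB).
by apply: (EB_trace0 T0 heq) => i j; apply: L2_L1; exact: (admissible_L2B adm).
Qed.

Lemma symmetric_mx_midpoint (A B : 'M[R]_d) :
  symmetric_mx A -> symmetric_mx B -> symmetric_mx (2^-1 *: (A + B)).
Proof. by rewrite /symmetric_mx linearZ linearD /= => -> ->. Qed.

Lemma EBPsi_midpoint (E E' : point -> 'rV[R]_d) (B B' chi chi' : point -> 'M[R]_d) :
  EBPsi T nu E B chi -> EBPsi T nu E' B' chi' ->
  EBPsi T nu (fun z => 2^-1 *: (E z + E' z)) (fun z => 2^-1 *: (B z + B' z))
    (fun z => 2^-1 *: (chi z + chi' z)).
Proof.
move=> EB EB'; have [adm adm'] := (EBPsi_admissible EB, EBPsi_admissible EB').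
have [LB LB'] := (admissible_L2B adm, admissible_L2B adm').
have [_ _ _ [sB sc] heq] := EB; have [_ _ _ [sB' sc'] heq'] := EB'.
have [LE mB [C HC] Lc] := adm; have [LE' mB' [C' HC'] Lc'] := adm'.
have LEm i : L2 Q (fun z => (2^-1 *: (E z + E' z)) 0 i).
  by under eq_fun do rewrite !mxE; apply: L2Z; exact: L2D.
have Lcm i j : L2 Q (fun z => (2^-1 *: (chi z + chi' z)) i j).
  by under eq_fun do rewrite !mxE; apply: L2Z; exact: L2D.
have LBm i j : L2 Q (fun z => (2^-1 *: (B z + B' z)) i j).
  by under eq_fun do rewrite !mxE; apply: L2Z; exact: L2D.
split.
- by move=> i; exact: L2_Lfun2.
- move=> i j; apply: (@bounded_Lfuny _ _ _ _ _ (2^-1 * (C + C'))); first exact: (LBm i j).1.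
  apply: filterS2 (HC i j) (HC' i j) => z h h'.
  by rewrite !mxE normrM ger0_norm ?invr_ge0// ler_pM2l ?invr_gt0// (le_trans (ler_normD _ _))// lerD.
- by move=> i j; exact: L2_Lfun2.
- by split => z; exact: symmetric_mx_midpoint.
move=> psi phi s1 s2 s3 s4 s5.
have [wE [wB [wc [LwE LwB Lwc H]]]] := EB_equation_pairing nu T0 s1 s4.
apply/H => //; rewrite pairing_midpoint//.
have -> : pairing T wE wB wc E B chi = 0 by apply/H => //; exact: heq.
have -> : pairing T wE wB wc E' B' chi' = 0 by apply/H => //; exact: heq'.
by rewrite addr0 mulr0.
Qed.

(** An infimum of functionals that are affine in the triple is concave. *)
Lemma dual_midpoint (E E' : point -> 'rV[R]_d) (B B' chi chi' : point -> 'M[R]_d) (c : R) :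
  admissible T E B chi -> admissible T E' B' chi' ->
  admissible T (fun z => 2^-1 *: (E z + E' z)) (fun z => 2^-1 *: (B z + B' z))
    (fun z => 2^-1 *: (chi z + chi' z)) ->
  (c%:E <= dual E B chi)%E -> (c%:E <= dual E' B' chi')%E ->
  (c%:E <= dual (fun z => 2^-1 *: (E z + E' z))%R (fun z => 2^-1 *: (B z + B' z))%R
    (fun z => 2^-1 *: (chi z + chi' z))%R)%E.
Proof.
move=> adm adm' admm Hc Hc'; apply/dual_geP => V W LV LW.
have := (dual_geP _ _ _ _).1 Hc V W LV LW.
have := (dual_geP _ _ _ _).1 Hc' V W LV LW.
rewrite (lagrangianE nu aV aW LV0 LG LVb LWb adm LV LW).
rewrite (lagrangianE nu aV aW LV0 LG LVb LWb adm' LV LW).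
rewrite (lagrangianE nu aV aW LV0 LG LVb LWb admm LV LW).
have Ld := L1_dual_density nu LV0 LG adm LV LW.
have Ld' := L1_dual_density nu LV0 LG adm' LV LW.
under [X in _ -> _ -> _ <= X + _]eq_Rintegral => z _.
  have -> : density (fun z => 2^-1 *: (E z + E' z)) (fun z => 2^-1 *: (B z + B' z))
    (fun z => 2^-1 *: (chi z + chi' z)) V W z = 2^-1 * (density E B chi V W z + density E' B' chi' V W z).
    rewrite /dual_density.
    have m1 (x y : 'rV[R]_d) (F : 'I_d -> R) : \sum_i (2^-1 *: (x + y)) 0 i * F i =
        2^-1 * (\sum_i x 0 i * F i + \sum_i y 0 i * F i).
      by rewrite -big_split mulr_sumr; apply: eq_bigr => i _; rewrite !mxE /=; ring.
    have m2 (x y : 'M[R]_d) (F : 'I_d -> 'I_d -> R) : \sum_i \sum_j (2^-1 *: (x + y)) i j * F i j =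
        2^-1 * (\sum_i \sum_j x i j * F i j + \sum_i \sum_j y i j * F i j).
      rewrite -big_split mulr_sumr; apply: eq_bigr => i _ /=.
      by rewrite -big_split mulr_sumr; apply: eq_bigr => j _; rewrite !mxE /=; ring.
    by rewrite m1 !m2; ring.
  over.
rewrite RintgZ; last exact: L1D.
rewrite RintgD//; lra.
Qed.

Lemma EBPsi_zero : EBPsi T nu (fun _ : point => 0) (fun=> 0) (fun=> 0).
Proof.
split.
- by move=> i; apply: L2_Lfun2; under eq_fun do rewrite mxE; exact: L2_cst.
- move=> i j; apply: (@bounded_Lfuny _ _ _ _ _ 0); first by under eq_fun do rewrite mxE; exact: measurable_cst.
  by apply: aeW => z; rewrite mxE normr0.
- by move=> i j; apply: L2_Lfun2; under eq_fun do rewrite mxE; exact: L2_cst.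
- by split => z; rewrite /symmetric_mx trmx0.
move=> psi phi _ _ _ _ _.
have z1 (F : 'I_d -> R) : \sum_(i < d) (0 : 'rV[R]_d) 0 i * F i = 0.
  by apply: big1 => i _; rewrite mxE mul0r.
have z2 (F : 'I_d -> 'I_d -> R) : \sum_(i < d) \sum_(j < d) (0 : 'M[R]_d) i j * F i j = 0.
  by apply: big1 => i _; apply: big1 => j _; rewrite mxE mul0r.
rewrite (_ : (fun z : point => _) = cst 0); last by apply/funext => z; rewrite z2.
rewrite [in RHS](_ : (fun z : point => _) = cst 0); first by rewrite Rintg_cst mul0r oppr0.
apply/funext => z; rewrite z1 z2.
rewrite [X in - X + _]big1; last by move=> i _; apply: big1 => j _; rewrite mxE mul0r.
rewrite [X in _ - 2 * nu * X]big1; first by rewrite /= !mulr0 !addr0 !subr0 oppr0.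
by move=> i _; apply: big1 => j _; apply: big1 => l _; rewrite mxE mul0r.
Qed.

(** Only the cost remains, and completing squares shows it to be (a_V / 2) |V - Vbar|^2 + (a_W / 2)
    |W - Wbar|^2. This bounds the supremum from below. *)
Lemma dual_zero : (0%:E <= dual (fun=> 0%R) (fun=> 0%R) (fun=> 0%R))%E.
Proof.
apply/dual_geP => V W LV LW.
rewrite (lagrangianE nu aV aW LV0 LG LVb LWb (EBPsi_admissible EBPsi_zero) LV LW).
apply: addr_ge0; apply: Rintg_ge0 => z.
  have z1 (F : 'I_d -> R) : \sum_(i < d) (0 : 'rV[R]_d) 0 i * F i = 0.
    by apply: big1 => i _; rewrite mxE mul0r.
  have z2 (F : 'I_d -> 'I_d -> R) : \sum_(i < d) \sum_(j < d) (0 : 'M[R]_d) i j * F i j = 0.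
    by apply: big1 => i _; apply: big1 => j _; rewrite mxE mul0r.
  by rewrite /dual_density z1 !z2 !addr0.
rewrite /control_cost; apply: addr_ge0; rewrite mulr_ge0 ?divr_ge0 ?(ltW haV) ?(ltW haW)//.
  apply: sumr_ge0 => i _.
  have -> : V z 0 i ^+ 2 + Vbar z 0 i * (Vbar z 0 i - 2 * V z 0 i) = (V z 0 i - Vbar z 0 i) ^+ 2 by ring.
  exact: sqr_ge0.
apply: sumr_ge0 => i _; apply: sumr_ge0 => j _.
have -> : W z i j ^+ 2 + Wbar z i j ^+ 2 - 2 * (Wbar z i j * W z i j) = (W z i j - Wbar z i j) ^+ 2 by ring.
exact: sqr_ge0.
Qed.

End admissible_controls.

(** * Passage to the limit in the constraint and the functional *)

Section limits.
Context {R : realType} {d : nat}.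
Variables (T nu aV aW : R).
Hypotheses (T0 : 0 <= T) (haV : 0 < aV) (haW : 0 < aW).
Local Notation point := (R * 'rV[R]_d)%type.
Local Notation Q := (spacetime d T).
Variables (V0 : 'rV[R]_d -> 'rV[R]_d) (gradV0 : 'rV[R]_d -> 'M[R]_d).
Hypotheses (LV0 : forall i, L2 (torus_measure d) (fun x => V0 x 0 i))
  (LG : forall i j, L2 (torus_measure d) (fun x => gradV0 x i j)).
Variables (Vbar : point -> 'rV[R]_d) (Wbar : point -> 'M[R]_d).
Hypotheses (LVb : forall i, L2 Q (fun z => Vbar z 0 i))
  (LWb : forall i j, L2 Q (fun z => Wbar z i j)).
Local Notation dual := (dual_functional T nu aV aW Vbar Wbar V0 gradV0).
Local Notation density := (dual_density nu V0 gradV0).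
Local Notation cost := (control_cost aV aW Vbar Wbar).
Local Notation dual_geP := (dual_functional_geP T nu aV aW V0 gradV0 Vbar Wbar).

Lemma EBPsi_limit (E_ : nat -> point -> 'rV[R]_d) (B_ chi_ : nat -> point -> 'M[R]_d)
    (E : point -> 'rV[R]_d) (B chi : point -> 'M[R]_d) (Cb : R) :
  (forall n, EBPsi T nu (E_ n) (B_ n) (chi_ n)) ->
  (forall i, L2 Q (fun z => E z 0 i)) -> (forall i j, L2 Q (fun z => B z i j)) ->
  (forall i j, L2 Q (fun z => chi z i j)) ->
  (forall n i, \int[Q]_z (E_ n z 0 i - E z 0 i) ^+ 2 <= (2 ^- n) ^+ 2) ->
  (forall n i j, \int[Q]_z (B_ n z i j - B z i j) ^+ 2 <= (2 ^- n) ^+ 2) ->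
  (forall n i j, \int[Q]_z (chi_ n z i j - chi z i j) ^+ 2 <= (2 ^- n) ^+ 2) ->
  (forall i j, \forall z \ae Q, `|B z i j| <= Cb) ->
  (forall z, symmetric_mx (B z)) -> (forall z, symmetric_mx (chi z)) ->
  EBPsi T nu E B chi.
Proof.
move=> EB LE LB Lc dE dB dc bB sB sc.
have adm n := EBPsi_admissible (EB n).
have LE_ n i : L2 Q (fun z => E_ n z 0 i) by have [] := adm n.
have LB_ n i j : L2 Q (fun z => B_ n z i j) by exact: admissible_L2B (adm n) i j.
have Lc_ n i j : L2 Q (fun z => chi_ n z i j) by have [] := adm n.
split.
- by move=> i; exact: L2_Lfun2.
- by move=> i j; exact: bounded_Lfuny (LB i j).1 (bB i j).
- by move=> i j; exact: L2_Lfun2.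
- by [].
move=> psi phi s1 s2 s3 s4 s5.
have [wE [wB [wc [LwE LwB Lwc H]]]] := EB_equation_pairing nu T0 s1 s4.
apply/H => //.
have pn n : pairing T wE wB wc (E_ n) (B_ n) (chi_ n) = 0.
  by apply/H => //; have [_ _ _ _] := EB n; apply.
have : pairing T wE wB wc (E_ n) (B_ n) (chi_ n) @[n --> \oo] --> pairing T wE wB wc E B chi.
  apply: cvgD; first apply: cvgD.
  - by apply: cvg_sum_seq => i; exact: (@cvg_Rintg_mul _ _ _ Q (fun n z => E_ n z 0 i)).
  - apply: cvg_sum_seq => i; apply: cvg_sum_seq => j.
    exact: (@cvg_Rintg_mul _ _ _ Q (fun n z => B_ n z i j)).
  - apply: cvg_sum_seq => i; apply: cvg_sum_seq => j.
    exact: (@cvg_Rintg_mul _ _ _ Q (fun n z => chi_ n z i j)).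
under eq_fun do rewrite pn.
by move=> h; rewrite -(cvg_lim (@Rhausdorff R) h) lim_cst.
Qed.

Lemma integral_dual_density (E : point -> 'rV[R]_d) (B chi : point -> 'M[R]_d)
    (V : point -> 'rV[R]_d) (W : point -> 'M[R]_d) : admissible T E B chi ->
  (forall i, L2 Q (fun z => V z 0 i)) -> (forall i j, L2 Q (fun z => W z i j)) ->
  \int[Q]_z density E B chi V W z =
  \sum_i \int[Q]_z (E z 0 i * (V z 0 i - V0 z.2 0 i)) +
  \sum_i \sum_j \int[Q]_z (B z i j * (V z 0 i * V z 0 j - W z i j)) +
  \sum_i \sum_j \int[Q]_z (chi z i j * (W z i j - 2 * nu * gradV0 z.2 j i)).
Proof.
move=> [LE mB [C HC] Lc] LV LW.
have LV02 i := L2_comp_snd T (LV0 i).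
have LG2 i j := L2_comp_snd T (LG i j).
have h1 i : L1 Q (fun z => E z 0 i * (V z 0 i - V0 z.2 0 i)).
  by apply: L2_mul => //; exact: L2B.
have h2 i j : L1 Q (fun z => B z i j * (V z 0 i * V z 0 j - W z i j)).
  by apply: (L1_bddM (mB i j) (HC i j)); apply: L1B; [exact: L2_mul|exact: L2_L1].
have h3 i j : L1 Q (fun z => chi z i j * (W z i j - 2 * nu * gradV0 z.2 j i)).
  by apply: L2_mul => //; apply: L2B => //; exact: L2Z.
rewrite /dual_density RintgD; last 2 first.
- by apply: L1D; apply: L1_sum => i _ //; exact: L1_sum.
- by apply: L1_sum => i _; exact: L1_sum.
rewrite RintgD; last 2 first.
- exact: L1_sum.
- by apply: L1_sum => i _; exact: L1_sum.
congr (_ + _ + _); first by rewrite Rintg_sum.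
- rewrite Rintg_sum; last by move=> i _; exact: L1_sum.
  by apply: eq_bigr => i _; rewrite Rintg_sum.
- rewrite Rintg_sum; last by move=> i _; exact: L1_sum.
  by apply: eq_bigr => i _; rewrite Rintg_sum.
Qed.

(** Upper semicontinuity: for each fixed (V, W) the Lagrangian converges along the sequence, and the
    infimum over (V, W) is taken afterwards. *)
Lemma dual_limit (E_ : nat -> point -> 'rV[R]_d) (B_ chi_ : nat -> point -> 'M[R]_d)
    (E : point -> 'rV[R]_d) (B chi : point -> 'M[R]_d) (Cb : R) (c_ : nat -> R) (c : R) :
  (forall n, admissible T (E_ n) (B_ n) (chi_ n)) -> admissible T E B chi ->
  (forall n i, \int[Q]_z (E_ n z 0 i - E z 0 i) ^+ 2 <= (2 ^- n) ^+ 2) ->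
  (forall n i j, \int[Q]_z (chi_ n z i j - chi z i j) ^+ 2 <= (2 ^- n) ^+ 2) ->
  (forall n i j, \forall z \ae Q, `|B_ n z i j| <= Cb) ->
  (forall i j, \forall z \ae Q, B_ n z i j @[n --> \oo] --> B z i j) ->
  (forall n, ((c_ n)%:E <= dual (E_ n) (B_ n) (chi_ n))%E) -> c_ n @[n --> \oo] --> c ->
  (c%:E <= dual E B chi)%E.
Proof.
move=> adm_ adm dE dc bB cB Hc cc; apply/dual_geP => V W LV LW.
have LV02 i := L2_comp_snd T (LV0 i).
have LG2 i j := L2_comp_snd T (LG i j).
rewrite (lagrangianE nu aV aW LV0 LG LVb LWb adm LV LW) integral_dual_density//.
have H n : c_ n <= \sum_i \int[Q]_z (E_ n z 0 i * (V z 0 i - V0 z.2 0 i)) +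
  \sum_i \sum_j \int[Q]_z (B_ n z i j * (V z 0 i * V z 0 j - W z i j)) +
  \sum_i \sum_j \int[Q]_z (chi_ n z i j * (W z i j - 2 * nu * gradV0 z.2 j i)) + \int[Q]_z cost V W z.
  have := (dual_geP _ _ _ _).1 (Hc n) V W LV LW.
  by rewrite (lagrangianE nu aV aW LV0 LG LVb LWb (adm_ n) LV LW) integral_dual_density.
have [LE mB _ Lc] := adm.
apply: (ler_cvg_to cc _ (nearW _ H)).
apply: cvgD; last exact: cvg_cst.
apply: cvgD; first apply: cvgD.
- apply: cvg_sum_seq => i; apply: (@cvg_Rintg_mul _ _ _ Q (fun n z => E_ n z 0 i)) => //.
  + by move=> n; have [] := adm_ n.
  + exact: L2B.
- apply: cvg_sum_seq => i; apply: cvg_sum_seq => j.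
  apply: (@cvg_Rintg_bounded_mul _ _ _ Q (fun n z => B_ n z i j) _ _ Cb) => //.
  + by move=> n; have [] := adm_ n.
  + by apply: L1B; [exact: L2_mul|exact: L2_L1].
- apply: cvg_sum_seq => i; apply: cvg_sum_seq => j.
  apply: (@cvg_Rintg_mul _ _ _ Q (fun n z => chi_ n z i j)) => //.
  + by move=> n; have [] := adm_ n.
  + by apply: L2B => //; exact: L2Z.
Qed.

(** Coercivity bounds every lower bound c of the functional by K, as the norms on its left side are
    nonnegative; the zero triple gives the bound from below. *)
Lemma J_NS_fin : J_NS T nu aV aW Vbar Wbar V0 gradV0 \is a fin_num.
Proof.
have Cb0 : 0 <= (d%:R + 1) * aV by rewrite mulr_ge0 ?addr_ge0// ltW.
have [kappa [K [k0 HK]]] := dual_coercive nu haV haW LV0 LG LVb LWb Cb0.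
have ub : (J_NS T nu aV aW Vbar Wbar V0 gradV0 <= K%:E)%E.
  apply: ge_ereal_sup => _ [E [B [chi [EB ->]]]].
  have bnd c : (c%:E <= dual E B chi)%E -> c <= K.
    move=> Hc; have := HK _ _ _ _ (EBPsi_admissible EB) Hc (EBPsi_bound T0 haV LV0 LG LVb LWb EB Hc).
    set N := (X in kappa * X) => h; rewrite -subr_ge0; apply: le_trans h.
    rewrite mulr_ge0 ?(ltW k0)// addr_ge0//; apply: sumr_ge0 => i _; first by apply: Rintg_ge0 => z; exact: sqr_ge0.
    by apply: sumr_ge0 => j _; apply: Rintg_ge0 => z; exact: sqr_ge0.
  (* The value +oo would have K + 1 among its lower bounds, and -oo lies below K trivially. *)
  case: (dual E B chi) bnd => [r|/(_ (K + 1))|_]; last 2 first.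
  - by rewrite leey => /(_ isT); rewrite leNgt ltrDl// ltr01.
  - by rewrite leNye.
  by move=> /(_ r (lexx _)); rewrite lee_fin.
have lb : (0%:E <= J_NS T nu aV aW Vbar Wbar V0 gradV0)%E.
  apply: le_trans (ereal_sup_ubound _); first exact: (dual_zero nu haV haW LV0 LG LVb LWb).
  by exists (fun=> 0), (fun=> 0), (fun=> 0); split => //; exact: EBPsi_zero.
by rewrite fin_numElt (lt_le_trans (ltNyr 0) lb) (le_lt_trans ub (ltry K)).
Qed.

End limits.

Section controls.
Context {R : realType} {d : nat}.
Local Notation point := (R * 'rV[R]_d)%type.

(* A triple (E, B, chi) as a finite family of scalar functions. *)
Definition triple_index := ('I_d + ('I_d * 'I_d + 'I_d * 'I_d))%type.

Implicit Types u : triple_index -> point -> R.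

Definition triple_E u (z : point) : 'rV[R]_d := \row_i u (inl i) z.
Definition triple_B u (z : point) : 'M[R]_d := \matrix_(i, j) u (inr (inl (i, j))) z.
Definition triple_chi u (z : point) : 'M[R]_d := \matrix_(i, j) u (inr (inr (i, j))) z.

Definition triple (E : point -> 'rV[R]_d) (B chi : point -> 'M[R]_d) : triple_index -> point -> R :=
  fun a z => match a with
  | inl i => E z 0 i
  | inr (inl p) => B z p.1 p.2
  | inr (inr p) => chi z p.1 p.2
  end.

Lemma triple_EE E B chi : triple_E (triple E B chi) = E.
Proof. by apply/funext => z; apply/rowP => i; rewrite mxE. Qed.

Lemma triple_BE E B chi : triple_B (triple E B chi) = B.
Proof. by apply/funext => z; apply/matrixP => i j; rewrite mxE. Qed.

Lemma triple_chiE E B chi : triple_chi (triple E B chi) = chi.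
Proof. by apply/funext => z; apply/matrixP => i j; rewrite mxE. Qed.

Lemma triple_E_midpoint u v :
  triple_E (midpoint u v) = fun z => 2^-1 *: (triple_E u z + triple_E v z).
Proof. by apply/funext => z; apply/rowP => i; rewrite !mxE. Qed.

Lemma triple_B_midpoint u v :
  triple_B (midpoint u v) = fun z => 2^-1 *: (triple_B u z + triple_B v z).
Proof. by apply/funext => z; apply/matrixP => i j; rewrite !mxE. Qed.

Lemma triple_chi_midpoint u v :
  triple_chi (midpoint u v) = fun z => 2^-1 *: (triple_chi u z + triple_chi v z).
Proof. by apply/funext => z; apply/matrixP => i j; rewrite !mxE. Qed.

Lemma sqnorm_triple (mu : {finite_measure set point -> \bar R}) u : sqnorm mu u =
  \sum_i \int[mu]_z triple_E u z 0 i ^+ 2 +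
  (\sum_i \sum_j \int[mu]_z triple_B u z i j ^+ 2 + \sum_i \sum_j \int[mu]_z triple_chi u z i j ^+ 2).
Proof.
rewrite /sqnorm !big_sumType /=; congr (_ + _).
  by apply: eq_bigr => i _; under [RHS]eq_Rintegral do rewrite mxE.
congr (_ + _); rewrite pair_big; apply: eq_bigr => -[i j] _ /=;
  by under [RHS]eq_Rintegral do rewrite mxE.
Qed.

End controls.

Section maximiser.
Context {R : realType} {d : nat}.
Variables (T nu aV aW : R).
Hypotheses (T0 : 0 <= T) (haV : 0 < aV) (haW : 0 < aW).
Local Notation point := (R * 'rV[R]_d)%type.
Local Notation Q := (spacetime d T).
Variables (V0 : 'rV[R]_d -> 'rV[R]_d) (gradV0 : 'rV[R]_d -> 'M[R]_d).
Hypotheses (LV0 : forall i, L2 (torus_measure d) (fun x => V0 x 0 i))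
  (LG : forall i j, L2 (torus_measure d) (fun x => gradV0 x i j)).
Variables (Vbar : point -> 'rV[R]_d) (Wbar : point -> 'M[R]_d).
Hypotheses (LVb : forall i, L2 Q (fun z => Vbar z 0 i))
  (LWb : forall i j, L2 Q (fun z => Wbar z i j)).
Local Notation dual := (dual_functional T nu aV aW Vbar Wbar V0 gradV0).
Local Notation J := (J_NS T nu aV aW Vbar Wbar V0 gradV0).

Lemma exists_maximiser : exists (E : point -> 'rV[R]_d) (B chi : point -> 'M[R]_d),
  [/\ EBPsi T nu E B chi, dual E B chi = J &
   forall i j, \forall z \ae Q, `|B z i j| <= (d%:R + 1) * aV].
Proof.
pose r := fine J.
have Jfin : J \is a fin_num by exact: (J_NS_fin nu T0 haV haW LV0 LG LVb LWb).
have rE : r%:E = J by rewrite fineK.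
pose Cb : R := (d%:R + 1) * aV.
have Cb0 : 0 <= Cb by rewrite mulr_ge0 ?addr_ge0// ltW.
have [kappa [K [k0 HK]]] := dual_coercive nu haV haW LV0 LG LVb LWb Cb0.
pose c n : R := r - n.+1%:R^-1.
have c_r1 n : r - 1 <= c n by rewrite lerD2l lerN2 invf_le1// ler1n.
pose A n := [set u : triple_index -> point -> R |
  EBPsi T nu (triple_E u) (triple_B u) (triple_chi u) /\
  ((c n)%:E <= dual (triple_E u) (triple_B u) (triple_chi u))%E].
have bB n u : A n u -> forall i j, \forall z \ae Q, `|triple_B u z i j| <= Cb.
  by move=> [EB Hc]; exact: (EBPsi_bound T0 haV LV0 LG LVb LWb EB Hc).
(* The norm bound has two parts: coercivity with the weakest threshold r - 1 for E and chi, and [Cb]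
   squared times the total measure for each entry of B. *)
have [| | | | |u [uA Lv uv dv]] := @nested_convex_cvg _ _ _ _ Q A
    (kappa^-1 * (K - (r - 1)) + \sum_(i < d) \sum_(j < d) Cb ^+ 2 * fine (Q setT)).
- move=> n.
  have n0 : (0 : R) < n.+1%:R^-1 by rewrite invr_gt0.
  have [y [E [B [chi [EB ->]]]] Hy] := ub_ereal_sup_adherent n0 Jfin.
  exists (triple E B chi); rewrite /A /= triple_EE triple_BE triple_chiE; split => //.
  by apply/ltW; move: Hy; rewrite -/J -rE -EFinB.
- move=> n m nm u [EB Hc]; split => //; apply: le_trans Hc.
  by rewrite lee_fin lerD2l lerN2 lef_pV2 ?posrE// ler_nat.
- move=> n u v [EB Hc] [EB' Hc'].
  have EBm := EBPsi_midpoint T0 EB EB'.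
  rewrite /A /= triple_E_midpoint triple_B_midpoint triple_chi_midpoint; split => //.
  by apply: (dual_midpoint LV0 LG LVb LWb (EBPsi_admissible EB) (EBPsi_admissible EB') (EBPsi_admissible EBm)).
- move=> n u [EB _] a; have adm := EBPsi_admissible EB; have LB := admissible_L2B adm.
  have [LE _ _ Lc] := adm.
  case: a => [i|[[i j]|[i j]]].
  + by have := LE i; under eq_fun do rewrite mxE.
  + by have := LB i j; under eq_fun do rewrite mxE.
  + by have := Lc i j; under eq_fun do rewrite mxE.
- move=> n u Au; have [EB Hc] := Au; have adm := EBPsi_admissible EB.
  have LB := admissible_L2B adm.
  have := HK _ _ _ _ adm Hc (bB _ _ Au).
  rewrite sqnorm_triple => H; rewrite addrCA addrC lerD//.
    rewrite ler_pdivlMl//; apply: (le_trans H).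
    by rewrite lerD2l lerN2.
  apply: ler_sum => i _; apply: ler_sum => j _.
  rewrite -Rintg_cst; apply: ae_le_Rintg.
  + exact: (LB i j).2.
  + exact: L1_cst.
  + by apply: filterS (bB _ _ Au i j) => z; rewrite -ler_sqr ?nnegrE// real_normK ?num_real.
set v := fun a x => seq_lim (fun n => u n a x) in Lv uv dv.
have cB i j : \forall z \ae Q, triple_B (u n) z i j @[n --> \oo] --> triple_B v z i j.
  apply: filterS (uv (inr (inl (i, j)))) => z.
  rewrite mxE (_ : (fun n => triple_B (u n) z i j) = fun n => u n (inr (inl (i, j))) z)//.
  by apply/funext => n; rewrite mxE.
have bv i j : \forall z \ae Q, `|triple_B v z i j| <= Cb.
  apply: (@ae_lim_bounded _ _ _ _ (fun n z => triple_B (u n) z i j)).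
    by move=> n; exact: bB (uA n) i j.
  exact: cB.
have dE n i : \int[Q]_z (triple_E (u n) z 0 i - triple_E v z 0 i) ^+ 2 <= (2 ^- n) ^+ 2.
  by under eq_Rintegral do rewrite !mxE; exact: dv.
have dB n i j : \int[Q]_z (triple_B (u n) z i j - triple_B v z i j) ^+ 2 <= (2 ^- n) ^+ 2.
  by under eq_Rintegral do rewrite !mxE; exact: dv.
have dc n i j : \int[Q]_z (triple_chi (u n) z i j - triple_chi v z i j) ^+ 2 <= (2 ^- n) ^+ 2.
  by under eq_Rintegral do rewrite !mxE; exact: dv.
have EB : EBPsi T nu (triple_E v) (triple_B v) (triple_chi v).
  apply: (EBPsi_limit T0 (fun n => (uA n).1) _ _ _ dE dB dc bv).
  - by move=> i; under eq_fun do rewrite mxE; exact: Lv.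
  - by move=> i j; under eq_fun do rewrite mxE; exact: Lv.
  - by move=> i j; under eq_fun do rewrite mxE; exact: Lv.
  (* The sequences of entries (i, j) and (j, i) coincide at z, hence so do their limits superior,
     convergent or not: symmetry holds at every point. *)
  - move=> z; apply/matrixP => i j; rewrite !mxE; congr seq_lim; apply/funext => n.
    have [[_ _ _ [sB _] _] _] := uA n.
    by have := congr1 (fun M : 'M[R]_d => M i j) (sB z); rewrite !mxE.
  - move=> z; apply/matrixP => i j; rewrite !mxE; congr seq_lim; apply/funext => n.
    have [[_ _ _ [_ sc] _] _] := uA n.
    by have := congr1 (fun M : 'M[R]_d => M i j) (sc z); rewrite !mxE.
exists (triple_E v), (triple_B v), (triple_chi v); split => //.
apply/eqP; rewrite eq_le; apply/andP; split.
  by apply: ereal_sup_ubound; exists (triple_E v), (triple_B v), (triple_chi v).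
rewrite -rE.
apply: (dual_limit LV0 LG LVb LWb (fun n => EBPsi_admissible (uA n).1) (EBPsi_admissible EB)
  dE dc (fun n => bB n _ (uA n)) cB (fun n => (uA n).2)).
rewrite -[X in _ --> X]subr0; apply: cvgB; first exact: cvg_cst.
exact: cvg_harmonic.
Qed.

End maximiser.

(** * Time regularity *)

Section time_primitives.
Context {R : realType}.

Definition after (t s : R) : R := \1_(`[t, +oo[%classic : set R) s.

Definition window (t s r : R) : R := \1_(`[t, s[%classic : set R) r.

Lemma indic_bound (U : Type) (A : set U) (x : U) : `|\1_A x : R| <= 1.
Proof. by rewrite indicE; case: (x \in A); rewrite ?normr1 ?normr0. Qed.

Lemma measurable_after t : measurable_fun setT (after t).
Proof. by apply: measurable_indic; exact: measurable_itv. Qed.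

Lemma measurable_window t s : measurable_fun setT (window t s).
Proof. by apply: measurable_indic; exact: measurable_itv. Qed.

Lemma afterB t s r : t <= s -> after t r - after s r = window t s r.
Proof.
move=> ts; rewrite /after /window !indicE !mem_setE !in_itv/= !andbT.
have [sr|rs] := leP s r; first by rewrite (le_trans ts sr) subrr.
by rewrite subr0 andbT.
Qed.

Lemma window_sqr t s r : window t s r ^+ 2 = window t s r.
Proof. by rewrite /window indicE; case: (r \in _); rewrite ?expr1n ?expr0n. Qed.

Variable T : R.

Lemma integral_window t s : 0 <= t -> t <= s -> s <= T ->
  \int[leb0 T]_r window t s r = s - t.
Proof.
move=> t0 ts sT; rewrite /Rintegral /window integral_indic//= setIT.
rewrite /leb0 /mrestr setIidl; last first.
  by move=> r /=; rewrite !in_itv/= => /andP[tr rs]; rewrite (le_trans t0 tr) (le_trans (ltW rs) sT).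
rewrite lebesgue_measure_itv /= lte_fin; case: ltP => // st.
by apply/eqP; rewrite eq_sym subr_eq0 eq_le st ts.
Qed.

Lemma L1_after_mul t (g : R -> R) : L1 (leb0 T) g -> L1 (leb0 T) (fun s => after t s * g s).
Proof. by move=> Lg; apply: (L1_bddM (measurable_after t) (aeW _ (indic_bound _)) Lg). Qed.

Hypothesis T0 : 0 <= T.

(** The tests t^(n+1) vanish at 0 but not at T, so the identity encodes the terminal value f(T) = 0
    and f must be minus the integral of g over [t, T]. By Fubini's theorem and the integral of the
    derivative of t^(n+1) over [0, s], this candidate has the moments of f, and the powers are
    complete. *)
Lemma ae_time_primitive (f g : R -> R) : L1 (leb0 T) f -> L1 (leb0 T) g ->
  (forall n, - (\int[leb0 T]_t (f t * (n.+1%:R * t ^+ n))) = \int[leb0 T]_t (t ^+ n.+1 * g t)) ->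
  \forall t \ae leb0 T, f t = - \int[leb0 T]_s (after t s * g s).
Proof.
move=> Lf Lg Hfg.
have mg := L1_meas Lg.
pose a (p : R * R) : R := after p.1 p.2.
have ma : measurable_fun setT a.
  have -> : a = \1_((fun p : R * R => p.2 - p.1) @^-1` `[0, +oo[).
    apply/funext => p; rewrite /a /after !indicE; congr (nat_of_bool _)%:R.
    by apply/idP/idP; rewrite !inE /= !in_itv/= !andbT subr_ge0.
  have mB : measurable_fun setT (fun p : R * R => p.2 - p.1).
    by apply: measurable_funB; [exact: measurable_snd|exact: measurable_fst].
  apply: measurable_indic; rewrite -[_ @^-1` _]setTI.
  by apply: (mB measurableT); exact: measurable_itv.
have Lg2 : (leb0 T \x leb0 T)%E.-integrable setT (EFin \o (fun p : R * R => g p.2)).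
  have mg2 : measurable_fun setT (EFin \o (fun p : R * R => g p.2)).
    by apply/measurable_EFinP; exact: measurableT_comp.
  apply/(integrable12ltyP (leb0 T) (leb0 T) mg2) => /=.
  have /integrableP[_] := Lg; rewrite integral_cst//=.
  move=> h; apply: lte_mul_pinfty => //.
  - exact: integral_ge0.
  - by rewrite ge0_fin_numE//; exact: integral_ge0.
  - by rewrite -ge0_fin_numE//; exact: fin_num_measure.
(* Cutting the monomial off outside [0, T] bounds it everywhere, which makes the double integrand
   integrable on the product. *)
pose h n t : R := \1_(`[0, T]%classic : set R) t * (n.+1%:R * t ^+ n).
have mi : measurable_fun setT (\1_(`[0, T]%classic : set R) : R -> R).
  by apply: measurable_indic; exact: measurable_itv.
have mp n : measurable_fun setT (fun t : R => n.+1%:R * t ^+ n).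
  by apply: measurable_funM => //; exact: exprn_measurable.
have mh n : measurable_fun setT (h n) by exact: measurable_funM.
have hC n t : `|h n t| <= n.+1%:R * `|T| ^+ n.
  rewrite /h indicE mem_setE in_itv/=; case: andP => [[t0 tT]|_]; last first.
    by rewrite mul0r normr0 mulr_ge0.
  rewrite mul1r normrM normr_nat normrX ler_wpM2l// lerXn2r ?nnegrE//.
  by rewrite !ger0_norm// (le_trans t0).
have Lm n : L1 (leb0 T) (fun t => n.+1%:R * t ^+ n).
  have [C HC] := leb0_monomial_bounded T0 n.
  by apply: L1Z; apply: (L1_bounded _ HC); exact: exprn_measurable.
have hE n : \forall t \ae leb0 T, h n t = n.+1%:R * t ^+ n.
  by apply: filterS (leb0_ae_itv T) => t tT; rewrite /h indicE mem_setE in_itv/= tT mul1r.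
pose F n (p : R * R) := h n p.1 * a p * g p.2.
have LF n : (leb0 T \x leb0 T)%E.-integrable setT (EFin \o F n).
  have := hC n; set C := n.+1%:R * `|T| ^+ n => hCn.
  have C0 : 0 <= C by rewrite mulr_ge0.
  apply: (le_integrable measurableT _ _ (integrableZl measurableT C Lg2)).
    apply/measurable_EFinP; apply: measurable_funM; last exact: measurableT_comp.
    by apply: measurable_funM => //; exact: measurableT_comp.
  move=> p _; rewrite /= lee_fin.
  rewrite 2!normrM [in leRHS]normrM (ger0_norm C0) ler_wpM2r// -[leRHS]mulr1.
  by rewrite ler_pM// indic_bound.
pose b t := \int[leb0 T]_s (after t s * g s).
have bE n t : \int[leb0 T]_s F n (t, s) = h n t * b t.
  by rewrite /b -RintgZ; [apply: eq_Rintegral => s _; rewrite mulrA|exact: L1_after_mul].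
have iE n : \forall s \ae leb0 T, \int[leb0 T]_t F n (t, s) = s ^+ n.+1 * g s.
  apply: filterS (leb0_ae_itv T) => s sT.
  have := @leb0_FTC R T s (fun t => t ^+ n.+1) (Ck_exp 1 n.+1) sT.
  rewrite expr0n subr0 => <-.
  have LD : L1 (leb0 T) (fun t => \1_(`[0, s]%classic : set R) t * 'D_1 (fun t : R => t ^+ n.+1) t).
    under eq_fun do rewrite exp_derive /GRing.scale/= mulr1.
    apply: (L1_bddM _ (aeW _ (indic_bound _)) (Lm n)).
    by apply: measurable_indic; exact: measurable_itv.
  rewrite mulrC -RintgZ//; apply: ae_eq_Rintg.
  - have mF := measurable_int _ (LF n); have {}mF : measurable_fun setT (F n) by exact/measurable_EFinP.
    exact: (measurableT_comp mF (pair2_measurable s)).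
  - by apply: measurable_funM => //; exact: L1_meas LD.
  apply: filterS2 (leb0_ae_itv T) (hE n) => t /andP[t0 tT] ht.
  rewrite exp_derive /GRing.scale/= mulr1 /F ht /a /after !indicE !mem_setE !in_itv/= t0 andbT /=.
  by ring.
have LI n := L1_integral1 (LF n).
(* The function [h 0%N] is the indicator of [0, T], so this product is a version of [b] whose
   integrability comes from Fubini's theorem with n = 0. *)
have Lk : L1 (leb0 T) (fun t => h 0%N t * b t).
  by have := LI 0%N; under eq_fun do rewrite bE.
have eqI : \forall t \ae leb0 T, f t + h 0%N t * b t = 0.
  apply: monomials_total; first exact: L1D.
  move=> n; have [C HC] := leb0_monomial_bounded T0 n.
  have Lt (u : R -> R) : L1 (leb0 T) u -> L1 (leb0 T) (fun t => t ^+ n * u t).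
    by move=> Lu; apply: (L1_bddM _ HC Lu); exact: exprn_measurable.
  under eq_Rintegral do rewrite mulrDr.
  rewrite RintgD; [|exact: Lt|exact: Lt].
  apply/(mulfI (_ : n.+1%:R != 0)); first by rewrite pnatr_eq0.
  rewrite mulr0 mulrDr -!RintgZ; [|exact: Lt|exact: Lt].
  have -> : \int[leb0 T]_t (n.+1%:R * (t ^+ n * f t)) = - \int[leb0 T]_t (t ^+ n.+1 * g t).
    by rewrite -Hfg opprK; apply: eq_Rintegral => t _; ring.
  apply/eqP; rewrite addrC subr_eq0; apply/eqP.
  transitivity (\int[leb0 T]_t \int[leb0 T]_s F n (t, s)).
    apply: ae_eq_Rintg; [exact: (L1_meas (L1Z _ (Lt _ Lk)))|exact: L1_meas (LI n)|].
    apply: filterS2 (hE n) (hE 0%N) => t hn h0.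
    by rewrite bE hn h0; ring.
  rewrite (Rintg_fubini_swap (LF n)); apply: ae_eq_Rintg => //.
  - exact: L1_meas (L1_integral2 (LF n)).
  - by apply: measurable_funM => //; exact: exprn_measurable.
apply: filterS2 eqI (hE 0%N) => t /eqP; rewrite addr_eq0 => /eqP -> ->.
by rewrite expr0 !mulr1 mul1r.
Qed.

End time_primitives.

(** * Curves of slices defined at every time *)

Section weak_curve.
Context {R : realType} {d : nat} {I : countType}.
Variables (T : R) (w : I -> 'rV[R]_d -> R).
Local Notation point := (R * 'rV[R]_d)%type.
Local Notation Q := (spacetime d T).
Local Notation mu := (torus_measure d).
Hypotheses (T0 : 0 < T) (mw : forall q, measurable_fun setT (w q)).
Hypothesis w1 : forall q x, `|w q x| <= 1.

Lemma L1_section_ae (f : point -> R) : L1 Q f -> \forall t \ae leb0 T, L1 mu (fun x => f (t, x)).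
Proof. exact: L1_ae_section1. Qed.

Lemma spacetime_fubini (f : point -> R) : L1 Q f ->
  \int[Q]_z f z = \int[leb0 T]_t \int[mu]_x f (t, x).
Proof. by move=> Lf; rewrite (Rintg_fubini1 (m1 := leb0 T) (m2 := mu) Lf). Qed.

Lemma L1_slice_integral (f : point -> R) : L1 Q f ->
  L1 (leb0 T) (fun t => \int[mu]_x f (t, x)).
Proof. exact: L1_integral1. Qed.

Lemma spacetime_fubini_mul (f : R -> R) (g : point -> R) :
  measurable_fun setT f -> (exists C, \forall t \ae leb0 T, `|f t| <= C) -> L1 Q g ->
  \int[Q]_z (f z.1 * g z) = \int[leb0 T]_t (f t * \int[mu]_x g (t, x)).
Proof.
move=> mf [C fC] Lg.
have mf1 : measurable_fun setT (fun z : point => f z.1) by exact: measurableT_comp.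
have L : L1 Q (fun z => f z.1 * g z) := L1_bddM mf1 (ae_time_product_fst mu fC) Lg.
rewrite (spacetime_fubini L); apply: ae_eq_Rintg.
- exact: L1_meas (L1_slice_integral L).
- by apply: measurable_funM => //; exact: L1_meas (L1_slice_integral Lg).
by apply: filterS (L1_section_ae Lg) => t Lt; rewrite -RintgZ.
Qed.

(** The positive part of |b| - C has integral zero, hence so do almost all of its slices. *)
Lemma ae_slices_bounded (b : point -> R) (C : R) : measurable_fun setT b ->
  (\forall z \ae Q, `|b z| <= C) ->
  \forall t \ae leb0 T, \forall x \ae mu, `|b (t, x)| <= C.
Proof.
move=> mb bC.
pose h z := Num.max (`|b z| - C) 0.
have h0 z : 0 <= h z by rewrite le_max lexx orbT.
have mh : measurable_fun setT h.
  apply: measurable_maxr => //; apply: measurable_funB => //.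
  exact: measurableT_comp.
have hE : \forall z \ae Q, h z = 0.
  by apply: filterS bC => z bz; apply/max_idPr; rewrite subr_le0.
have Lh : L1 Q h by apply: (L1_ae mh _ hE); exact: L1_cst.
have Ih : \int[leb0 T]_t \int[mu]_x h (t, x) = 0.
  rewrite -spacetime_fubini// -[RHS](Rintg0 Q); exact: ae_eq_Rintg.
have : \forall t \ae leb0 T, \int[mu]_x h (t, x) = 0.
  apply: Rintg_eq0 => //; first exact: L1_slice_integral.
  by move=> t; exact: Rintg_ge0.
apply: filterS2 (L1_section_ae Lh) => t Lt It.
have := Rintg_eq0 Lt (fun x => h0 (t, x)) It.
by apply: filterS => x /max_idPr; rewrite subr_le0.
Qed.

(** The part of [0, T] within distance e of t contains an interval of positive length, which is not
    a null set. *)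
Lemma exists_good_time (P : R -> Prop) t e : (\forall s \ae leb0 T, P s) ->
  0 <= t <= T -> 0 < e -> exists s, [/\ P s, 0 <= s <= T & `|s - t| <= e].
Proof.
move=> aeP /andP[t0 tT] e0; have T1 := T0; apply: contrapT => /forallNP H.
pose a := Num.max 0 (t - e); pose c := Num.min T (t + e).
have a0 : 0 <= a by rewrite le_max lexx.
have cT : c <= T by rewrite ge_min lexx.
have ac : a < c by rewrite gt_max !lt_min; apply/andP; split; apply/andP; split; lra.
have := integral_window a0 (ltW ac) cT.
have -> : \int[leb0 T]_r window a c r = 0.
  rewrite -[RHS](Rintg0 (leb0 T)); apply: ae_eq_Rintg => //; first exact: measurable_window.
  apply: filterS aeP => r Pr; rewrite /window indicE mem_setE in_itv/=.
  case: andP => // -[ar rc]; exfalso; apply: (H r); split => //.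
    by rewrite (le_trans a0 ar) (le_trans (ltW rc) cT).
  move: ar rc; rewrite ge_max lt_min => /andP[_ h1] /andP[_ h2].
  by rewrite ler_norml; apply/andP; split; lra.
lra.
Qed.

Variables (b : point -> R) (C : R) (G : I -> point -> R) (M : I -> R).
Hypotheses (mb : measurable_fun setT b) (bC : \forall z \ae Q, `|b z| <= C).
Hypotheses (LG : forall q, L1 Q (G q)) (M0 : forall q, 0 <= M q).
Hypothesis moments : forall q n,
  - (\int[Q]_z (b z * (n.+1%:R * z.1 ^+ n * w q z.2))) = \int[Q]_z (z.1 ^+ n.+1 * G q z).
Hypothesis modulus : forall q t s, 0 <= t -> t <= s -> s <= T ->
  `|\int[Q]_z (window t s z.1 * G q z)| <= M q * Num.sqrt (s - t).

(** [beta q] is the continuous version of the moment of b against [w q], vanishing at T. It is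
    defined at every time, while the slices of b realise it only at almost every one. *)
Let g q t := \int[mu]_x G q (t, x).
Let beta q t := - \int[leb0 T]_s (after t s * g q s).

Let Lg q : L1 (leb0 T) (g q). Proof. exact: L1_slice_integral. Qed.

Let betaB q t s : t <= s ->
  beta q s - beta q t = \int[Q]_z (window t s z.1 * G q z).
Proof.
move=> ts; rewrite spacetime_fubini_mul//; last 2 first.
- exact: measurable_window.
- by exists 1; apply: aeW => r; exact: indic_bound.
rewrite /beta opprK addrC -RintgB; [|exact: L1_after_mul|exact: L1_after_mul].
by apply: eq_Rintegral => r _; rewrite -mulrBl afterB.
Qed.

Let Lbw q : L1 Q (fun z => w q z.2 * b z).
Proof.
apply: (L1_bddM (C := 1)) => //; first exact: measurableT_comp.
  by apply: aeW => z.
exact: L1_bounded mb bC.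
Qed.

Let ae_moment q : \forall t \ae leb0 T, \int[mu]_x (w q x * b (t, x)) = beta q t.
Proof.
apply: (ae_time_primitive (ltW T0)) => //; first exact: (L1_slice_integral (Lbw q)).
move=> n; have [K HK] := leb0_monomial_bounded (ltW T0) n.
have [K' HK'] := leb0_monomial_bounded (ltW T0) n.+1.
rewrite -(spacetime_fubini_mul (f := fun t => t ^+ n.+1)) //; last by exists K'.
rewrite -moments; congr (- _).
transitivity (\int[Q]_z ((n.+1%:R * z.1 ^+ n) * (w q z.2 * b z))).
  rewrite (spacetime_fubini_mul (f := fun t => n.+1%:R * t ^+ n)) //.
  - by apply: eq_Rintegral => t _; rewrite mulrC.
  - by apply: measurable_funM => //; exact: exprn_measurable.
  - exists (n.+1%:R * K); apply: filterS HK => t tK.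
    by rewrite normrM normr_nat ler_wpM2l.
by apply: eq_Rintegral => z _; ring.
Qed.

Let good t := (\forall x \ae mu, `|b (t, x)| <= C) /\
  forall q, \int[mu]_x (w q x * b (t, x)) = beta q t.

Let ae_good : \forall t \ae leb0 T, good t.
Proof.
apply: filterS2 (ae_slices_bounded mb bC) (ae_forall_countable ae_moment) => t h1 h2.
by split.
Qed.

Let mslice t : measurable_fun setT (fun x => b (t, x)).
Proof. exact: (measurableT_comp mb (pair1_measurable t)). Qed.

Let beta_modulus q s t : 0 <= s <= T -> 0 <= t <= T ->
  `|beta q s - beta q t| <= M q * Num.sqrt `|s - t|.
Proof.
wlog ts : s t / t <= s => [H|/andP[s0 sT] /andP[t0 tT]].
  have [ts|/ltW st] := leP t s; first exact: H.
  by move=> h1 h2; rewrite distrC [`|s - t|]distrC; exact: H.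
rewrite betaB// (ger0_norm (_ : 0 <= s - t)); first exact: modulus.
by rewrite subr_ge0.
Qed.

(** The sets [A n] of functions bounded by C with moments close to [beta q t] are convex, nested and
    bounded in L^2. They are nonempty because they contain the slices at good times within 1/(n+1)
    of t, thanks to the modulus of [beta]. The L^2 limit of nearly minimal elements has exactly the
    moments [beta q t]. *)
Let slice_limit t : 0 <= t <= T -> exists u : 'rV[R]_d -> R,
  [/\ measurable_fun setT u, \forall x \ae mu, `|u x| <= C &
   forall q, \int[mu]_x (w q x * u x) = beta q t].
Proof.
move=> tT.
have Lw q : L2 mu (w q) by apply: (L2_bounded (mw q)); apply: aeW; exact: w1.
pose A n := [set u : unit -> 'rV[R]_d -> R | [/\ measurable_fun setT (u tt),
  \forall x \ae mu, `|u tt x| <= C &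
  forall q, `|\int[mu]_x (w q x * u tt x) - beta q t| <= M q * Num.sqrt (n.+1%:R^-1)]].
have LA n u i : A n u -> L2 mu (u i).
  by case: i => -[mu' uC _]; exact: L2_bounded mu' uC.
have [| | | | |u [uA Lv uv dv]] := @nested_convex_cvg _ _ _ _ mu A (C ^+ 2 * fine (mu setT)).
- move=> n; have n0 : (0 : R) < n.+1%:R^-1 by rewrite invr_gt0.
  have [s [[sC sb] sT st]] := exists_good_time ae_good tT n0.
  exists (fun _ x => b (s, x)); split => // q.
  rewrite sb (le_trans (beta_modulus _ sT tT))// ler_wpM2l//.
  by rewrite ler_wsqrtr.
- move=> n m nm u [h1 h2 h3]; split => // q; apply: (le_trans (h3 q)).
  by rewrite ler_wpM2l// ler_wsqrtr// lef_pV2 ?posrE// ler_nat.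
- move=> n u v Au Av; have [h1 h2 h3] := Au; have [k1 k2 k3] := Av; split.
  + by apply: measurable_funM => //; exact: measurable_funD.
  + apply: filterS2 h2 k2 => x ux vx; rewrite /midpoint normrM ger0_norm ?invr_ge0//.
    by have := ler_normD (u tt x) (v tt x); lra.
  + move=> q; rewrite /midpoint.
    have [Lu Lv] := (LA _ _ tt Au, LA _ _ tt Av).
    have -> : \int[mu]_x (w q x * (2^-1 * (u tt x + v tt x))) =
        2^-1 * (\int[mu]_x (w q x * u tt x) + \int[mu]_x (w q x * v tt x)).
      rewrite -RintgD; [|exact: L2_mul|exact: L2_mul].
      rewrite -RintgZ; last by apply: L1D; exact: L2_mul.
      by apply: eq_Rintegral => x _; ring.
    have := h3 q; have := k3 q; rewrite !ler_norml => /andP[? ?] /andP[? ?].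
    by apply/andP; split; lra.
- by move=> n u Au i; exact: LA Au.
- move=> n u Au; have [h1 h2 _] := Au; rewrite /sqnorm (bigD1 tt)//= big1 ?addr0; last by case.
  rewrite -Rintg_cst.
  apply: ae_le_Rintg; [exact: (LA _ _ tt Au).2|exact: L1_cst|].
  by apply: filterS h2 => x ux; rewrite -[leLHS]real_normK ?num_real// lerXn2r ?nnegrE// (le_trans _ ux).
set v := fun i x => seq_lim (fun n => u n i x) in Lv uv dv.
exists (v tt); split.
- exact: (Lv tt).1.
- apply: (@ae_lim_bounded _ _ _ _ (fun n => u n tt)) (uv tt) => n.
  by have [] := uA n.
move=> q.
have c1 : \int[mu]_x (u n tt x * w q x) @[n --> \oo] --> \int[mu]_x (v tt x * w q x).
  apply: (@cvg_Rintg_mul _ _ _ mu (fun n => u n tt)) => //.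
  - by move=> n; exact: LA (uA n).
  - exact: Lv.
have c2 : \int[mu]_x (u n tt x * w q x) @[n --> \oo] --> beta q t.
  have z : M q * Num.sqrt (n.+1%:R^-1) @[n --> \oo] --> (0 : R).
    rewrite -[X in _ --> X](mulr0 (M q)) -[X in _ * X]sqrtr0.
    apply: cvgMr; apply: continuous_cvg; first exact: sqrt_continuous.
    exact: cvg_harmonic.
  apply/cvgrPdist_le => /= e e0.
  have : \forall n \near \oo, M q * Num.sqrt (n.+1%:R^-1) <= e by exact: (cvgr_le _ z).
  apply: filterS => n; apply: le_trans; rewrite distrC.
  by under eq_Rintegral do rewrite mulrC; have [_ _] := uA n; apply.
under eq_Rintegral do rewrite mulrC.
by rewrite -(cvg_lim (@Rhausdorff R) c1) (cvg_lim (@Rhausdorff R) c2).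
Qed.

Lemma weak_curve : exists bt : R -> 'rV[R]_d -> R,
  [/\ \forall t \ae leb0 T, forall x, bt t x = b (t, x),
      forall t, 0 <= t <= T -> measurable_fun setT (bt t),
      forall t, 0 <= t <= T -> \forall x \ae mu, `|bt t x| <= C
    & forall q t s, 0 <= t -> t <= s -> s <= T ->
      \int[mu]_x (w q x * bt s x) - \int[mu]_x (w q x * bt t x) =
      \int[Q]_z (window t s z.1 * G q z)].
Proof.
(* A good time keeps its own slice, so the curve agrees with b at almost every time; outside [0, T]
   the zero function is a default value. *)
have H t : exists u : 'rV[R]_d -> R, (good t -> u = fun x => b (t, x)) /\
    (0 <= t <= T -> [/\ measurable_fun setT u, \forall x \ae mu, `|u x| <= C &
    forall q, \int[mu]_x (w q x * u x) = beta q t]).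
  have [gt|ngt] := pselect (good t).
    by exists (fun x => b (t, x)); split => // _; have [] := gt; split.
  have [tT|tN] := boolP (0 <= t <= T); last by exists (fun=> 0).
  by have [u Hu] := slice_limit tT; exists u.
have [bt Hbt] := choice H.
exists bt; split.
- by apply: filterS ae_good => t gt x; rewrite (Hbt t).1.
- by move=> t /(Hbt t).2[].
- by move=> t /(Hbt t).2[].
move=> q t s t0 ts sT.
have tT : 0 <= t <= T by rewrite t0 (le_trans ts).
have {}sT : 0 <= s <= T by rewrite sT (le_trans t0).
by have [_ _ ->] := (Hbt t).2 tT; have [_ _ ->] := (Hbt s).2 sT; exact: betaB.
Qed.

End weak_curve.

(** * Density of trigonometric polynomials in H^2 *)

Section density.
Context {R : realType} {d : nat}.
Local Notation mu := (torus_measure d).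
Local Notation freq := ('rV[int]_d * nat)%type.
Implicit Types (f : 'rV[R]_d -> R) (s : seq (R * freq)).

(* Indices of the derivatives of order at most two. *)
Definition jet_index := (unit + ('I_d + 'I_d * 'I_d))%type.

Definition jet f (a : jet_index) : 'rV[R]_d -> R :=
  match a with
  | inl _ => f
  | inr (inl i) => spartial i f
  | inr (inr p) => spartial p.1 (spartial p.2 f)
  end.

Definition jet_tp (a : jet_index) s :=
  match a with
  | inl _ => s
  | inr (inl i) => diff_tp i s
  | inr (inr p) => diff_tp p.1 (diff_tp p.2 s)
  end.

(** The real factor of the Fourier multiplier of the derivative; the power of the imaginary unit is
    carried by the phase of the wave. *)
Definition jet_symbol (a : jet_index) (k : 'rV[int]_d) : R :=
  match a with
  | inl _ => 1
  | inr (inl i) => 2 * pi * (k 0 i)%:~R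
  | inr (inr p) => 2 * pi * (k 0 p.2)%:~R * (2 * pi * (k 0 p.1)%:~R)
  end.

(** Minus one to the power of the order of the derivative, the sign produced by moving it onto the
    other factor. *)
Definition jet_sign (a : jet_index) : R :=
  match a with inr (inl _) => -1 | _ => 1 end.

Definition scale_tp (c : R) s := [seq (c * p.1, p.2) | p <- s].

Lemma jet_tpoly a s : jet (tpoly s) a = tpoly (jet_tp a s).
Proof. by case: a => [u|[i|[i j]]] //=; rewrite !spartial_tpoly. Qed.

Lemma tpoly_cat s s' x : tpoly (s ++ s') x = tpoly s x + tpoly s' x.
Proof. by rewrite /tpoly big_cat. Qed.

Lemma tpoly_scale c s x : tpoly (scale_tp c s) x = c * tpoly s x.
Proof. by rewrite /tpoly big_map mulr_sumr; apply: eq_bigr => p _; rewrite mulrA. Qed.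

Lemma jet_tp_cat a s s' : jet_tp a (s ++ s') = jet_tp a s ++ jet_tp a s'.
Proof. by case: a => [u|[i|[i j]]] //=; rewrite /diff_tp !map_cat. Qed.

Lemma jet_tp_scale a c s x : tpoly (jet_tp a (scale_tp c s)) x = c * tpoly (jet_tp a s) x.
Proof.
rewrite -tpoly_scale; congr (tpoly _ x).
case: a => [u|[i|[i j]]] //=; rewrite /diff_tp /scale_tp -!map_comp; apply: eq_map => p /=.
- by rewrite !mulrA.
- by rewrite !mulrA.
Qed.

(** The sign is the one of integration by parts, so the two cancel and every derivative contributes
    a nonnegative multiple of the same Fourier coefficient. *)
Lemma jet_tp_wave a (q : freq) x :
  tpoly (jet_tp a (jet_tp a [:: (1, q)])) x =
  jet_sign a * jet_symbol a q.1 ^+ 2 * wave q.1 q.2 x.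
Proof.
case: a => [u|[i|[i j]]]; rewrite /tpoly /= big_seq1 /= ?wave2 ?opprK; by ring.
Qed.

Lemma L2_jet f a : Ck 2 f -> torus_periodic f -> L2 mu (jet f a).
Proof.
move=> Cf pf; apply: L2_continuous_periodic.
- case: a => [u|[i|[i j]]] /=; first exact: Ck_cont Cf.
    exact: Ck_cont (Ck_derive _ Cf).
  exact: Ck_cont (Ck_derive _ (Ck_derive _ Cf)).
- case: a => [u|[i|[i j]]] /=; first exact: pf.
    exact: (spartial_periodic i pf).
  exact: (spartial_periodic i (spartial_periodic j pf)).
Qed.

Lemma jet_IBP f a s : Ck 2 f -> torus_periodic f ->
  \int[mu]_x (jet f a x * tpoly s x) =
  jet_sign a * \int[mu]_x (f x * tpoly (jet_tp a s) x).
Proof.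
move=> Cf pf; have C1 := Ck_tpoly 1; have p1 := @tpoly_periodic R d.
case: a => [u|[i|[i j]]] /=; first by rewrite mul1r.
  rewrite mulN1r torus_IBP//; last exact: CkS.
  by under eq_Rintegral do rewrite spartial_tpoly.
rewrite mul1r torus_IBP//; last 2 first.
- exact: (Ck_derive _ Cf).
- exact: spartial_periodic.
rewrite spartial_tpoly torus_IBP//; last exact: CkS.
rewrite opprK; apply: eq_Rintegral => x _.
by rewrite spartial_tpoly (diff_tpC j i).
Qed.

Variable psi : 'rV[R]_d -> R.
Hypotheses (Cpsi : Ck 2 psi) (ppsi : torus_periodic psi).

Definition residual s (a : jet_index) x := jet psi a x - tpoly (jet_tp a s) x.

Lemma L2_residual s a : L2 mu (residual s a).
Proof. by apply: L2B; [exact: L2_jet|exact: L2_tpoly]. Qed.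

Lemma residual_IBP s s' a : \int[mu]_x (residual s a x * tpoly s' x) =
  jet_sign a * \int[mu]_x (residual s (inl tt) x * tpoly (jet_tp a s') x).
Proof.
have L2j b := L2_jet b Cpsi ppsi.
rewrite /residual; under eq_Rintegral do rewrite mulrBl.
rewrite RintgB; [|by apply: L2_mul => //; exact: L2_tpoly|exact: L1_tpolyM].
under [in RHS]eq_Rintegral do rewrite mulrBl.
rewrite RintgB; [|by apply: L2_mul; [exact: (L2j (inl tt))|exact: L2_tpoly]|exact: L1_tpolyM].
by rewrite mulrBr (jet_IBP a s' Cpsi ppsi) -(jet_tpoly a s) (jet_IBP a s' (Ck_tpoly 2 s) (@tpoly_periodic _ _ s)).
Qed.

(* The residuals of nearly best approximations converge to a jet orthogonal to
   the jets of all waves; its Fourier coefficients are therefore zero. *)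
Lemma tpoly_dense (e : R) : 0 < e -> exists s, sqnorm mu (residual s) <= e.
Proof.
move=> e0.
pose A := [set sqnorm mu (residual s) | s in [set: seq (R * freq)]].
have lbA : has_lbound A by exists 0 => _ [s _ <-]; exact: sqnorm_ge0.
have infA : has_inf A by split => //; exists (sqnorm mu (residual [::])), [::].
pose m := inf A.
have m_le s : m <= sqnorm mu (residual s) by apply: ge_inf => //; exists s.
have m0 : 0 <= m by apply: lb_le_inf infA.1 _ => _ [s _ <-]; exact: sqnorm_ge0.
pose K n := [set u : jet_index -> 'rV[R]_d -> R |
  exists s, u = residual s /\ sqnorm mu u <= m + n.+1%:R^-1].
have LK n u : K n u -> forall a, L2 mu (u a) by move=> [s [-> _]] a; exact: L2_residual.
have [| | | | |u [uK Lv uv dv]] := @nested_convex_cvg _ _ _ _ mu K (m + 1).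
- move=> n; have n0 : (0 : R) < n.+1%:R^-1 by rewrite invr_gt0.
  have [_ [s _ <-] Hs] := inf_adherent n0 infA.
  by exists (residual s), s; split => //; exact: ltW.
- move=> n k nk u [s [us Hs]]; exists s; split => //; apply: (le_trans Hs).
  by rewrite lerD2l lef_pV2 ?posrE// ler_nat.
- move=> n u v Ku Kv; have [s [us Hs]] := Ku; have [s' [vs Hs']] := Kv.
  exists (scale_tp 2^-1 (s ++ s')); split.
    apply/funext => a; apply/funext => x; rewrite us vs /midpoint /residual.
    by rewrite jet_tp_scale jet_tp_cat tpoly_cat; field.
  have := sqnorm_parallelogram (LK _ _ Ku) (LK _ _ Kv).
  have := sqnorm_ge0 mu (fun i x => u i x - v i x).
  move: Hs Hs'; move: (sqnorm mu u) (sqnorm mu v) (sqnorm mu (midpoint _ _)) (sqnorm mu _) (n.+1%:R^-1 : R).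
  by move=> a b c x y; lra.
- exact: LK.
- by move=> n u [s [_ h]]; apply: (le_trans h); rewrite lerD2l invf_le1// ler1n.
set v := fun a x => seq_lim (fun n => u n a x) in Lv uv dv.
have Lu n a : L2 mu (u n a) := LK _ _ (uK n) a.
have cu a s : \int[mu]_x (u n a x * tpoly s x) @[n --> \oo] --> \int[mu]_x (v a x * tpoly s x).
  by apply: (@cvg_Rintg_mul _ _ _ mu (fun n => u n a)); [move=> n; exact: Lu|exact: Lv|exact: L2_tpoly|move=> n; exact: dv].
have IBP a s : \int[mu]_x (v a x * tpoly s x) =
    jet_sign a * \int[mu]_x (v (inl tt) x * tpoly (jet_tp a s) x).
  have c2 : \int[mu]_x (u n a x * tpoly s x) @[n --> \oo] -->
      jet_sign a * \int[mu]_x (v (inl tt) x * tpoly (jet_tp a s) x).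
    rewrite (_ : (fun n => _) = fun n => jet_sign a * \int[mu]_x (u n (inl tt) x * tpoly (jet_tp a s) x)).
      by apply: cvgMr; exact: cu.
    by apply/funext => n; have [s' [-> _]] := uK n; exact: residual_IBP.
  by rewrite -(cvg_lim (@Rhausdorff R) (cu a s)) (cvg_lim (@Rhausdorff R) c2).
pose ip s := \sum_a \int[mu]_x (v a x * tpoly (jet_tp a s) x).
have orth s : ip s = 0.
  pose N := sqnorm mu (fun a => tpoly (jet_tp a s)).
  have Lt a : L2 mu (tpoly (jet_tp a s)) by exact: L2_tpoly.
  (* Appending t times s to the list behind [u n] gives another residual, whose squared norm is at
     least the infimum m and is quadratic in t. *)
  have expand n t : m <= sqnorm mu (u n) - 2 * t * (\sum_a \int[mu]_x (u n a x * tpoly (jet_tp a s) x)) + t ^+ 2 * N.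
    have [s' [us' _]] := uK n.
    apply: le_trans (m_le (s' ++ scale_tp t s)) _.
    rewrite /N /sqnorm !mulr_sumr -sumrB -big_split; apply: ler_sum => a _ /=.
    have [[_ Lu2] [_ Lt2]] := (Lu n a, Lt a).
    have Lut := L2_mul (Lu n a) (Lt a).
    rewrite -!RintgZ// -RintgB//; last exact: L1Z.
    rewrite -RintgD; [|by apply: L1B => //; exact: L1Z|exact: L1Z].
    rewrite le_eqVlt; apply/orP; left; apply/eqP; apply: eq_Rintegral => x _.
    by rewrite us' /residual jet_tp_cat tpoly_cat jet_tp_scale; ring.
  have Ht t : 0 <= - (2 * t) * ip s + t ^+ 2 * N.
    have c1 : m + n.+1%:R^-1 + (- (2 * t) * (\sum_a \int[mu]_x (u n a x * tpoly (jet_tp a s) x)) + t ^+ 2 * N)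
        @[n --> \oo] --> m + 0 + (- (2 * t) * ip s + t ^+ 2 * N).
      apply: cvgD; first by apply: cvgD; [exact: cvg_cst|exact: cvg_harmonic].
      apply: cvgD; last exact: cvg_cst.
      by apply: cvgMr; apply: cvg_sum_seq => a; exact: cu.
    rewrite -(lerD2l (m + 0)) addr0 [m + 0]addr0; move: c1; rewrite addr0.
    move=> c1; apply: (ler_cvg_to (cvg_cst m) c1); apply: nearW => n.
    have [_ [_ us]] := uK n; have := expand n t; move: us.
    move: (sqnorm mu (u n)) (\sum_a _) (n.+1%:R^-1 : R) => x y z; lra.
  have N0 : 0 <= N := sqnorm_ge0 _ _.
  apply/eqP; rewrite -sqrf_eq0 eq_le sqr_ge0 andbT.
  (* Nearly the minimiser of the quadratic; N + 1 avoids a division by zero, and the value is still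
     negative unless [ip s] is 0. *)
  have := Ht (ip s / (N + 1)).
  have N1 : 0 < N + 1 by lra.
  rewrite (_ : _ + _ = - ((ip s) ^+ 2 * ((N + 2) / (N + 1) ^+ 2))); last first.
    by field; rewrite gt_eqF.
  rewrite oppr_ge0 pmulr_lle0// divr_gt0 ?exprn_gt0//; lra.
have v0 : \forall x \ae mu, v (inl tt) x = 0.
  apply: waves_complete; first exact: L2_L1 (Lv _).
  move=> q; have := orth [:: (1, q)]; rewrite /ip.
  under eq_bigr do rewrite IBP.
  have E a : jet_sign a * \int[mu]_x (v (inl tt) x * tpoly (jet_tp a (jet_tp a [:: (1, q)])) x) =
      jet_symbol a q.1 ^+ 2 * \int[mu]_x (wave q.1 q.2 x * v (inl tt) x).
    have Lw : L1 mu (fun x => wave q.1 q.2 x * v (inl tt) x).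
      have := L2_mul (L2_tpoly [:: (1, q)]) (Lv (inl tt)).
      by under eq_fun do rewrite /tpoly big_seq1 mul1r.
    rewrite -!RintgZ//; last first.
      by apply: L2_mul; [exact: Lv|exact: L2_tpoly].
    apply: eq_Rintegral => x _; rewrite jet_tp_wave.
    by case: a => [?|[?|?]] /=; ring.
  under eq_bigr do rewrite E.
  (* The sum of the squared symbols is at least 1, its term of order zero, so it is the Fourier
     coefficient that vanishes. *)
  rewrite -mulr_suml => /eqP; rewrite mulf_eq0 => /orP[|/eqP//].
  rewrite big_sumType /= (bigD1 tt)//= expr1n big1 ?addr0; last by case.
  rewrite gt_eqF// ltr_pwDl// sumr_ge0// => a _; exact: sqr_ge0.
(* By [IBP] the other components are the weak derivatives of the component of order zero. *)
have va a : \forall x \ae mu, v a x = 0.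
  apply: waves_complete; first exact: L2_L1 (Lv _).
  move=> q; have := IBP a [:: (1, q)].
  have -> : \int[mu]_x (v (inl tt) x * tpoly (jet_tp a [:: (1, q)]) x) = 0.
    rewrite -[RHS](Rintg0 mu); apply: ae_eq_Rintg => //.
      by apply: measurable_funM; [exact: (Lv _).1|exact: (L2_tpoly _).1].
    by apply: filterS v0 => x ->; rewrite mul0r.
  rewrite mulr0 => <-; apply: eq_Rintegral => x _.
  by rewrite /tpoly big_seq1 /= mul1r mulrC.
(* As the limit jet vanishes, the rate of convergence bounds the residuals themselves; the factor
   counts the jet indices. *)
have small n : sqnorm mu (u n) <= #|{: jet_index}|%:R * (2^-1 ^+ n).
  rewrite mulr_natl -sumr_const; apply: ler_sum => a _.
  apply: le_trans (_ : (2 ^- n) ^+ 2 <= _); last first.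
    rewrite expr2 -exprVn ler_piMl ?exprn_ge0 ?invr_ge0//.
    by rewrite exprn_ile1 ?invr_ge0// invf_le1// ler1n.
  apply: le_trans (dv a n); rewrite le_eqVlt; apply/orP; left; apply/eqP; apply: ae_eq_Rintg.
  - by apply: measurable_funX; exact: (Lu n a).1.
  - by apply: measurable_funX; apply: measurable_funB; [exact: (Lu n a).1|exact: (Lv a).1].
  by apply: filterS (va a) => x; rewrite -/(v a x) => ->; rewrite subr0.
have c0 : #|{: jet_index}|%:R * (2^-1 ^+ n) @[n --> \oo] --> (0 : R).
  rewrite -[X in _ --> X](mulr0 (#|{: jet_index}|%:R : R)); apply: cvgMr; apply: cvg_expr.
  by rewrite ger0_norm ?invr_ge0// invf_lt1// ltr1n.
have [n _ Hn] : \forall n \near \oo, #|{: jet_index}|%:R * (2^-1 ^+ n) <= e by exact: (cvgr_le _ c0).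
have [s [us _]] := uK n.
by exists s; rewrite -us (le_trans (small n))//; apply: Hn => /=.
Qed.

End density.

Section symmetric_unit.
Context {R : realType} {d : nat}.

(** The constraint admits symmetric tests only; paired with a symmetric B, this symmetrised unit
    matrix still returns the single entry B_ij. *)
Definition sym_delta (i j : 'I_d) : 'M[R]_d :=
  \matrix_(a, b) (2^-1 * (((i == a) && (j == b))%:R + ((j == a) && (i == b))%:R)).

Lemma sym_delta_sym i j : symmetric_mx (sym_delta i j).
Proof. by apply/matrixP => a b; rewrite !mxE addrC; congr (_ * (_ + _)); rewrite andbC. Qed.

Lemma sum_sym_delta i j (F : 'I_d -> 'I_d -> R) :
  \sum_a \sum_b F a b * sym_delta i j a b = 2^-1 * (F i j + F j i).
Proof.
have H (k l : 'I_d) : \sum_a \sum_b F a b * ((k == a) && (l == b))%:R = F k l.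
  rewrite (bigD1 k)//= [X in _ + X]big1 ?addr0; last first.
    by move=> a ak; apply: big1 => b _; rewrite eq_sym (negbTE ak) mulr0.
  rewrite (bigD1 l)//= big1 ?addr0; first by rewrite !eqxx mulr1.
  by move=> b bl; rewrite [l == b]eq_sym (negbTE bl) andbF mulr0.
rewrite -[in RHS](H i j) -[in RHS](H j i) -big_split mulr_sumr; apply: eq_bigr => a _ /=.
rewrite -big_split mulr_sumr; apply: eq_bigr => b _ /=.
by rewrite mxE; ring.
Qed.

Lemma riesz_mx_sym_delta i j k : riesz_mx (sym_delta i j) k = riesz i j k :> R.
Proof.
rewrite /riesz_mx; under eq_bigr do under eq_bigr do rewrite mulrC.
have e : riesz j i k = riesz i j k :> R by rewrite /riesz [X in X / _]mulrC.
by rewrite (sum_sym_delta i j (fun a b => riesz a b k)) e; field.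
Qed.

End symmetric_unit.

(** * Estimates for the tested flux *)

Section flux_modulus.
Context {R : realType} {d : nat}.
Variables (T nu : R).
Local Notation point := (R * 'rV[R]_d)%type.
Local Notation Q := (spacetime d T).
Local Notation mu := (torus_measure d).
Local Notation freq := ('rV[int]_d * nat)%type.
Variables (E : point -> 'rV[R]_d) (chi : point -> 'M[R]_d).
Hypotheses (LE : forall i, L2 Q (fun z => E z 0 i))
  (Lc : forall i j, L2 Q (fun z => chi z i j)).
Variables (i j : 'I_d).
Local Notation S := (sym_delta i j : 'M[R]_d).

(** The coefficients in the flux of the first and second derivatives of eta; [riesz_flux] has those
    of the potential Delta^-1 d_i d_j eta. *)
Definition local_flux (a : 'I_d + 'I_d * 'I_d) (z : point) : R :=
  match a with
  | inl b => - \sum_c E z 0 c * S c b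
  | inr p => - (2 * nu * \sum_c chi z p.1 c * S c p.2)
  end.

Definition riesz_flux (a : 'I_d + 'I_d * 'I_d) (z : point) : R :=
  match a with
  | inl b => E z 0 b
  | inr p => 2 * nu * chi z p.1 p.2
  end.

Definition tested_flux (s : seq (R * freq)) (z : point) : R :=
  \sum_a (local_flux a z * tpoly (jet_tp (inr a) s) z.2 +
          riesz_flux a z * tpoly (jet_tp (inr a) (riesz_tp i j s)) z.2).

Lemma fluxE s z :
  flux nu S (tpoly s) (tpoly (riesz_tp i j s)) E chi z = tested_flux s z.
Proof.
rewrite /tested_flux big_split !big_sumType /= /flux.
have h1 : \sum_a \sum_b E z 0 a * (S a b * spartial b (tpoly s) z.2) =
    - \sum_b (- \sum_c E z 0 c * S c b) * tpoly (diff_tp b s) z.2.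
  rewrite exchange_big -sumrN; apply: eq_bigr => b _ /=.
  rewrite mulNr opprK mulr_suml; apply: eq_bigr => a _.
  by rewrite spartial_tpoly mulrA.
have h2 : 2 * nu * (\sum_a \sum_b \sum_l chi z l a * (S a b * spartial l (spartial b (tpoly s)) z.2)) =
    - \sum_p (- (2 * nu * \sum_c chi z p.1 c * S c p.2)) * tpoly (diff_tp p.1 (diff_tp p.2 s)) z.2.
  rewrite -(pair_big xpredT xpredT (fun l b => - (2 * nu * \sum_c chi z l c * S c b) *
    tpoly (diff_tp l (diff_tp b s)) z.2)) /=.
  have rot (F : 'I_d -> 'I_d -> 'I_d -> R) :
      \sum_a \sum_b \sum_l F a b l = \sum_l \sum_b \sum_a F a b l.
    transitivity (\sum_a \sum_l \sum_b F a b l).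
      by apply: eq_bigr => a _; exact: exchange_big.
    by rewrite exchange_big; apply: eq_bigr => l _; exact: exchange_big.
  rewrite (rot (fun a b l => chi z l a * (S a b * spartial l (spartial b (tpoly s)) z.2))).
  rewrite -sumrN mulr_sumr; apply: eq_bigr => l _.
  rewrite -sumrN mulr_sumr; apply: eq_bigr => b _.
  rewrite mulNr opprK -[RHS]mulrA; congr (_ * _); rewrite mulr_suml; apply: eq_bigr => a _.
  by rewrite !spartial_tpoly mulrA.
have h3 : \sum_l E z 0 l * spartial l (tpoly (riesz_tp i j s)) z.2 =
   \sum_l E z 0 l * tpoly (diff_tp l (riesz_tp i j s)) z.2.
  by apply: eq_bigr => l _; rewrite spartial_tpoly.
have h4 : 2 * nu * (\sum_l \sum_k chi z l k * spartial l (spartial k (tpoly (riesz_tp i j s))) z.2) =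
   \sum_p 2 * nu * chi z p.1 p.2 * tpoly (diff_tp p.1 (diff_tp p.2 (riesz_tp i j s))) z.2.
  rewrite pair_big mulr_sumr; apply: eq_bigr => p _ /=.
  by rewrite !spartial_tpoly mulrA.
by rewrite h1 h2 h3 h4; ring.
Qed.

Lemma tested_flux_cons p s z :
  tested_flux (p :: s) z = p.1 * tested_flux [:: (1, p.2)] z + tested_flux s z.
Proof.
have J a s' : jet_tp (R := R) (inr a) (p :: s') = jet_tp (inr a) [:: p] ++ jet_tp (inr a) s'.
  by rewrite -jet_tp_cat.
have pE : [:: p] = scale_tp p.1 [:: (1, p.2)] :> seq (R * freq).
  by rewrite /scale_tp /= mulr1 -surjective_pairing.
rewrite /tested_flux mulr_sumr -big_split; apply: eq_bigr => a _.
have e1 : tpoly (jet_tp (inr a) (p :: s)) z.2 =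
    p.1 * tpoly (jet_tp (inr a) [:: (1, p.2)]) z.2 + tpoly (jet_tp (inr a) s) z.2.
  by rewrite -jet_tp_scale -pE -tpoly_cat -jet_tp_cat.
have e2 : tpoly (jet_tp (inr a) (riesz_tp i j (p :: s))) z.2 =
    p.1 * tpoly (jet_tp (inr a) (riesz_tp i j [:: (1, p.2)])) z.2 +
    tpoly (jet_tp (inr a) (riesz_tp i j s)) z.2.
  have rE : [:: (p.1 * riesz i j p.2.1, p.2)] = scale_tp p.1 (riesz_tp i j [:: (1, p.2)]).
    by rewrite /scale_tp /riesz_tp /= mul1r.
  by rewrite -jet_tp_scale -rE -tpoly_cat -jet_tp_cat.
cbv beta; rewrite e1 e2 /=; ring.
Qed.

Let L2local a : L2 Q (local_flux a).
Proof.
case: a => [b|[l b]] /=.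
  by apply: L2N; apply: L2_sum => c _; under eq_fun do rewrite mulrC; exact: L2Z.
apply: L2N; apply: L2Z; apply: L2_sum => c _; under eq_fun do rewrite mulrC; exact: L2Z.
Qed.

Let L2riesz a : L2 Q (riesz_flux a).
Proof. by case: a => [b|[l b]]; [exact: LE|exact: (L2Z (2 * nu) (Lc l b))]. Qed.

Lemma L1_tested_flux s : L1 Q (tested_flux s).
Proof.
by apply: L1_sum => a _; apply: L1D; apply: L2_mul => //; apply: L2_comp_snd; exact: L2_tpoly.
Qed.

(** The window is its own square and has integral s - t: this is where the exponent 1/2 comes
    from. *)
Lemma window_cauchy_schwarz (P : point -> R) (f : 'rV[R]_d -> R) t s : L2 Q P -> L2 mu f ->
  0 <= t -> t <= s -> s <= T ->
  `|\int[Q]_z (window t s z.1 * (P z * f z.2))| <=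
  Num.sqrt (\int[Q]_z P z ^+ 2) * Num.sqrt (\int[mu]_x f x ^+ 2) * Num.sqrt (s - t).
Proof.
move=> LP Lf t0 ts sT.
have mw : measurable_fun setT (fun z : point => window t s z.1).
  by apply: (measurableT_comp (measurable_window t s)).
have Lf2 : L2 Q (fun z => f z.2) := L2_comp_snd T Lf.
have Lwf : L2 Q (fun z => window t s z.1 * f z.2).
  by apply: (L2_bddM mw (aeW _ _) Lf2) => z; exact: indic_bound.
have := cauchy_schwarz LP Lwf.
have -> : \int[Q]_z (window t s z.1 * f z.2) ^+ 2 = (\int[mu]_x f x ^+ 2) * (s - t).
  under eq_Rintegral do rewrite exprMn window_sqr.
  rewrite (spacetime_fubini_mul (f := window t s) (g := fun z => f z.2 ^+ 2)); last 3 first.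
  - exact: measurable_window.
  - by exists 1; apply: aeW => r; exact: indic_bound.
  - exact: Lf2.2.
  under eq_Rintegral do rewrite mulrC /=.
  rewrite RintgZ ?(integral_window t0 ts sT)//.
  apply: (L1_bounded (C := 1)); first exact: measurable_window.
  by apply: aeW => r; exact: indic_bound.
have p0 : 0 <= \int[Q]_z P z ^+ 2 by apply: Rintg_ge0 => z; exact: sqr_ge0.
have f0 : 0 <= \int[mu]_x f x ^+ 2 by apply: Rintg_ge0 => z; exact: sqr_ge0.
under eq_Rintegral do rewrite mulrCA.
move=> /ler_wsqrtr; rewrite sqrtr_sqr sqrtrM// sqrtrM// mulrA.
by move=> h; exact: h.
Qed.

Definition flux_norm : R := \sum_a (Num.sqrt (\int[Q]_z local_flux a z ^+ 2) +
  Num.sqrt (\int[Q]_z riesz_flux a z ^+ 2)).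

Lemma flux_norm_ge0 : 0 <= flux_norm.
Proof. by apply: sumr_ge0 => a _; rewrite addr_ge0 ?sqrtr_ge0. Qed.

Lemma jet_sqnorm_ge (s : seq (R * freq)) a : \int[mu]_x tpoly (jet_tp a s) x ^+ 2 <= sqnorm mu (jet (tpoly s)).
Proof.
rewrite /sqnorm (bigD1 a)//= jet_tpoly lerDl; apply: sumr_ge0 => b _.
by apply: Rintg_ge0 => x; exact: sqr_ge0.
Qed.

(** The gradient and Hessian estimates for Delta^-1 d_i d_j; the jet of the potential is needed in
    orders one and two only, as the flux contains no zeroth-order term. *)
Lemma riesz_jet_bound (s : seq (R * freq)) a :
  \int[mu]_x tpoly (jet_tp (inr a) (riesz_tp i j s)) x ^+ 2 <= sqnorm mu (jet (tpoly s)).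
Proof.
have Ip s' : 0 <= \int[mu]_x tpoly s' x ^+ 2.
  by apply: Rintg_ge0 => x; exact: sqr_ge0.
case: a => [b|[l b]] /=.
  apply: le_trans (jet_sqnorm_ge s (inr (inl j))).
  apply: le_trans (riesz_grad_bound i j s); rewrite (bigD1 b)//= lerDl.
  by apply: sumr_ge0 => c _.
apply: le_trans (jet_sqnorm_ge s (inr (inr (i, j)))) => /=.
rewrite -(riesz_hess_bound i j s) (bigD1 l)//= (bigD1 b)//= -addrA lerDl.
by rewrite addr_ge0//; apply: sumr_ge0 => c _ //; apply: sumr_ge0.
Qed.

(** The constant sees s only through the H^2 norm of [tpoly s], not through its frequencies or its
    length, and so it survives a limit over s. *)
Lemma flux_modulus s t r : 0 <= t -> t <= r -> r <= T ->
  `|\int[Q]_z (window t r z.1 * tested_flux s z)| <=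
  flux_norm * Num.sqrt (sqnorm mu (jet (tpoly s))) * Num.sqrt (r - t).
Proof.
move=> t0 tr rT.
have mw : measurable_fun setT (fun z : point => window t r z.1).
  by apply: (measurableT_comp (measurable_window t r)).
have Lw (f : point -> R) : L1 Q f -> L1 Q (fun z => window t r z.1 * f z).
  by move=> Lf; apply: (L1_bddM mw (aeW _ _) Lf) => z; exact: indic_bound.
have LP (P : point -> R) s' : L2 Q P -> L1 Q (fun z => window t r z.1 * (P z * tpoly s' z.2)).
  by move=> LP; apply: Lw; apply: L2_mul => //; apply: L2_comp_snd; exact: L2_tpoly.
have -> : \int[Q]_z (window t r z.1 * tested_flux s z) =
    \sum_a (\int[Q]_z (window t r z.1 * (local_flux a z * tpoly (jet_tp (inr a) s) z.2)) +
     \int[Q]_z (window t r z.1 * (riesz_flux a z * tpoly (jet_tp (inr a) (riesz_tp i j s)) z.2))).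
  under eq_Rintegral do rewrite mulr_sumr.
  rewrite Rintg_sum; last first.
    by move=> a _; apply: Lw; apply: L1D; apply: L2_mul => //; apply: L2_comp_snd; exact: L2_tpoly.
  apply: eq_bigr => a _; rewrite -RintgD; [|exact: LP|exact: LP].
  by apply: eq_Rintegral => z _; rewrite mulrDr.
apply: (le_trans (ler_norm_sum _ _ _)); rewrite /flux_norm !mulr_suml; apply: ler_sum => a _.
apply: (le_trans (ler_normD _ _)); rewrite !mulrDl; apply: lerD.
  apply: (le_trans (window_cauchy_schwarz _ _ t0 tr rT)) => //; first exact: L2_tpoly.
  by rewrite ler_wpM2r ?sqrtr_ge0// ler_wpM2l ?sqrtr_ge0// ler_wsqrtr// jet_sqnorm_ge.
apply: (le_trans (window_cauchy_schwarz _ _ t0 tr rT)) => //; first exact: L2_tpoly.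
by rewrite ler_wpM2r ?sqrtr_ge0// ler_wpM2l ?sqrtr_ge0// ler_wsqrtr// riesz_jet_bound.
Qed.

End flux_modulus.

(** * Hoelder continuity of the pairings *)

Section holder.
Context {R : realType} {d : nat}.
Variables (T nu : R).
Hypothesis T0 : 0 < T.
Local Notation point := (R * 'rV[R]_d)%type.
Local Notation Q := (spacetime d T).
Local Notation mu := (torus_measure d).
Local Notation freq := ('rV[int]_d * nat)%type.
Variables (E : point -> 'rV[R]_d) (B chi : point -> 'M[R]_d) (Cb : R).
Hypotheses (EB : EBPsi T nu E B chi)
  (bB : forall i j, \forall z \ae Q, `|B z i j| <= Cb).

Let LE i : L2 Q (fun z => E z 0 i). Proof. by have [] := EBPsi_admissible EB. Qed.
Let Lc i j : L2 Q (fun z => chi z i j). Proof. by have [] := EBPsi_admissible EB. Qed.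
Let mB i j : measurable_fun setT (fun z => B z i j).
Proof. by have [] := EBPsi_admissible EB. Qed.

Local Notation G i j := (tested_flux nu E chi i j).

Lemma tested_flux_sum i j (s : seq (R * freq)) z :
  G i j s z = \sum_(p <- s) p.1 * G i j [:: (1, p.2)] z.
Proof.
elim: s => [|p s IH].
  rewrite big_nil /tested_flux; apply: big1 => a _.
  by case: a => [b|[l b]] /=; rewrite /tpoly !big_nil !mulr0 addr0.
by rewrite tested_flux_cons IH big_cons.
Qed.

Lemma EB_entry_moments i j (q : freq) n :
  - (\int[Q]_z (B z i j * (n.+1%:R * z.1 ^+ n * wave q.1 q.2 z.2))) =
  \int[Q]_z (z.1 ^+ n.+1 * G i j [:: (1, q)] z).
Proof.
have [_ _ _ [sB _] heq] := EB.
have := EB_equation_monomial_wave n q.1 q.2 heq (sym_delta_sym i j).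
have -> : \int[Q]_z (\sum_a \sum_b B z a b *
      (n.+1%:R * z.1 ^+ n * (sym_delta i j a b * wave q.1 q.2 z.2))) =
    \int[Q]_z (B z i j * (n.+1%:R * z.1 ^+ n * wave q.1 q.2 z.2)).
  apply: eq_Rintegral => z _.
  transitivity ((\sum_a \sum_b B z a b * sym_delta i j a b) * (n.+1%:R * z.1 ^+ n * wave q.1 q.2 z.2)).
    rewrite mulr_suml; apply: eq_bigr => a _; rewrite mulr_suml; apply: eq_bigr => b _.
    by ring.
  rewrite sum_sym_delta.
  have -> : B z j i = B z i j by rewrite -[in LHS](sB z) mxE.
  by congr (_ * _); field.
move=> ->; apply: eq_Rintegral => z _; congr (_ * _).
have e1 : wave q.1 q.2 = tpoly [:: (1, q)] :> ('rV[R]_d -> R).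
  by apply/funext => x; rewrite /tpoly big_seq1 mul1r.
have e2 : (fun x => riesz_mx (sym_delta i j) q.1 * wave q.1 q.2 x) =
    tpoly (riesz_tp i j [:: (1, q)]) :> ('rV[R]_d -> R).
  by apply/funext => x; rewrite /tpoly big_seq1 /= mul1r riesz_mx_sym_delta.
by rewrite e2 e1 fluxE.
Qed.

(** The waves form a countable family, as the construction of the curve demands. What extends to
    polynomials by linearity is the identity for the increments: summing the estimates wave by wave
    would lose the H^2 norm. *)
Lemma entry_curve i j : exists bt : R -> 'rV[R]_d -> R,
  [/\ \forall t \ae leb0 T, forall x, bt t x = B (t, x) i j,
      forall t, 0 <= t <= T -> measurable_fun setT (bt t),
      forall t, 0 <= t <= T -> \forall x \ae mu, `|bt t x| <= Cb
    & forall (s : seq (R * freq)) t r, 0 <= t -> t <= r -> r <= T ->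
      \int[mu]_x (tpoly s x * bt r x) - \int[mu]_x (tpoly s x * bt t x) =
      \int[Q]_z (window t r z.1 * G i j s z)].
Proof.
have LGq s : L1 Q (G i j s) := L1_tested_flux nu LE Lc i j s.
pose M (q : freq) := flux_norm T nu E chi i j * Num.sqrt (sqnorm mu (jet (tpoly [:: (1, q)]))).
have M0 q : 0 <= M q by rewrite mulr_ge0 ?sqrtr_ge0 ?flux_norm_ge0.
have [bt [b1 b2 b3 b4]] := weak_curve (w := fun q : freq => wave q.1 q.2) T0
  (fun q => measurable_wave q.1 q.2) (fun q x => wave_le1 q.1 q.2 x) (mB i j) (bB i j)
  (fun q => LGq [:: (1, q)]) M0 (EB_entry_moments i j)
  (fun q => @flux_modulus _ _ _ nu _ _ LE Lc i j [:: (1, q)]).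
exists bt; split => // s t r t0 tr rT.
have Lw t' (q : freq) : 0 <= t' <= T -> L1 mu (fun x => wave q.1 q.2 x * bt t' x).
  move=> tT; apply: (L1_bddM (C := 1)); first exact: measurable_wave.
    by apply: aeW => x; exact: wave_le1.
  exact: L1_bounded (b2 _ tT) (b3 _ tT).
have E1 t' : 0 <= t' <= T -> \int[mu]_x (tpoly s x * bt t' x) =
    \sum_(p <- s) p.1 * \int[mu]_x (wave p.2.1 p.2.2 x * bt t' x).
  move=> tT; under eq_Rintegral do rewrite /tpoly mulr_suml.
  under eq_Rintegral do under eq_bigr do rewrite -mulrA.
  rewrite Rintg_sum; last by move=> p _; apply: L1Z; exact: Lw.
  by apply: eq_bigr => p _; rewrite RintgZ//; exact: Lw.
rewrite !E1 ?t0 ?rT ?(le_trans t0 tr) ?(le_trans tr rT)// -sumrB.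
have Lwin (f : point -> R) : L1 Q f -> L1 Q (fun z => window t r z.1 * f z).
  move=> Lf; apply: (L1_bddM _ (aeW _ _) Lf) => [|z]; last exact: indic_bound.
  by apply: (measurableT_comp (measurable_window t r)).
under [RHS]eq_Rintegral do rewrite tested_flux_sum mulr_sumr.
under [RHS]eq_Rintegral do under eq_bigr do rewrite mulrCA.
rewrite Rintg_sum; last by move=> p _; apply: L1Z; exact: Lwin.
apply: eq_bigr => p _; rewrite RintgZ; last exact: Lwin.
by rewrite -mulrBr b4.
Qed.

(** A trigonometric polynomial close to psi in H^2 has the exact increment formula. Replacing psi by
    it changes the pairing at every time by at most a small error, because the slices are bounded in
    L^2 uniformly in time. *)
Lemma entry_holder i j (bt : R -> 'rV[R]_d -> R) (psi : 'rV[R]_d -> R) :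
  (forall t, 0 <= t <= T -> measurable_fun setT (bt t)) ->
  (forall t, 0 <= t <= T -> \forall x \ae mu, `|bt t x| <= Cb) ->
  (forall (s : seq (R * freq)) t r, 0 <= t -> t <= r -> r <= T ->
      \int[mu]_x (tpoly s x * bt r x) - \int[mu]_x (tpoly s x * bt t x) =
      \int[Q]_z (window t r z.1 * G i j s z)) ->
  Ck 2 psi -> torus_periodic psi ->
  exists K, 0 <= K /\ forall t r, 0 <= t -> t <= r -> r <= T ->
    `|\int[mu]_x (psi x * bt r x) - \int[mu]_x (psi x * bt t x)| <= K * Num.sqrt (r - t).
Proof.
move=> mbt bbt Hbt Cpsi ppsi.
pose F := flux_norm T nu E chi i j; have F0 : 0 <= F by exact: flux_norm_ge0.
(* Bounds the squared H^2 norm of every approximant of psi whose squared error is at most 1, so the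
   constant does not depend on the approximant. *)
pose N := 2 * sqnorm mu (jet psi) + 2.
exists (F * Num.sqrt N); split; first by rewrite mulr_ge0 ?sqrtr_ge0.
move=> t r t0 tr rT.
have tT : 0 <= t <= T by rewrite t0 (le_trans tr).
have rTT : 0 <= r <= T by rewrite rT (le_trans t0).
pose L := Num.sqrt (Cb ^+ 2 * fine (mu setT)).
have Lbt t' : 0 <= t' <= T -> L2 mu (bt t') by move=> h; exact: L2_bounded (mbt _ h) (bbt _ h).
have L0 : 0 <= L by exact: sqrtr_ge0.
have Lpsi : L2 mu psi by exact: (L2_jet (inl tt) Cpsi ppsi).
apply/ler_addgt0Pr => e e0.
(* The errors at the two times add up to 2 L e1, which must not exceed e; L + 1 guards against L =
   0, and the cap 1 serves the choice of [N]. *)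
pose e1 := Num.min 1 (e / (2 * (L + 1))).
have e10 : 0 < e1 by rewrite lt_min ltr01 divr_gt0//; lra.
have e1e : 2 * (L * e1) <= e.
  have : e1 * (2 * (L + 1)) <= e by rewrite -ler_pdivlMr ?ge_min ?lexx ?orbT//; lra.
  have : 0 <= e1 by exact: ltW.
  lra.
have e11 : e1 <= 1 by rewrite ge_min lexx.
have [s Hs] := tpoly_dense Cpsi ppsi (exprn_gt0 2 e10).
have Lt : L2 mu (tpoly s) by exact: L2_tpoly.
have res : \int[mu]_x (psi x - tpoly s x) ^+ 2 <= e1 ^+ 2.
  apply: le_trans Hs; rewrite /sqnorm (bigD1 (inl tt))//= lerDl.
  by apply: sumr_ge0 => a _; apply: Rintg_ge0 => x; exact: sqr_ge0.
have close t' : 0 <= t' <= T ->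
    `|\int[mu]_x (psi x * bt t' x) - \int[mu]_x (tpoly s x * bt t' x)| <= L * e1.
  move=> h; rewrite -RintgB; [|by apply: L2_mul => //; exact: Lbt|by apply: L2_mul => //; exact: Lbt].
  under eq_Rintegral do rewrite -mulrBl mulrC.
  have := cauchy_schwarz (Lbt _ h) (L2B Lpsi Lt).
  have bt2 : \int[mu]_x bt t' x ^+ 2 <= L ^+ 2.
    rewrite sqr_sqrtr; last by rewrite mulr_ge0 ?sqr_ge0// fine_ge0.
    rewrite -Rintg_cst; apply: ae_le_Rintg; [exact: (Lbt _ h).2|exact: L1_cst|].
    apply: filterS (bbt _ h) => x bx.
    by rewrite -[leLHS]real_normK ?num_real// lerXn2r ?nnegrE// (le_trans _ bx).
  have b0 : 0 <= \int[mu]_x bt t' x ^+ 2 by apply: Rintg_ge0 => x; exact: sqr_ge0.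
  have p0 : 0 <= \int[mu]_x (psi x - tpoly s x) ^+ 2 by apply: Rintg_ge0 => x; exact: sqr_ge0.
  move=> /le_trans /(_ (ler_pM b0 p0 bt2 res)); rewrite -exprMn.
  rewrite -[X in X <= _ -> _]real_normK ?num_real// ler_pXn2r ?nnegrE//.
  by rewrite mulr_ge0// ltW.
have normN : sqnorm mu (jet (tpoly s)) <= N.
  have -> : sqnorm mu (jet (tpoly s)) = \sum_a \int[mu]_x tpoly (jet_tp a s) x ^+ 2.
    by apply: eq_bigr => a _; rewrite jet_tpoly.
  apply: (@le_trans _ _ (2 * sqnorm mu (jet psi) + 2 * sqnorm mu (residual psi s))); last first.
    rewrite lerD2l -[leRHS]mulr1 ler_wpM2l// (le_trans Hs)// expr_le1// ltW//.
  rewrite /sqnorm !mulr_sumr -big_split; apply: ler_sum => a _ /=.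
  have [_ L1j] := L2_jet a Cpsi ppsi.
  have [_ L1r] := L2_residual Cpsi ppsi s a.
  rewrite -!RintgZ// -RintgD; [|exact: L1Z|exact: L1Z].
  apply: le_Rintg; [exact: (L2_tpoly _).2|by apply: L1D; exact: L1Z|].
  move=> x; rewrite /residual; set u := jet psi a x; set v := tpoly _ x.
  by have := sqr_ge0 (2 * u - v); lra.
have main : `|\int[mu]_x (tpoly s x * bt r x) - \int[mu]_x (tpoly s x * bt t x)| <=
    F * Num.sqrt N * Num.sqrt (r - t).
  rewrite Hbt//; apply: le_trans (flux_modulus nu LE Lc i j s t0 tr rT) _.
  by rewrite ler_wpM2r ?sqrtr_ge0// ler_wpM2l// ler_wsqrtr.
move: (close _ tT) (close _ rTT) main; rewrite !ler_norml.
by move=> /andP[? ?] /andP[? ?] /andP[? ?]; apply/andP; split; lra.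
Qed.

Lemma EBPsi_holder : holder_half_weakstar T B.
Proof.
have [bt Hbt] := choice (fun p : 'I_d * 'I_d => entry_curve p.1 p.2).
have b1 i j := let: And4 h _ _ _ := Hbt (i, j) in h.
have b2 i j := let: And4 _ h _ _ := Hbt (i, j) in h.
have b3 i j := let: And4 _ _ h _ := Hbt (i, j) in h.
have b4 i j := let: And4 _ _ _ h := Hbt (i, j) in h.
rewrite /= in b1 b2 b3 b4.
exists (fun t x => \matrix_(i, j) bt (i, j) t x); split.
- have H : \forall t \ae leb0 T, forall i j x, bt (i, j) t x = B (t, x) i j.
    by apply: filter_forall => i; apply: filter_forall => j; exact: b1.
  apply: filterS H => t Ht; apply: aeW => x.
  by apply/matrixP => i j; rewrite mxE.
- move=> t; rewrite in_itv/= => tT i j; under eq_fun do rewrite mxE.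
  have L := L1_bounded (b2 i j t tT) (b3 i j t tT).
  by apply/Lfun1_integrable.
move=> psi Hpsi _ pairing.
have [K HK] := choice (fun p : 'I_d * 'I_d => entry_holder (b2 p.1 p.2) (b3 p.1 p.2) (b4 p.1 p.2)
  (Hpsi p.1 p.2).1 (Hpsi p.1 p.2).2).
have Lp i j t : 0 <= t <= T -> L1 mu (fun x => psi x i j * bt (i, j) t x).
  move=> tT; apply: L2_mul; first exact: (L2_jet (inl tt) (Hpsi i j).1 (Hpsi i j).2).
  exact: L2_bounded (b2 i j t tT) (b3 i j t tT).
have pE t : 0 <= t <= T -> pairing t = \sum_i \sum_j \int[mu]_x (psi x i j * bt (i, j) t x).
  move=> tT; rewrite /pairing; under eq_Rintegral do under eq_bigr do under eq_bigr do rewrite mxE mulrC.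
  rewrite Rintg_sum; last by move=> i _; apply: L1_sum => j _; exact: Lp.
  by apply: eq_bigr => i _; rewrite Rintg_sum// => j _; exact: Lp.
exists (\sum_i \sum_j K (i, j)) => t s; rewrite !in_itv/=.
wlog ts : t s / t <= s => [H|tT sT].
  have [ts|/ltW st] := leP t s; first exact: H.
  by move=> h1 h2; rewrite distrC [`|s - t|]distrC; exact: H.
rewrite !pE// (ger0_norm (_ : 0 <= s - t)) ?subr_ge0//.
rewrite -sumrB mulr_suml (le_trans (ler_norm_sum _ _ _))//; apply: ler_sum => i _.
rewrite -sumrB mulr_suml (le_trans (ler_norm_sum _ _ _))//; apply: ler_sum => j _.
have [_] := HK (i, j); apply => //.
  by case/andP: tT.
by case/andP: sT.
Qed.

End holder.

Theorem theorem4p1 (R : realType) (d : nat) (hd : d = 2%N \/ d = 3%N)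
  (T nu aV aW : R) (hT : 0 < T) (hnu : 0 < nu) (haV : 0 < aV) (haW : 0 < aW)
  (V0 : 'rV[R]_d -> 'rV[R]_d) (gradV0 : 'rV[R]_d -> 'M[R]_d)
  (hV0 : Lvec (torus_measure d) 2%:E V0)
  (hV0div : weakly_divergence_free V0)
  (hV0mean : zero_mean V0)
  (hgradV0 : is_weak_gradient V0 gradV0)
  (hgradV0L2 : Lmat (torus_measure d) 2%:E gradV0)
  (Vbar : R * 'rV[R]_d -> 'rV[R]_d) (Wbar : R * 'rV[R]_d -> 'M[R]_d)
  (hVbar : Lvec (spacetime d T) 2%:E Vbar)
  (hWbar : Lmat (spacetime d T) 2%:E Wbar) :
  exists (E : R * 'rV[R]_d -> 'rV[R]_d) (B chi : R * 'rV[R]_d -> 'M[R]_d),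
    [/\ EBPsi T nu E B chi,
        dual_functional T nu aV aW Vbar Wbar V0 gradV0 E B chi =
          J_NS T nu aV aW Vbar Wbar V0 gradV0
      & holder_half_weakstar T B].
Proof.
have T0 := ltW hT.
have LV0 i := Lfun2_L2 (hV0 i).
have LG i j := Lfun2_L2 (hgradV0L2 i j).
have LVb i := Lfun2_L2 (hVbar i).
have LWb i j := Lfun2_L2 (hWbar i j).
have [E [B [chi [EB dJ bB]]]] := exists_maximiser nu T0 haV haW LV0 LG LVb LWb.
by exists E, B, chi; split => //; exact: (EBPsi_holder hT EB bB).
Qed.
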